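(* Let $\mu_0\in\mathcal P_2(\mathbb R^d)$ be compactly supported. Assume that $W$ is convex and that $W\in C^{1,s}_{loc}(\mathbb R^d)$. Then the gradient flow solution $\mu\in C([0,T];\mathcal P_2(\mathbb R^d))$ with initial datum $\mu_0$ of the aggregation equation $$\partial_t\mu_t=\nabla\cdot(\mu_t\,\nabla W*\mu_t)$$ is a dual viscosity solution of this equation.
   Context: $T>0$ is a time horizon and $W:\mathbb R^d\to\mathbb R$ is an interaction potential; $W\in C^{1,s}_{loc}$ means that $W$ is $C^1$ and $\nabla W$ is locally Hölder continuous with exponent $s$. $\mathcal P_p(\mathbb R^d)$ denotes the Borel probability measures with finite $p$-th moment, with the $p$-Wasserstein distance $d_p$. The gradient flow solution is the 2-Wasserstein gradient flow (curve of steepest descent in $(\mathcal P_2(\mathbb R^d),d_2)$, in the sense of Ambrosio–Gigli–Savaré), starting at $\mu_0$, of the interaction energy $\mathcal F[\mu]=\frac12\int_{\mathbb R^d}\int_{\mathbb R^d}W(x-y)\,d\mu(x)\,d\mu(y)$. Viscosity solutions. For a continuous field $b:[0,\tau]\times\mathbb R^d\to\mathbb R^d$, a function $\psi\in C([0,\tau]\times\mathbb R^d)$ is a viscosity sub-solution of $\partial_s\psi_s=b_s\cdot\nabla\psi_s$ if for every $z_0=(s_0,x_0)\in[0,\tau]\times\mathbb R^d$, every neighbourhood $U$ of $z_0$ and every $\varphi\in C^2(U)$ with $\varphi\ge\psi$ on $U$ and $\varphi(z_0)=\psi(z_0)$, one has $\partial_s\varphi(z_0)\le b_{s_0}(x_0)\cdot\nabla\varphi(z_0)$.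 It is a super-solution if the inequalities are reversed for functions $\varphi$ touching from below, and a viscosity solution if it is both. Dual viscosity solution. $\mu$ is a dual viscosity solution of $\partial_t\mu_t=\nabla\cdot(\mu_t\nabla W*\mu_t)$ if there is a family $\{\Psi^\tau\}$ such that for every $\tau\ge0$ in the time interval considered: (1) $\Psi^\tau$ is a linear map from $\{\psi_0:\nabla\psi_0\in L^\infty(\mathbb R^d)\}$ to $\{\psi\in C([0,\tau]\times\mathbb R^d):\psi/(1+|x|)\in L^\infty((0,\tau)\times\mathbb R^d)\}$ such that for every $\psi_0$, $\psi^\tau=\Psi^\tau[\psi_0]$ is a viscosity solution of $\partial_s\psi^\tau_s=-(\nabla W*\mu_{\tau-s})\cdot\nabla\psi^\tau_s$, $s\in[0,\tau]$, with $\psi^\tau_0=\psi_0$; (2) $\mu_\tau\in\mathcal P_1(\mathbb R^d)$ and $\int\psi_0\,d\mu_\tau=\int\psi^\tau_\tau\,d\mu_0$ for all such $\psi_0$.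
   Formalization: W is also assumed even: for W(x)=a·x the gradient flow of F is constant while the equation translates μ0. Viscosity tests are imposed at times 0<s0≤τ only, since at s0=0 the function φ=s would exclude even ψ=0. *)

(* Defs.v *)
From HB Require Import structures.
From mathcomp Require Import all_boot all_order all_algebra.
From mathcomp Require Import all_classical all_reals all_analysis.

Set Implicit Arguments.
Unset Strict Implicit.
Unset Printing Implicit Defensive.

Import Order.TTheory GRing.Theory Num.Theory.
Import numFieldNormedType.Exports.

Local Open Scope classical_set_scope.
Local Open Scope ring_scope.

(* The library norm on ['rV[R]_d] is the sup norm: it is used only through the
   topology and the differential calculus, which do not depend on the norm.
   Distances, moments and costs use the Euclidean norm [enorm]. *)
Definition dotp (R : realType) (d : nat) (x y : 'rV[R]_d) : R :=
  \sum_(i < d) x 0 i * y 0 i.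

Definition enorm (R : realType) (d : nat) (x : 'rV[R]_d) : R :=
  Num.sqrt (dotp x x).

Definition grad (R : realType) (d : nat) (f : 'rV[R]_d -> R) (x : 'rV[R]_d)
    : 'rV[R]_d :=
  \row_(i < d) 'D_(delta_mx 0 i) f x.

Definition C1_on (R : realType) (V : normedModType R) (U : set V) (f : V -> R) :=
  (forall x, U x -> differentiable f x) /\
  (forall v x, U x -> {for x, continuous ('D_v f)}).

Definition C2_on (R : realType) (V : normedModType R) (U : set V) (f : V -> R) :=
  C1_on U f /\ (forall v, C1_on U ('D_v f)).

Definition C1_holder_loc (R : realType) (d : nat) (s : R) (W : 'rV[R]_d -> R) :=
  C1_on setT W /\
  forall K : set 'rV[R]_d, compact K ->
    exists C : R, forall x y, K x -> K y ->
      enorm (grad W x - grad W y) <= C * enorm (x - y) `^ s.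

Definition borelRd (R : realType) (d : nat) :=
  g_sigma_algebraType (@open 'rV[R]_d).

Definition finite_moment (R : realType) (d : nat) (p : R)
    (mu : probability (borelRd R d) R) : Prop :=
  (\int[mu]_x ((enorm (x : 'rV[R]_d)) `^ p)%:E < +oo)%E.

Definition Pp (R : realType) (d : nat) (p : R) : Type :=
  {mu : probability (borelRd R d) R | finite_moment p mu}.
Arguments Pp : clear implicits.

Definition coupling (R : realType) (d : nat)
    (mu nu : probability (borelRd R d) R)
    (gamma : probability (borelRd R d * borelRd R d)%type R) : Prop :=
  forall A : set (borelRd R d), measurable A ->
    gamma (A `*` setT) = mu A /\ gamma (setT `*` A) = nu A.

Definition wasserstein (R : realType) (d : nat) (p : R)
    (mu nu : Pp R d p) : R :=
  (fine (ereal_inf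
    [set (\int[gamma]_z ((enorm (z.1 - z.2 : 'rV[R]_d)) `^ p)%:E)%E
    | gamma in coupling (sval mu) (sval nu)])) `^ p^-1.

Definition compactly_supported (R : realType) (d : nat)
    (mu : probability (borelRd R d) R) : Prop :=
  exists2 K : set 'rV[R]_d, compact K & mu (~` K) = 0%E.

Definition continuous_curve (R : realType) (S : Type) (dist : S -> S -> R)
    (T : R) (u : R -> S) : Prop :=
  forall t, t \in `[0, T] ->
    dist (u s) (u t) @[s --> within [set` `[0, T]] (nbhs t)] --> (0 : R).

Definition AC_loc (R : realType) (S : Type) (dist : S -> S -> R)
    (a b : R) (u : R -> S) : Prop :=
  exists m : R -> R,
    (forall s t : R, a < s -> s <= t -> t < b ->
      lebesgue_measure.-integrable `[s, t] (EFin \o m)) /\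
    (forall s t : R, a < s -> s <= t -> t < b ->
      dist (u s) (u t) <= \int[lebesgue_measure]_(r in `[s, t]) m r).

Definition is_metric_derivative (R : realType) (S : Type) (dist : S -> S -> R)
    (u : R -> S) (t m : R) : Prop :=
  dist (u s) (u t) / `|s - t| @[s --> t^'] --> m.

(* limsup_{w -> v} (phi v - phi w)^+ / dist v w *)
Definition local_slope (R : realType) (S : Type) (dist : S -> S -> R)
    (phi : S -> \bar R) (v : S) : \bar R :=
  if phi v \is a fin_num then
    ereal_inf [set ereal_sup
        [set (maxe 0 (phi v - phi w) * ((dist v w)^-1)%:E)%E
        | w in [set w | 0 < dist v w < r]]
      | r in [set r : R | 0 < r]]
  else +oo%E.

(* Curve of maximal slope of phi in the sense of Ambrosio-Gigli-Savare, for the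
   upper gradient given by the local slope |d phi|: f' <= -|u'|^2/2 - |d phi|^2(u)/2
   almost everywhere, f being a non-increasing version of phi o u. *)
Definition maximal_slope_curve (R : realType) (S : Type) (dist : S -> S -> R)
    (phi : S -> \bar R) (a b : R) (u : R -> S) : Prop :=
  AC_loc dist a b u /\
  exists f : R -> R,
  [/\ forall s t : R, a < s -> s <= t -> t < b -> f t <= f s,
      {ae lebesgue_measure, forall t : R, t \in `]a, b[ ->
        phi (u t) = (f t)%:E} &
      {ae lebesgue_measure, forall t : R, t \in `]a, b[ ->
        derivable f t 1 /\
        exists m : R, is_metric_derivative dist u t m /\
          ((derive1 f t)%:E <= - (2^-1 * m ^+ 2)%:E
             - (2^-1)%:E * (local_slope dist phi (u t) ^+ 2))%E}].

Definition interaction_energy (R : realType) (d : nat) (W : 'rV[R]_d -> R)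
    (mu : Pp R d 2) : \bar R :=
  ((2^-1)%:E *
    \int[sval mu]_x \int[sval mu]_y (W ((x : 'rV[R]_d) - y))%:E)%E.

Definition gradient_flow (R : realType) (d : nat) (T : R) (W : 'rV[R]_d -> R)
    (mu0 : Pp R d 2) (mu : R -> Pp R d 2) : Prop :=
  [/\ mu 0 = mu0,
      continuous_curve (@wasserstein R d 2) T mu &
      maximal_slope_curve (@wasserstein R d 2) (interaction_energy W) 0 T mu].

(* nabla W * mu; the convolution is meaningful where [conv_grad_defined] *)
Definition conv_grad (R : realType) (d : nat) (W : 'rV[R]_d -> R)
    (mu : probability (borelRd R d) R) (x : 'rV[R]_d) : 'rV[R]_d :=
  \row_(i < d) (\int[mu]_y (grad W (x - (y : 'rV[R]_d)) 0 i)).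

Definition conv_grad_defined (R : realType) (d : nat) (W : 'rV[R]_d -> R)
    (mu : probability (borelRd R d) R) : Prop :=
  forall (x : 'rV[R]_d) (i : 'I_d),
    mu.-integrable setT
      (fun y : borelRd R d => (grad W (x - (y : 'rV[R]_d)) 0 i)%:E).

Definition slab (R : realType) (d : nat) (tau : R)
    : set (R * 'rV[R]_d) :=
  [set z | z.1 \in `[0, tau]].

Definition dtime (R : realType) (d : nat) (phi : R * 'rV[R]_d -> R)
    (z : R * 'rV[R]_d) : R := 'D_((1, 0) : R * 'rV[R]_d) phi z.

Definition dspace (R : realType) (d : nat) (phi : R * 'rV[R]_d -> R)
    (z : R * 'rV[R]_d) : 'rV[R]_d :=
  \row_(i < d) 'D_((0, delta_mx 0 i) : R * 'rV[R]_d) phi z.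

(* Sub-solution of [d_s psi = b . grad psi] on [0, tau] x R^d.  The test
   functions are C^2 on an open set U of R x R^d and touch psi on the part of U
   where psi lives.  The tested points have 0 < s0 <= tau: with s0 = 0, where the
   initial datum is prescribed, adding [K s] to a function touching from above
   preserves the contact and makes [d_s phi] as large as desired, so that no
   function at all would pass the test. *)
Definition viscosity_subsolution (R : realType) (d : nat) (tau : R)
    (b : R * 'rV[R]_d -> 'rV[R]_d) (psi : R * 'rV[R]_d -> R) : Prop :=
  forall z0 : R * 'rV[R]_d, 0 < z0.1 <= tau ->
  forall (U : set (R * 'rV[R]_d)) (phi : R * 'rV[R]_d -> R),
    open U -> U z0 -> C2_on U phi ->
    (forall z, U z -> slab tau z -> psi z <= phi z) -> phi z0 = psi z0 ->
    dtime phi z0 <= dotp (b z0) (dspace phi z0).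

Definition viscosity_supersolution (R : realType) (d : nat) (tau : R)
    (b : R * 'rV[R]_d -> 'rV[R]_d) (psi : R * 'rV[R]_d -> R) : Prop :=
  forall z0 : R * 'rV[R]_d, 0 < z0.1 <= tau ->
  forall (U : set (R * 'rV[R]_d)) (phi : R * 'rV[R]_d -> R),
    open U -> U z0 -> C2_on U phi ->
    (forall z, U z -> slab tau z -> phi z <= psi z) -> phi z0 = psi z0 ->
    dotp (b z0) (dspace phi z0) <= dtime phi z0.

Definition viscosity_solution (R : realType) (d : nat) (tau : R)
    (b : R * 'rV[R]_d -> 'rV[R]_d) (psi : R * 'rV[R]_d -> R) : Prop :=
  [/\ {within slab tau, continuous b},
      {within slab tau, continuous psi},
      viscosity_subsolution tau b psi &
      viscosity_supersolution tau b psi].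

(* Lebesgue integral over R^d as an iterated integral; it is used below for
   bounded Borel functions with compact support only, so Fubini applies. *)
Fixpoint integral_Rd (R : realType) (d : nat) : ('rV[R]_d -> R) -> R :=
  match d with
  | 0 => fun f => f 0
  | d'.+1 => fun f =>
      \int[lebesgue_measure]_t
        integral_Rd (fun y : 'rV[R]_d' => f (row_mx (t%:M : 'rV[R]_1) y))
  end.

Definition C1_compact (R : realType) (d : nat) (phi : 'rV[R]_d -> R) : Prop :=
  C1_on setT phi /\
  exists2 K : set 'rV[R]_d, compact K & forall x, ~ K x -> phi x = 0.

Definition is_weak_gradient (R : realType) (d : nat)
    (psi : 'rV[R]_d -> R) (g : 'rV[R]_d -> 'rV[R]_d) : Prop :=
  forall (phi : 'rV[R]_d -> R) (i : 'I_d), C1_compact phi ->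
    integral_Rd (fun x => psi x * grad phi x 0 i)
    = - integral_Rd (fun x => g x 0 i * phi x).

(* {psi : nabla psi in L^oo(R^d)}; psi is its continuous representative, and the
   class of its gradient in L^oo has a representative that is bounded
   everywhere. *)
Definition bounded_gradient (R : realType) (d : nat)
    (psi : 'rV[R]_d -> R) : Prop :=
  continuous psi /\
  exists g : 'rV[R]_d -> 'rV[R]_d,
  [/\ forall i : 'I_d, measurable_fun setT (fun x : borelRd R d => g x 0 i),
      exists C : R, forall x, enorm (g x) <= C &
      is_weak_gradient psi g].

(* {psi in C([0, tau] x R^d) : psi / (1 + |x|) in L^oo((0, tau) x R^d)} *)
Definition linear_growth (R : realType) (d : nat) (tau : R)
    (psi : R * 'rV[R]_d -> R) : Prop :=
  {within slab tau, continuous psi} /\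
  exists C : R, forall (s : R) x, 0 < s < tau ->
    `|psi (s, x) / (1 + enorm x)| <= C.

Definition dual_viscosity_solution (R : realType) (d : nat) (T : R)
    (W : 'rV[R]_d -> R) (mu : R -> probability (borelRd R d) R) : Prop :=
  (forall t : R, 0 <= t <= T -> conv_grad_defined W (mu t)) /\
  exists Psi : R -> ('rV[R]_d -> R) -> (R * 'rV[R]_d -> R),
  forall tau : R, 0 <= tau <= T ->
  [/\ forall (a : R) (f g : 'rV[R]_d -> R),
        bounded_gradient f -> bounded_gradient g ->
        forall z, slab tau z ->
          Psi tau (fun x => a * f x + g x) z
          = a * Psi tau f z + Psi tau g z,
      forall psi0 : 'rV[R]_d -> R, bounded_gradient psi0 ->
        [/\ linear_growth tau (Psi tau psi0),
            viscosity_solution tau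
              (fun z => - conv_grad W (mu (tau - z.1)) z.2) (Psi tau psi0) &
            forall x, Psi tau psi0 (0, x) = psi0 x],
      finite_moment 1 (mu tau) &
      forall psi0 : 'rV[R]_d -> R, bounded_gradient psi0 ->
        (\int[mu tau]_x (psi0 x)%:E
         = \int[mu 0%R]_x (Psi tau psi0 (tau, x))%:E)%E].

(* Main.v *)
(* Test the slope at mu_t along the generalized geodesic with base mu_t from
   mu_{t+h} to nu: the energy F and the squared distance to mu_t are convex along it.
   For a curve of maximal slope this gives the evolution variational inequality in
   the form
     W_2(mu_t, nu)^2 - W_2(mu_a, nu)^2 <= 2 (t - a) (F(nu) - F(mu_t)),
   for all a <= t and almost every t.

   Let nu_k be the law after k steps of the explicit Euler scheme in which all
   points of the support of mu_0 move by - h grad W * nu_k. Convexity of W yields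
   the subgradient inequality for F at nu_k; the particles do not drift apart, up to
   an error of order h, hence they stay in a ball independent of h because mu_0 is
   compactly supported. With nu = nu_k above, one step increases
   W_2(mu_{kh}, nu_k)^2 by O(h^2) only, so that nu_k converges to mu_t. Hence the
   mu_t are supported in a common ball, and - grad W * mu_t is a monotone field,
   continuous in (t, x) and bounded on bounded sets. Monotonicity makes Euler
   polygons a Cauchy sequence: the field has a unique flow, which contracts
   distances, and mu_tau is the push-forward of mu_0 by F_{0 -> tau}.

   Then Psi^tau[psi_0](s, x) = psi_0(F_{tau - s -> tau}(x)) is constant along
   characteristics. A test function touching it at (s_0, x_0) with s_0 > 0 has a
   one-sided extremum along the characteristic through that point, which is the
   viscosity inequality. The duality formula is the push-forward identity. The
   linear growth comes from that of psi_0, obtained by testing its weak gradient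
   with products of bump functions. *)

(* Nearly optimal couplings take the place of optimal ones, and two plans with a common marginal are
   glued up to a small distance, cell by cell. Each transport inequality thus carries an error that
   tends to 0 at the end.

   The curve is controlled only at almost every time, and only through distances and energies;
   nothing bounds the support of mu_t a priori. It is therefore compared with the Euler laws, which
   are bounded by construction: the subgradient inequality at nu_k is tested against mu_t, the
   evolution inequality of the curve against nu_k. The two energy differences cancel and leave only
   the quadratic error of the Euler step.

   The velocity of a particle averages grad W over differences of particles, so mutual distances
   alone bound it. Monotonicity controls these distances, which closes the estimate on the whole
   time interval. The scheme then serves a second time: since nu_k is close to mu_t in W_2, its
   particles are approximate solutions of the equation driven by mu_t, uniformly in the starting
   point, hence close to the flow. *)
Require Import Defs.
From HB Require Import structures.
From mathcomp Require Import all_boot all_order all_algebra.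
From mathcomp Require Import all_classical all_reals all_analysis.
From mathcomp Require Import measurable_realfun ring lra.
Import Order.TTheory GRing.Theory Num.Theory.
Import numFieldNormedType.Exports.
Set Implicit Arguments.
Unset Strict Implicit.
Unset Printing Implicit Defensive.
Local Open Scope classical_set_scope.
Local Open Scope ring_scope.

(** * Euclidean space, laws and couplings *)

Section euclid.
Context {R : realType} {d : nat}.
Implicit Types (x y z : 'rV[R]_d) (a b : R).

Lemma dotpC x y : dotp x y = dotp y x.
Proof. by apply: eq_bigr => i _; rewrite mulrC. Qed.

Lemma dotpDl x y z : dotp (x + y) z = dotp x z + dotp y z.
Proof. by rewrite -big_split; apply: eq_bigr => i _ /=; rewrite !mxE mulrDl. Qed.

Lemma dotpZl a x y : dotp (a *: x) y = a * dotp x y.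
Proof. by rewrite mulr_sumr; apply: eq_bigr => i _; rewrite !mxE mulrA. Qed.

Lemma dotpNl x y : dotp (- x) y = - dotp x y.
Proof. by rewrite -scaleN1r dotpZl mulN1r. Qed.

Lemma dotpBl x y z : dotp (x - y) z = dotp x z - dotp y z.
Proof. by rewrite dotpDl dotpNl. Qed.

Lemma dotpDr x y z : dotp z (x + y) = dotp z x + dotp z y.
Proof. by rewrite dotpC dotpDl !(dotpC z). Qed.

Lemma dotpZr a x y : dotp y (a *: x) = a * dotp y x.
Proof. by rewrite dotpC dotpZl (dotpC y). Qed.

Lemma dotpNr x y : dotp x (- y) = - dotp x y.
Proof. by rewrite dotpC dotpNl dotpC. Qed.

Lemma dotp0l x : dotp 0 x = 0.
Proof. by rewrite -(scale0r 0) dotpZl mul0r. Qed.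

Lemma dotp0r x : dotp x 0 = 0.
Proof. by rewrite dotpC dotp0l. Qed.

Definition dotpE := (dotpDl, dotpDr, dotpNl, dotpNr, dotpZl, dotpZr).

Lemma dotp_ge0 x : 0 <= dotp x x.
Proof. by apply: sumr_ge0 => i _; rewrite -expr2 sqr_ge0. Qed.

Lemma enorm_ge0 x : 0 <= enorm x.
Proof. exact: sqrtr_ge0. Qed.

Lemma enorm_sqr x : enorm x ^+ 2 = dotp x x.
Proof. by rewrite sqr_sqrtr ?dotp_ge0. Qed.

Lemma enorm_powR x : enorm x `^ 2 = enorm x ^+ 2.
Proof. by rewrite -powR_mulrn ?enorm_ge0. Qed.

Lemma enormN x : enorm (- x) = enorm x.
Proof. by rewrite /enorm dotpNl dotpNr opprK. Qed.

Lemma enormC x y : enorm (x - y) = enorm (y - x).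
Proof. by rewrite -enormN opprB. Qed.

Lemma enorm0 : enorm (0 : 'rV[R]_d) = 0.
Proof. by rewrite /enorm dotp0l sqrtr0. Qed.

Lemma coord_sqr_le x i : x 0 i ^+ 2 <= dotp x x.
Proof.
rewrite /dotp (bigD1 i)//= -expr2 lerDl; apply: sumr_ge0 => j _.
by rewrite -expr2 sqr_ge0.
Qed.

Lemma coord_le x i : `|x 0 i| <= enorm x.
Proof.
by rewrite -(@ler_pXn2r _ 2)// ?nnegrE ?enorm_ge0// enorm_sqr real_normK ?num_real// coord_sqr_le.
Qed.

Lemma enorm_eq0 x : enorm x = 0 -> x = 0.
Proof.
move=> x0; apply/rowP => i; rewrite mxE; apply/eqP; rewrite -normr_eq0.
by rewrite eq_le normr_ge0 andbT -x0 coord_le.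
Qed.

Lemma cauchy_schwarz_sqr x y : dotp x y ^+ 2 <= dotp x x * dotp y y.
Proof.
have := dotp_ge0 (dotp y y *: x - dotp x y *: y).
rewrite !dotpE (dotpC y x).
have [y0|yp] := eqVneq (dotp y y) 0.
  have -> : y = 0 by apply: enorm_eq0; rewrite /enorm y0 sqrtr0.
  by move=> _; rewrite !dotp0r mulr0 expr2 mulr0.
have {}yp : 0 < dotp y y by rewrite lt_neqAle eq_sym yp dotp_ge0.
move: (dotp x y) (dotp x x) (dotp y y) yp => b c a a0 h.
rewrite -subr_ge0 -(pmulr_rge0 _ a0).
by apply: le_trans h _; rewrite le_eqVlt; apply/orP; left; apply/eqP; ring.
Qed.

Lemma cauchy_schwarz x y : `|dotp x y| <= enorm x * enorm y.
Proof.
rewrite -(@ler_pXn2r _ 2)// ?nnegrE ?mulr_ge0 ?enorm_ge0//.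
by rewrite exprMn !enorm_sqr real_normK ?num_real// cauchy_schwarz_sqr.
Qed.

Lemma dotp_le x y : dotp x y <= enorm x * enorm y.
Proof. exact: le_trans (ler_norm _) (cauchy_schwarz x y). Qed.

Lemma enormD x y : enorm (x + y) <= enorm x + enorm y.
Proof.
rewrite -(@ler_pXn2r _ 2)// ?nnegrE ?addr_ge0 ?enorm_ge0//.
rewrite sqrrD !enorm_sqr !dotpE (dotpC y x).
have := dotp_le x y; lra.
Qed.

Lemma enormB_tri x y z : enorm (x - z) <= enorm (x - y) + enorm (y - z).
Proof. by rewrite (_ : x - z = x - y + (y - z)) ?enormD// addrA subrK. Qed.

Lemma enormZ a x : enorm (a *: x) = `|a| * enorm x.
Proof. by rewrite /enorm !dotpE mulrA -expr2 sqrtrM ?sqr_ge0// sqrtr_sqr. Qed.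

Lemma enorm_dist x y : `|enorm x - enorm y| <= enorm (x - y).
Proof.
have h (a b : 'rV[R]_d) : enorm a - enorm b <= enorm (a - b).
  by rewrite lerBlDr; have := enormD (a - b) b; rewrite subrK.
by rewrite ler_norml h andbT lerNl opprB enormC h.
Qed.

Lemma enorm_le_sum x : enorm x <= \sum_(i < d) `|x 0 i|.
Proof.
have s0 : 0 <= \sum_(i < d) `|x 0 i| by apply: sumr_ge0.
rewrite -(@ler_pXn2r _ 2)// ?nnegrE ?enorm_ge0// enorm_sqr expr2 mulr_suml.
apply: ler_sum => i _; apply: le_trans (ler_norm _) _; rewrite normrM.
by apply: ler_wpM2l => //; rewrite (bigD1 i)//= lerDl; apply: sumr_ge0.
Qed.

Lemma enorm_le_bound x (c : R) : (forall i, `|x 0 i| <= c) -> enorm x <= d%:R * c.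
Proof.
move=> h; apply: le_trans (enorm_le_sum x) _.
by apply: le_trans (ler_sum _ (fun i _ => h i)) _; rewrite sumr_const card_ord mulr_natl.
Qed.

Lemma mx_norm_le_enorm x : `|x| <= enorm x.
Proof.
rewrite /Num.norm/= mx_normrE; apply: bigmax_le; first exact: enorm_ge0.
by move=> [i j] _ /=; rewrite ord1 coord_le.
Qed.

Lemma coord_le_mx_norm x i : `|x 0 i| <= `|x|.
Proof.
rewrite [in leRHS]/Num.norm/= mx_normrE.
exact: (le_bigmax _ (fun i : 'I_1 * 'I_d => `|x i.1 i.2|) (0, i)).
Qed.

Lemma enorm_le_mx_norm x : enorm x <= d%:R * `|x|.
Proof. by apply: enorm_le_bound => i; exact: coord_le_mx_norm. Qed.

Lemma enorm_sqrD x y : enorm (x + y) ^+ 2 = enorm x ^+ 2 + 2 * dotp x y + enorm y ^+ 2.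
Proof. by rewrite !enorm_sqr !dotpE (dotpC y x); ring. Qed.

Lemma enorm_sqrD_young x y (l : R) : 0 < l ->
  enorm (x + y) ^+ 2 <= (1 + l) * enorm x ^+ 2 + (1 + l^-1) * enorm y ^+ 2.
Proof.
move=> l0; rewrite enorm_sqrD.
have h := dotp_ge0 (l *: x - y); rewrite !dotpE (dotpC y x) -!enorm_sqr in h.
have h2 : 0 <= l^-1 * (l * (l * enorm x ^+ 2) + l * - dotp x y + - (l * dotp x y + - enorm y ^+ 2)).
  by apply: mulr_ge0; [rewrite invr_ge0 ltW | lra].
rewrite -subr_ge0; apply: le_trans h2 _; rewrite le_eqVlt; apply/orP; left; apply/eqP.
field; lra.
Qed.

(** Integrated against a plan glued over the base point [x], this identity gives the convexity of
    the squared distance along generalized geodesics. *)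
Lemma enorm_sqr_segment x y z a :
  enorm ((1 - a) *: y + a *: z - x) ^+ 2 =
  (1 - a) * enorm (y - x) ^+ 2 + a * enorm (z - x) ^+ 2
  - a * (1 - a) * enorm (y - z) ^+ 2.
Proof.
rewrite !enorm_sqr !(dotpDl, dotpDr, dotpNl, dotpNr, dotpZl, dotpZr) (dotpC z y) (dotpC x y) (dotpC z x).
ring.
Qed.

End euclid.

Notation measurableRd f := (measurable_fun setT (f : _ -> borelRd _ _)).

Section borel.
Context {R : realType} {d : nat}.

Lemma open_measurableRd (U : set 'rV[R]_d) :
  open U -> measurable (U : set (borelRd R d)).
Proof. by move=> oU; apply: sub_sigma_algebra. Qed.

Lemma closed_measurableRd (U : set 'rV[R]_d) :
  closed U -> measurable (U : set (borelRd R d)).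
Proof.
move=> cU; rewrite -(setCK U); apply: measurableC.
by apply: open_measurableRd; rewrite openC.
Qed.

Lemma continuous_measurableRd (f : 'rV[R]_d -> R) :
  continuous f -> measurable_fun setT (f : borelRd R d -> R).
Proof.
move=> /continuousP cf.
apply: (measurability _ (RGenOpens.measurableE R)).
move=> _ [_ [a [b ->] <-]]; rewrite setTI; apply: open_measurableRd.
exact/cf/interval_open.
Qed.

Lemma measurable_coord i : measurable_fun setT (fun x : borelRd R d => (x : 'rV_d) 0 i).
Proof. by apply: continuous_measurableRd; exact: coord_continuous. Qed.

Context {d0 : measure_display} {T : measurableType d0}.

(** An open set is the union of the rational cubes that it contains. There are countably many of
    them, and the preimage of a cube is a finite intersection of coordinate conditions. *)
Lemma measurable_coordP (f : T -> 'rV[R]_d) :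
  (forall i, measurable_fun setT (fun t => f t 0 i)) -> measurableRd f.
Proof.
move=> mf; apply: (@measurability _ _ _ (borelRd R d) _ _ (@open 'rV[R]_d)) => //.
move=> _ [U oU <-]; rewrite setTI.
pose P (q : 'rV[rat]_d) (r : rat) : Prop := (0 < r) /\
  (forall x : 'rV[R]_d, (forall i, `|x 0 i - ratr (q 0 i)| < ratr r) -> U x).
(* Cubes are enumerated by the codes of their centre and half-side. Numbers that code nothing, or a
   cube not contained in [U], contribute the empty set. *)
pose F n : set T := if unpickle n is Some (q, r) then
  [set t | P q r /\ forall i : 'I_d, `|f t 0 i - ratr (q 0 i)| < ratr r] else set0.
have -> : f @^-1` U = \bigcup_n F n.
  apply/seteqP; split => t; last first.
    by move=> [n _]; rewrite /F; case: unpickle => // -[q r] [[r0 h] /h].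
  rewrite /= => Uft.
  have /nbhs_ballP [e /= e0 he] : nbhs (f t) U by apply: open_nbhs_nbhs; split.
  have [r] : exists r : rat, ratr r \in `]0, e / 2[.
    by apply: rat_in_itvoo; rewrite divr_gt0.
  rewrite in_itv/= => /andP[r0 re].
  have /choice[q hq] : forall i : 'I_d, exists q : rat, `|f t 0 i - ratr q| < ratr r.
    move=> i; have [q] : exists q : rat, ratr q \in `](f t 0 i - ratr r), (f t 0 i + ratr r)[.
      by apply: rat_in_itvoo; lra.
    rewrite in_itv/= => /andP[q1 q2]; exists q.
    by rewrite ltr_norml; apply/andP; split; lra.
  exists (pickle (\row_i q i, r)) => //; rewrite /F pickleK; split; last by move=> i; rewrite mxE.
  split; first by rewrite -(ltr0q R).
  move=> x hx; apply: he; split => // i j; rewrite ord1 /ball/=.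
  have := hx j; rewrite mxE; have := hq j.
  move: (f t 0 j) (x 0 j) (ratr (q j) : R) => a b c.
  rewrite !ltr_norml => /andP[? ?] /andP[? ?]; apply/andP; split; lra.
apply: bigcupT_measurable => n; rewrite /F; case: unpickle => // -[q r].
have [hP|hP] := pselect (P q r); last first.
  by rewrite [X in measurable X](_ : _ = set0)// -subset0 => t [].
rewrite [X in measurable X](_ : _ = \bigcap_(i in [set: 'I_d])
    [set t | `|f t 0 i - ratr (q 0 i)| < ratr r]); last first.
  apply/seteqP; split => t; first by move=> [_ h] i _; exact: h.
  by move=> h; split => // i; exact: h.
apply: fin_bigcap_measurable => // i _.
rewrite [X in measurable X](_ : _ = (fun t => f t 0 i) @^-1` `](ratr (q 0 i) - ratr r), (ratr (q 0 i) + ratr r)[); last first.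
  by apply/seteqP; split => t /=; rewrite in_itv/= ltr_norml => /andP[? ?]; apply/andP; split; lra.
by rewrite -[X in measurable X]setTI; apply: mf => //; exact: measurable_itv.
Qed.

Lemma measurable_coord_comp (f : T -> 'rV[R]_d) i :
  measurableRd f -> measurable_fun setT (fun t => f t 0 i).
Proof. by move=> mf; exact: (measurableT_comp (measurable_coord i) mf). Qed.

Lemma measurable_addRd (f g : T -> 'rV[R]_d) :
  measurableRd f -> measurableRd g -> measurableRd (fun t => f t + g t).
Proof.
move=> mf mg; apply: measurable_coordP => i; under eq_fun do rewrite mxE.
by apply: measurable_funD; exact: measurable_coord_comp.
Qed.

Lemma measurable_scaleRd (f : T -> 'rV[R]_d) (a : R) :
  measurableRd f -> measurableRd (fun t => a *: f t).
Proof.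
move=> mf; apply: measurable_coordP => i; under eq_fun do rewrite mxE.
by apply: measurable_funM => //; exact: measurable_coord_comp.
Qed.

Lemma measurable_subRd (f g : T -> 'rV[R]_d) :
  measurableRd f -> measurableRd g -> measurableRd (fun t => f t - g t).
Proof.
move=> mf mg; apply: measurable_addRd => //.
by under eq_fun do rewrite -scaleN1r; exact: measurable_scaleRd.
Qed.

Lemma measurable_dotp (f g : T -> 'rV[R]_d) :
  measurableRd f -> measurableRd g -> measurable_fun setT (fun t => dotp (f t) (g t)).
Proof.
move=> mf mg; apply: measurable_sum => i.
by apply: measurable_funM; exact: measurable_coord_comp.
Qed.

Lemma measurable_enorm (f : T -> 'rV[R]_d) :
  measurableRd f -> measurable_fun setT (fun t => enorm (f t)).
Proof.
move=> mf; apply: (@measurableT_comp _ _ _ _ _ _ (@Num.sqrt R)).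
  by apply: continuous_measurable_fun; exact: sqrt_continuous.
exact: measurable_dotp.
Qed.

End borel.

Lemma continuous_enorm {R : realType} {d : nat} : continuous (@enorm R d).
Proof.
move=> x; apply/(@cvgrPdist_le _ R^o _ (nbhs x) (nbhs_filter x)) => e e0.
apply/nbhs_ballP; exists (e / d.+1%:R); first by rewrite /= divr_gt0 ?ltr0n.
move=> y; rewrite -ball_normE/= => xy.
apply: le_trans (enorm_dist _ _) _; apply: le_trans (enorm_le_mx_norm _) _.
apply: (@le_trans _ _ (d.+1%:R * `|x - y|)).
  by apply: ler_wpM2r => //; rewrite ler_nat.
by rewrite mulrC -ler_pdivlMr ?ltr0n// ltW.
Qed.

Section laws.
Context {d1 d2 : measure_display} {T1 : measurableType d1} {T2 : measurableType d2}
  {R : realType}.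
Implicit Types (P : probability T1 R) (Q : probability T2 R) (X : T1 -> T2).

(** A relation rather than a push-forward measure: one law can be represented on several probability
    spaces, and a coupling is a space that represents two laws at once. *)
Definition is_law P X Q := measurable_fun setT X /\
  forall A, measurable A -> P (X @^-1` A) = Q A.

Lemma law_exists P X : measurable_fun setT X -> exists Q, is_law P X Q.
Proof.
move=> mX; pose X' : {mfun T1 >-> T2} := HB.pack X (isMeasurableFun.Build _ _ _ _ X mX).
by exists (distribution P X'); split.
Qed.

Lemma is_law_integral P X Q (f : T2 -> \bar R) : is_law P X Q ->
  measurable_fun setT f -> (forall y, 0 <= f y)%E ->
  (\int[Q]_y f y = \int[P]_x f (X x))%E.
Proof.
move=> [mX h] mf f0.
pose X' : {mfun T1 >-> T2} := HB.pack X (isMeasurableFun.Build _ _ _ _ X mX).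
rewrite (eq_measure_integral (distribution P X')) => [|A mA _]; last exact/esym/h.
by rewrite ge0_integral_pushforward// preimage_setT.
Qed.

Lemma is_law_integrable P X Q (f : T2 -> \bar R) : is_law P X Q ->
  measurable_fun setT f ->
  (Q.-integrable setT f <-> P.-integrable setT (f \o X)).
Proof.
move=> h mf; have [mX _] := h; have mfX : measurable_fun setT (f \o X) by exact: measurableT_comp.
have e : (\int[Q]_y `|f y| = \int[P]_x `|(f \o X) x|)%E.
  by apply: (is_law_integral h) => //; exact: measurableT_comp.
by split=> /integrableP[_ i]; apply/integrableP; split => //; rewrite ?e// -e.
Qed.

Lemma is_law_integral_EFin P X Q (f : T2 -> R) : is_law P X Q ->
  measurable_fun setT f -> (\int[Q]_y (f y)%:E = \int[P]_x (f (X x))%:E)%E.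
Proof.
move=> h mf; have [mX _] := h.
have mfE : measurable_fun setT (EFin \o f) by exact/measurable_EFinP.
rewrite integralE [in RHS]integralE.
rewrite (is_law_integral h)//; last exact: measurable_funepos.
rewrite (is_law_integral h (f := (fun x => (f x)%:E)^\-%E))//; last exact: measurable_funeneg.
by rewrite !unlock.
Qed.

Lemma is_law_Rintegral P X Q (f : T2 -> R) : is_law P X Q ->
  measurable_fun setT f -> \int[Q]_y f y = \int[P]_x f (X x).
Proof. by move=> h mf; rewrite /Rintegral (is_law_integral_EFin h mf). Qed.

End laws.

Lemma is_law_comp {d1 d2 d3} {T1 : measurableType d1} {T2 : measurableType d2}
  {T3 : measurableType d3} {R : realType} (P : probability T1 R) (X : T1 -> T2)
  (Q : probability T2 R) (Y : T2 -> T3) (S : probability T3 R) :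
  is_law P X Q -> is_law Q Y S -> is_law P (Y \o X) S.
Proof.
move=> [mX hX] [mY hY]; split; first exact: measurableT_comp.
move=> A mA; rewrite -hY// -hX//.
by rewrite -[X in measurable X]setTI; exact: mY.
Qed.

Section glue.
Context {d1 d2 : measure_display} {T1 : measurableType d1} {T2 : measurableType d2}
  {R : realType} (P1 : probability T1 R) (P2 : probability T2 R).
Variables (c1 : T1 -> nat) (c2 : T2 -> nat).
Hypothesis mc1 : forall k, measurable (c1 @^-1` [set k]).
Hypothesis mc2 : forall k, measurable (c2 @^-1` [set k]).
Hypothesis c12 : forall k, P1 (c1 @^-1` [set k]) = P2 (c2 @^-1` [set k]).

Let A k := c1 @^-1` [set k].
Let B k := c2 @^-1` [set k].
Let p k : {nonneg R} := NngNum (fine_ge0 (measure_ge0 P1 (A k))).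
Let mAB k : measurable (A k `*` B k). Proof. by apply: measurableX; [exact: mc1|exact: mc2]. Qed.
(** The product measure gives the k-th cell the mass p_k^2; the factor 1 / p_k brings it back to p_k
    and restores both marginals. For a null cell the inverse of 0 is 0, and the piece vanishes. *)
Let piece k : {measure set (T1 * T2) -> \bar R} :=
  mscale ((p k)%:num^-1)%:nng (mrestr (P1 \x P2)%E (mAB k)).
Let Q := mseries piece 0.

Let pE k : ((p k)%:num)%:E = P1 (A k).
Proof. by rewrite /= fineK// fin_num_measure//; exact: mc1. Qed.

Let pE2 k : ((p k)%:num)%:E = P2 (B k).
Proof. by rewrite pE; exact: c12. Qed.

Let sum_fibres {d0} {T0 : measurableType d0} (P : probability T0 R) (c : T0 -> nat)
    (mc : forall k, measurable (c @^-1` [set k])) (C : set T0) : measurable C ->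
  (P C = \sum_(k <oo) P (C `&` c @^-1` [set k]))%E.
Proof.
move=> mC; rewrite -measure_semi_bigcup//; last 2 first.
- by apply: trivIset_setIl; move=> i j _ _ [x [<- <-]].
- by apply: bigcup_measurable => k _; apply: measurableI => //; exact: mc.
- congr (P _); apply/seteqP; split => x; last by move=> [k _ []].
  by move=> Cx; exists (c x).
by move=> k; apply: measurableI => //; exact: mc.
Qed.

Let Q_rect (C : set T1) (D : set T2) : measurable C -> measurable D ->
  Q (C `*` D) = (\sum_(k <oo) ((p k)%:num^-1)%:E * (P1 (C `&` A k) * P2 (D `&` B k)))%E.
Proof.
move=> mC mD; apply: eq_eseriesr => k _.
rewrite /piece/= /mscale/= /mrestr -setXI product_measure1E//.
- by apply: measurableI => //; exact: mc1.
- by apply: measurableI => //; exact: mc2.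
Qed.

Let Q1 (C : set T1) : measurable C -> Q (C `*` setT) = P1 C.
Proof.
move=> mC; rewrite Q_rect// (sum_fibres _ mc1 mC); apply: eq_eseriesr => k _.
rewrite setTI -pE2 muleCA.
have [p0|p0] := eqVneq (p k)%:num 0; last by rewrite -EFinM mulVf// mule1.
rewrite p0 mule0 mule0; apply/esym/eqP; rewrite -measure_le0 -[leRHS]/((0:R)%:E) -p0 pE.
by apply: le_measure; rewrite ?inE//; [apply: measurableI => //; exact: mc1 | exact: mc1].
Qed.

Let Q2 (C : set T2) : measurable C -> Q (setT `*` C) = P2 C.
Proof.
move=> mC; rewrite Q_rect// (sum_fibres _ mc2 mC); apply: eq_eseriesr => k _.
rewrite setTI -pE muleA -EFinM.
have [p0|p0] := eqVneq (p k)%:num 0; last by rewrite mulVf// mul1e.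
rewrite p0 mulr0 mul0e; apply/esym/eqP; rewrite -measure_le0 -[leRHS]/((0:R)%:E) -p0 pE2.
by apply: le_measure; rewrite ?inE//; [apply: measurableI => //; exact: mc2 | exact: mc2].
Qed.

(* On each cell the two probabilities are made independent; over the whole
   space they share the cell. *)
Lemma glue_along_cells : exists S : probability (T1 * T2)%type R,
  [/\ is_law S fst P1, is_law S snd P2 & S [set z | c1 z.1 <> c2 z.2] = 0%E].
Proof.
have QT : Q setT = 1%E by rewrite -setXTT Q1// probability_setT.
pose S : probability (T1 * T2)%type R :=
  HB.pack Q (Measure.class [the {measure set _ -> \bar R} of Q]) (Measure_isProbability.Build _ _ _ Q QT).
exists S; split.
- split; [exact: measurable_fst|move=> C mC; rewrite -(Q1 mC); congr (Q _)].
  by apply/seteqP; split => -[x y]//= [].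
- split; [exact: measurable_snd|move=> C mC; rewrite -(Q2 mC); congr (Q _)].
  by apply/seteqP; split => -[x y]//= [].
- rewrite /S/= /Q /mseries eseries0// => k _ _.
  rewrite /piece/= /mscale/= /mrestr (_ : _ `&` _ = set0) ?measure0 ?mule0//.
  rewrite -subset0 => -[x y] /= [ne [xA yB]]; apply: ne.
  by rewrite xA yB.
Qed.

End glue.

Section nonneg_integrals.
Context {d : measure_display} {T : measurableType d} {R : realType} (P : probability T R).
Local Open Scope ereal_scope.

Lemma ge0_integral_lin (f g : T -> R) (a b : R) :
  measurable_fun setT f -> measurable_fun setT g ->
  (forall x, 0 <= f x)%R -> (forall x, 0 <= g x)%R -> (0 <= a)%R -> (0 <= b)%R ->
  \int[P]_x (a * f x + b * g x)%:E =
  a%:E * \int[P]_x (f x)%:E + b%:E * \int[P]_x (g x)%:E.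
Proof.
move=> mf mg f0 g0 a0 b0; under eq_integral do rewrite EFinD !EFinM.
rewrite ge0_integralD//.
- have e (h : T -> R) c : measurable_fun setT h -> (forall x, 0 <= h x)%R -> (0 <= c)%R ->
      \int[P]_x (c%:E * (h x)%:E) = c%:E * \int[P]_x (h x)%:E.
    move=> mh h0 c0; apply: ge0_integralZl_EFin => //; last exact/measurable_EFinP.
    by move=> x _; rewrite lee_fin.
  by rewrite !e.
- by move=> x _; rewrite -EFinM lee_fin mulr_ge0.
- by apply/measurable_EFinP; exact: measurable_funM.
- by move=> x _; rewrite -EFinM lee_fin mulr_ge0.
- by apply/measurable_EFinP; exact: measurable_funM.
Qed.

Lemma ge0_integral_addc (f : T -> R) (c : R) :
  measurable_fun setT f -> (forall x, 0 <= f x)%R -> (0 <= c)%R ->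
  \int[P]_x (f x + c)%:E = \int[P]_x (f x)%:E + c%:E.
Proof.
move=> mf f0 c0; under eq_integral do rewrite EFinD.
rewrite ge0_integralD//.
- by rewrite integral_cst// [X in _ * X](@probability_setT _ _ _ P) mule1.
- by move=> x _; rewrite lee_fin.
- exact/measurable_EFinP.
Qed.

Lemma ge0_ae_le_integral (f g : T -> R) (N : set T) :
  measurable_fun setT f -> measurable_fun setT g ->
  (forall x, 0 <= f x)%R -> (forall x, 0 <= g x)%R ->
  measurable N -> P N = 0 -> (forall x, ~ N x -> f x <= g x)%R ->
  \int[P]_x (f x)%:E <= \int[P]_x (g x)%:E.
Proof.
move=> mf mg f0 g0 mN PN fg; apply: ae_ge0_le_integral => //.
- by move=> x _; rewrite lee_fin.
- exact/measurable_EFinP.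
- by move=> x _; rewrite lee_fin.
- exact/measurable_EFinP.
- exists N; split => // x /= h; apply: contrapT => Nx; apply: h => _.
  by rewrite lee_fin fg.
Qed.

Lemma ge0_le_integral_EFin (f g : T -> R) :
  measurable_fun setT f -> measurable_fun setT g ->
  (forall x, 0 <= f x)%R -> (forall x, f x <= g x)%R ->
  \int[P]_x (f x)%:E <= \int[P]_x (g x)%:E.
Proof.
move=> mf mg f0 fg; apply: (@ge0_ae_le_integral _ _ set0) => //.
by move=> x; exact: le_trans (fg x).
Qed.

End nonneg_integrals.

(** * The quadratic Wasserstein distance *)

Section wasserstein.
Context {R : realType} {d : nat}.
Local Notation Rd := (borelRd R d).
Implicit Types mu nu rho : probability Rd R.

Definition W2e mu nu : \bar R := ereal_inf
  [set (\int[gamma]_z ((enorm (z.1 - z.2 : 'rV[R]_d)) `^ 2)%:E)%E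
  | gamma in coupling mu nu].

Lemma coupling_is_law mu nu gamma :
  coupling mu nu gamma <-> is_law gamma fst mu /\ is_law gamma snd nu.
Proof.
split=> [h|[[_ h1] [_ h2]] A mA].
  split; split; [exact: measurable_fst| |exact: measurable_snd|] => A mA.
  - have [<- _] := h A mA; congr (gamma _).
    by apply/seteqP; split => -[x y]//= [].
  - have [_ <-] := h A mA; congr (gamma _).
    by apply/seteqP; split => -[x y]//= [].
rewrite -h1// -h2//; split; congr (gamma _);
  by apply/seteqP; split => -[x y]//= [].
Qed.

Lemma measurable_enorm_sqr_sub {d0} {T : measurableType d0} (X Y : T -> 'rV[R]_d) :
  measurableRd X -> measurableRd Y ->
  measurable_fun setT (fun w => enorm (X w - Y w) ^+ 2).
Proof.
by move=> mX mY; apply: measurable_funX; apply: measurable_enorm; exact: measurable_subRd.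
Qed.

Lemma W2e_ge0 mu nu : (0 <= W2e mu nu)%E.
Proof.
apply: le_ereal_inf_tmp => _ [gamma _ <-]; apply: integral_ge0 => z _.
by rewrite lee_fin powR_ge0.
Qed.

(** The law of the pair [(X, Y)] is a competitor. All upper bounds on distances below come from
    exhibiting two random vectors on one space. *)
Lemma W2e_le {d0} {T : measurableType d0} (P : probability T R) (X Y : T -> 'rV[R]_d) mu nu :
  is_law P (X : T -> Rd) mu -> is_law P (Y : T -> Rd) nu ->
  (W2e mu nu <= \int[P]_w (enorm (X w - Y w) ^+ 2)%:E)%E.
Proof.
move=> hX hY; have [mX _] := hX; have [mY _] := hY.
have mXY : measurable_fun setT (fun w => (X w, Y w) : Rd * Rd) by exact: measurable_fun_pair.
have [gamma hg] := law_exists P mXY.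
have mf : measurable_fun setT (fun z : Rd * Rd => enorm ((z.1 : 'rV_d) - z.2) ^+ 2).
  by apply: measurable_enorm_sqr_sub; [exact: measurable_fst|exact: measurable_snd].
have -> : (\int[P]_w (enorm (X w - Y w) ^+ 2)%:E =
    \int[gamma]_z (enorm ((z.1 : 'rV_d) - z.2) ^+ 2)%:E)%E.
  rewrite (is_law_integral hg)//; first exact/measurable_EFinP.
  by move=> y; rewrite lee_fin sqr_ge0.
apply: ereal_inf_lbound; exists gamma.
  apply/coupling_is_law; split.
  - split; first exact: measurable_fst.
    move=> A mA; have [_ <-] := hX; last by [].
    have [_ <-] := hg; first by [].
    by rewrite -[X in measurable X]setTI; exact: measurable_fst.
  - split; first exact: measurable_snd.
    move=> A mA; have [_ <-] := hY; last by [].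
    have [_ <-] := hg; first by [].
    by rewrite -[X in measurable X]setTI; exact: measurable_snd.
by apply: eq_integral => z _; rewrite enorm_powR.
Qed.

(** Supplies the nearly optimal couplings: [c] will exceed the infimum by an error that is sent to 0
    afterwards. *)
Lemma W2e_near mu nu (c : \bar R) : (W2e mu nu < c)%E ->
  exists gamma : probability (Rd * Rd)%type R, [/\ is_law gamma fst mu, is_law gamma snd nu &
    (\int[gamma]_z (enorm ((z.1 : 'rV_d) - z.2) ^+ 2)%:E < c)%E].
Proof.
move=> /ereal_inf_lt [_ [gamma /coupling_is_law[h1 h2] <-] h]; exists gamma; split => //.
by apply: le_lt_trans h; under eq_integral do rewrite -enorm_powR.
Qed.

Lemma is_law_id mu : is_law mu id mu.
Proof. by split; [exact: measurable_id|]. Qed.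

Lemma W2e_refl mu : W2e mu mu = 0%E.
Proof.
apply/eqP; rewrite eq_le W2e_ge0 andbT.
have := W2e_le (is_law_id mu) (is_law_id mu).
by under eq_integral do rewrite subrr enorm0 expr2 mul0r; rewrite integral0.
Qed.

Lemma W2e_sym_le mu nu : (W2e mu nu <= W2e nu mu)%E.
Proof.
rewrite leNgt; apply/negP => /W2e_near[gamma [h1 h2]]; apply/negP; rewrite -leNgt.
have := W2e_le h2 h1; under eq_integral do rewrite enormC; exact.
Qed.

Lemma W2e_sym mu nu : W2e mu nu = W2e nu mu.
Proof. by apply/eqP; rewrite eq_le !W2e_sym_le. Qed.

Definition m2e mu : \bar R := (\int[mu]_x (enorm (x : 'rV[R]_d) ^+ 2)%:E)%E.

Lemma finite_moment2 mu : finite_moment 2 mu <-> (m2e mu < +oo)%E.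
Proof.
by rewrite /finite_moment /m2e; under [X in _ <-> (X < _)%E]eq_integral do rewrite -enorm_powR.
Qed.

Lemma measurable_enorm_sqr {d0} {T : measurableType d0} (X : T -> 'rV[R]_d) :
  measurableRd X -> measurable_fun setT (fun w => enorm (X w) ^+ 2).
Proof. by move=> mX; apply: measurable_funX; exact: measurable_enorm. Qed.

Lemma m2e_law {d0} {T : measurableType d0} (P : probability T R) (X : T -> 'rV[R]_d) mu :
  is_law P (X : T -> Rd) mu -> (m2e mu = \int[P]_w (enorm (X w) ^+ 2)%:E)%E.
Proof.
move=> hX; rewrite /m2e (is_law_integral hX)//.
  by apply/measurable_EFinP/measurable_enorm_sqr/measurable_id.
by move=> x; rewrite lee_fin sqr_ge0.
Qed.

(** [fine] sends [+oo] to 0, so this finiteness must be known before the real-valued distance says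
    anything about couplings. The independent coupling has finite cost. *)
Lemma W2e_lty mu nu : finite_moment 2 mu -> finite_moment 2 nu -> (W2e mu nu < +oo)%E.
Proof.
move=> /finite_moment2 hmu /finite_moment2 hnu.
pose P : probability (Rd * Rd)%type R := (mu \x nu)%E.
have h1 : is_law P fst mu.
  split=> [|A mA]; first exact: measurable_fst.
  rewrite -[RHS]mule1 -(@probability_setT _ _ _ nu) -product_measure1E//; congr (P _).
  by apply/seteqP; split => -[x y]//= [].
have h2 : is_law P snd nu.
  split=> [|A mA]; first exact: measurable_snd.
  rewrite -[RHS]mul1e -(@probability_setT _ _ _ mu) -product_measure1E//; congr (P _).
  by apply/seteqP; split => -[x y]//= [].
apply: le_lt_trans (W2e_le h1 h2) _.
apply: (@le_lt_trans _ _ (\int[P]_w (2 * enorm (w.1 : 'rV_d) ^+ 2 + 2 * enorm (w.2 : 'rV_d) ^+ 2)%:E)%E).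
  apply: ge0_le_integral_EFin.
  - by apply: measurable_enorm_sqr_sub; [exact: measurable_fst|exact: measurable_snd].
  - by apply: measurable_funD; apply: measurable_funM => //; apply: measurable_enorm_sqr;
      [exact: measurable_fst|exact: measurable_snd].
  - by move=> x; rewrite sqr_ge0.
  - move=> [x y] /=; have := @enorm_sqrD_young R d x (- y) 1 ltr01; rewrite enormN invr1.
    exact.
rewrite ge0_integral_lin//.
- by rewrite -(m2e_law h1) -(m2e_law h2) lte_add_pinfty// lte_mul_pinfty//.
- by apply: measurable_enorm_sqr; exact: measurable_fst.
- by apply: measurable_enorm_sqr; exact: measurable_snd.
- by move=> x; rewrite sqr_ge0.
- by move=> x; rewrite sqr_ge0.
Qed.

End wasserstein.

Lemma measurable_preimage {d1 d2} {T1 : measurableType d1} {T2 : measurableType d2}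
    (f : T1 -> T2) (B : set T2) :
  measurable_fun setT f -> measurable B -> measurable (f @^-1` B).
Proof. by move=> mf mB; rewrite -[X in measurable X]setTI; exact: mf. Qed.

Section glueRd.
Context {R : realType} {d : nat}.
Local Notation Rd := (borelRd R d).
Implicit Types mu nu rho : probability Rd R.

Let cell (e : R) (x : 'rV[R]_d) : nat := pickle (\row_(i < d) Num.floor (x 0 i / e)).

Let measurable_cell (e : R) (k : nat) : 0 < e -> measurable (cell e @^-1` [set k] : set Rd).
Proof.
move=> e0; pose F (q : 'rV[int]_d) := \bigcap_(i in [set: 'I_d])
  [set x : Rd | ((x : 'rV_d) 0 i) \in `[(q 0 i)%:~R * e, (q 0 i + 1)%:~R * e[].
have mF q : measurable (F q).
  apply: fin_bigcap_measurable => // i _.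
  exact: (@measurable_preimage _ _ _ _ _ `[(q 0 i)%:~R * e, (q 0 i + 1)%:~R * e[
    (measurable_coord i) (measurable_itv _)).
have hF q x : F q x <-> q = \row_i Num.floor (x 0 i / e).
  split=> [h|-> i _ /=].
    apply/rowP => i; rewrite mxE; apply/esym/floor_def.
    by have := h i I; rewrite /= in_itv/= ler_pdivlMr// ltr_pdivrMr.
  by rewrite in_itv/= mxE -ler_pdivlMr// -ltr_pdivrMr// floor_itv.
have -> : cell e @^-1` [set k] =
    if (unpickle k : option 'rV[int]_d) is Some q then
      if pickle q == k then F q else set0 else set0.
  apply/seteqP; split => x /=.
    by move=> <-; rewrite /cell pickleK eqxx; apply/hF.
  case: unpickle => // q; case: eqP => // <- /hF ->.
  by [].
by case: unpickle => // q; case: ifP.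
Qed.

Let cell_dist (e : R) (x y : 'rV[R]_d) : 0 < e -> cell e x = cell e y ->
  enorm (x - y) <= d%:R * e.
Proof.
move=> e0 /(congr1 (unpickle : _ -> option 'rV[int]_d)); rewrite !pickleK => -[] h.
apply: enorm_le_bound => i; rewrite !mxE.
have := congr1 (fun A : 'rV[int]_d => A 0 i) h; rewrite !mxE => {}h.
have := floor_itv (x 0 i / e); have := floor_itv (y 0 i / e).
rewrite -h; move: (Num.floor _) => q /andP[].
rewrite !ler_pdivlMr// !ltr_pdivrMr// => a1 a2 /andP[b1 b2].
rewrite rmorphD/= mulrDl mul1r in a2 b2.
by rewrite ler_norml; apply/andP; split; lra.
Qed.

(** Approximate gluing of two plans over their common first marginal: both copies of the first
    coordinate are made to fall in the same small cube, and the rest is independent given the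
    cube. *)
Lemma approx_glue mu (g1 g2 : probability (Rd * Rd)%type R) (e : R) : 0 < e ->
  is_law g1 fst mu -> is_law g2 fst mu ->
  exists S : probability ((Rd * Rd) * (Rd * Rd))%type R,
  [/\ is_law S fst g1, is_law S snd g2 &
    S [set z | ~ (enorm ((z.1.1 : 'rV_d) - z.2.1) <= e)] = 0%E].
Proof.
move=> e0 [m1 h1] [_ h2].
pose e' := e / d.+1%:R.
have e'0 : 0 < e' by rewrite divr_gt0 ?ltr0n.
have mc k : measurable ((cell e' \o fst) @^-1` [set k] : set (Rd * Rd)).
  by rewrite comp_preimage -[X in measurable X]setTI; apply: m1 => //; exact: measurable_cell.
have hc k : g1 ((cell e' \o fst) @^-1` [set k]) = g2 ((cell e' \o fst) @^-1` [set k]).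
  by rewrite comp_preimage h1 ?h2//; exact: measurable_cell.
have [S [s1 s2 s3]] := glue_along_cells mc mc hc.
exists S; split => //.
apply/eqP; rewrite -measure_le0 -s3; apply: le_measure; rewrite ?inE.
- rewrite (_ : [set _ | _] = ~` ((fun z : (Rd * Rd) * (Rd * Rd) => enorm ((z.1.1 : 'rV_d) - z.2.1)) @^-1` `]-oo, e])).
    apply: measurableC; apply: measurable_preimage; last exact: measurable_itv.
    apply: measurable_enorm; apply: measurable_subRd.
    + exact: measurableT_comp m1 measurable_fst.
    + exact: measurableT_comp m1 measurable_snd.
  by apply/seteqP; split => z /=; rewrite in_itv.
- rewrite (_ : [set _ | _] = ~` \bigcup_k (((cell e' \o fst) @^-1` [set k]) `*` ((cell e' \o fst) @^-1` [set k]))).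
    by apply: measurableC; apply: bigcupT_measurable => k; exact: measurableX.
  apply/seteqP; split => z /=.
    by move=> h [k _ [/= <-]] /esym.
  by move=> h h2'; apply: h; exists (cell e' z.1.1) => //; split => //=; rewrite h2'.
- move=> z /= h; move: h; apply: contra_not => /(cell_dist e'0)/le_trans; apply.
  rewrite /e' mulrCA ler_piMr ?(ltW e0)// ler_pdivrMr ?ltr0n// mul1r ler_nat.
  by [].
Qed.

End glueRd.

Section segment.
Context {R : realType} {d : nat}.
Local Notation Rd := (borelRd R d).
Implicit Types mu nu rho w : probability Rd R.

(** The identity on segments wants one base point, while the glued plans have two, [x] and [x'], at
    distance at most [c]. Shifting [z] by [x - x'] makes [x] the base of both legs; Young's
    inequality with weight [c] pays for the shift. *)
Let segment_pointwise (a c : R) (x x' y z : 'rV[R]_d) :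
  0 <= a <= 1 -> 0 < c <= 1 -> enorm (x - x') <= c ->
  enorm ((1 - a) *: y + a *: z - x) ^+ 2 + a * (1 - a) * enorm (y - z) ^+ 2 <=
  (1 + c) * (1 - a) * enorm (x - y) ^+ 2 + (1 + c) * a * enorm (x' - z) ^+ 2 + 4 * c.
Proof.
move=> /andP[a0 a1] /andP[c0 c1] xx'.
pose z' := z + (x - x').
have xx2 : enorm (x - x') ^+ 2 <= c ^+ 2.
  by rewrite ler_pXn2r ?nnegrE ?enorm_ge0// ltW.
have c2 : (1 + c^-1) * c ^+ 2 <= 2 * c.
  have -> : (1 + c^-1) * c ^+ 2 = c * (c + 1) by field; lra.
  by rewrite mulrC; apply: ler_wpM2r; lra.
have h1 : enorm ((1 - a) *: y + a *: z - x) ^+ 2 <=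
    (1 + c) * enorm ((1 - a) *: y + a *: z' - x) ^+ 2 + 2 * c.
  have -> : (1 - a) *: y + a *: z - x = ((1 - a) *: y + a *: z' - x) + (- a) *: (x - x').
    by rewrite /z'; apply/rowP => i; rewrite !mxE; ring.
  apply: le_trans (enorm_sqrD_young _ _ c0) _; rewrite lerD2l.
  apply: le_trans c2; apply: ler_wpM2l; first by rewrite addr_ge0// invr_ge0 ltW.
  apply: le_trans xx2; rewrite enormZ exprMn normrN real_normK ?num_real//.
  by rewrite ler_piMl ?sqr_ge0// expr_le1.
have h2 : enorm (y - z) ^+ 2 <= (1 + c) * enorm (y - z') ^+ 2 + 2 * c.
  have -> : y - z = (y - z') + (x - x') by rewrite /z'; apply/rowP => i; rewrite !mxE; ring.
  apply: le_trans (enorm_sqrD_young _ _ c0) _; rewrite lerD2l.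
  apply: le_trans c2; apply: ler_wpM2l => //.
  by rewrite addr_ge0// invr_ge0 ltW.
have := enorm_sqr_segment x y z' a.
have -> : z' - x = z - x' by rewrite /z' -addrA addrAC subrr add0r.
rewrite (enormC y x) (enormC z x').
move: (enorm _ ^+ 2) h1 => E1 h1; move: (enorm (y - z) ^+ 2) h2 => E2 h2.
move: (enorm ((1 - a) *: y + a *: z' - x) ^+ 2) h1 => E3 h1.
move: (enorm (y - z') ^+ 2) h2 => E4 h2 h3.
have a10 : 0 <= a * (1 - a) by apply: mulr_ge0; lra.
have a12 : a * (1 - a) * (2 * c) <= 2 * c.
  have : a * (1 - a) <= 1 by apply: mulr_ile1; lra.
  by move=> h; rewrite ler_piMl//; lra.
have h4 := ler_wpM2l a10 h2; rewrite mulrDr in h4.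
have := congr1 (fun t => (1 + c) * t) h3 => /= h5.
have e5 : (1 + c) * E3 = (1 + c) * (1 - a) * enorm (x - y) ^+ 2 + (1 + c) * a * enorm (x' - z) ^+ 2 - a * (1 - a) * ((1 + c) * E4).
  by rewrite h5; ring.
lra.
Qed.

(* Convexity of the squared distance to mu along generalized geodesics with
   base mu; the triangle inequality is a corollary. *)
Lemma W2e_segment mu nu1 nu2 (a e : R) : 0 <= a <= 1 -> 0 < e ->
  (W2e mu nu1 < +oo)%E -> (W2e mu nu2 < +oo)%E ->
  exists S : probability ((Rd * Rd) * (Rd * Rd))%type R,
  [/\ is_law S (fun z => z.1.2) nu1, is_law S (fun z => z.2.2) nu2 &
   forall w, is_law S (fun z => ((1 - a) *: (z.1.2 : 'rV_d) + a *: (z.2.2 : 'rV_d)) : Rd) w ->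
   (W2e mu w + (a * (1 - a))%:E * W2e nu1 nu2 <=
    ((1 - a) * fine (W2e mu nu1) + a * fine (W2e mu nu2) + e)%:E)%E].
Proof.
move=> a01 e0 f1 f2; have /andP[a0 a1] := a01.
set A := fine (W2e mu nu1); set B := fine (W2e mu nu2).
have EA : (W2e mu nu1 = A%:E)%E by rewrite fineK// ge0_fin_numE// W2e_ge0.
have EB : (W2e mu nu2 = B%:E)%E by rewrite fineK// ge0_fin_numE// W2e_ge0.
have A0 : 0 <= A by apply: fine_ge0; exact: W2e_ge0.
have B0 : 0 <= B by apply: fine_ge0; exact: W2e_ge0.
pose C := (1 - a) * A + a * B.
have C0 : 0 <= C by apply: addr_ge0; apply: mulr_ge0 => //; lra.
(* Gluing at distance [c] multiplies the costs by 1 + c and adds 4 c. This choice gives [c <= 1] and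
   makes the resulting excess at most e / 2. *)
pose c := e / (2 * (C + e / 2 + 4) + e).
have D0 : 0 < 2 * (C + e / 2 + 4) + e by lra.
have c0 : 0 < c by rewrite divr_gt0.
have c1 : c <= 1 by rewrite ler_pdivrMr// mul1r; lra.
have cC : c * (C + e / 2 + 4) <= e / 2.
  rewrite /c mulrAC ler_pdivrMr//; move: (C + e / 2 + 4) D0 => D D0.
  by rewrite mulrDr; have := sqr_ge0 e; rewrite expr2; lra.
have a1a : 0 <= a * (1 - a) by apply: mulr_ge0; lra.
have k1 : 0 <= (1 + c) * (1 - a) by apply: mulr_ge0; lra.
have k2 : 0 <= (1 + c) * a by apply: mulr_ge0; lra.
have c40 : 0 <= 4 * c by lra.
have c01 : 0 < c <= 1 by rewrite c0.
have Ce : (1 + c) * (1 - a) * (A + e / 2) + (1 + c) * a * (B + e / 2) + 4 * c <= C + e.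
  have -> : (1 + c) * (1 - a) * (A + e / 2) + (1 + c) * a * (B + e / 2) + 4 * c = C + e / 2 + c * (C + e / 2 + 4).
    by rewrite /C; ring.
  lra.
have eA : A < A + e / 2 by lra.
have eB : B < B + e / 2 by lra.
clearbody c.
(* The other half of the error goes to the plans: the weights 1 - a and a add up the two excesses to
   e / 2. *)
have [g1 [g11 g12 g1c]] : exists g1 : probability (Rd * Rd)%type R, [/\ is_law g1 fst mu, is_law g1 snd nu1 &
    (\int[g1]_z (enorm ((z.1 : 'rV_d) - z.2) ^+ 2)%:E < (A + e / 2)%:E)%E].
  by apply: W2e_near; rewrite EA lte_fin.
have [g2 [g21 g22 g2c]] : exists g2 : probability (Rd * Rd)%type R, [/\ is_law g2 fst mu, is_law g2 snd nu2 &
    (\int[g2]_z (enorm ((z.1 : 'rV_d) - z.2) ^+ 2)%:E < (B + e / 2)%:E)%E].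
  by apply: W2e_near; rewrite EB lte_fin.
have [S [s1 s2 s3]] := approx_glue c0 g11 g21.
have l11 := is_law_comp s1 g11; have l12 := is_law_comp s1 g12.
have l21 := is_law_comp s2 g21; have l22 := is_law_comp s2 g22.
exists S; split => // w lw.
have m11 : measurableRd (fun z : (Rd * Rd) * (Rd * Rd) => (z.1.1 : 'rV[R]_d)) by have [] := l11.
have m12 : measurableRd (fun z : (Rd * Rd) * (Rd * Rd) => (z.1.2 : 'rV[R]_d)) by have [] := l12.
have m21 : measurableRd (fun z : (Rd * Rd) * (Rd * Rd) => (z.2.1 : 'rV[R]_d)) by have [] := l21.
have m22 : measurableRd (fun z : (Rd * Rd) * (Rd * Rd) => (z.2.2 : 'rV[R]_d)) by have [] := l22.
have mw : measurableRd (fun z : (Rd * Rd) * (Rd * Rd) => ((1 - a) *: (z.1.2 : 'rV[R]_d) + a *: (z.2.2 : 'rV_d))).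
  by have [] := lw.
pose F1 (z : (Rd * Rd) * (Rd * Rd)) := enorm ((1 - a) *: (z.1.2 : 'rV_d) + a *: (z.2.2 : 'rV_d) - (z.1.1 : 'rV_d)) ^+ 2.
pose F2 (z : (Rd * Rd) * (Rd * Rd)) := enorm ((z.1.2 : 'rV_d) - (z.2.2 : 'rV_d)) ^+ 2.
pose G1 (z : (Rd * Rd) * (Rd * Rd)) := enorm ((z.1.1 : 'rV_d) - (z.1.2 : 'rV_d)) ^+ 2.
pose G2 (z : (Rd * Rd) * (Rd * Rd)) := enorm ((z.2.1 : 'rV_d) - (z.2.2 : 'rV_d)) ^+ 2.
have mF1 : measurable_fun setT F1 by exact: measurable_enorm_sqr_sub.
have mF2 : measurable_fun setT F2 by exact: measurable_enorm_sqr_sub.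
have mG1 : measurable_fun setT G1 by exact: measurable_enorm_sqr_sub.
have mG2 : measurable_fun setT G2 by exact: measurable_enorm_sqr_sub.
have F10 z : 0 <= F1 z by exact: sqr_ge0.
have F20 z : 0 <= F2 z by exact: sqr_ge0.
have G10 z : 0 <= G1 z by exact: sqr_ge0.
have G20 z : 0 <= G2 z by exact: sqr_ge0.
have mm : measurable_fun setT (fun z : Rd * Rd => enorm ((z.1 : 'rV_d) - z.2) ^+ 2).
  by apply: measurable_enorm_sqr_sub; [exact: measurable_fst|exact: measurable_snd].
have iG1 : (\int[S]_z (G1 z)%:E < (A + e / 2)%:E)%E.
  move: g1c; rewrite (is_law_integral s1)//; first exact/measurable_EFinP.
  by move=> y; rewrite lee_fin sqr_ge0.
have iG2 : (\int[S]_z (G2 z)%:E < (B + e / 2)%:E)%E.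
  move: g2c; rewrite (is_law_integral s2)//; first exact/measurable_EFinP.
  by move=> y; rewrite lee_fin sqr_ge0.
have lhs : (W2e mu w + (a * (1 - a))%:E * W2e nu1 nu2 <= \int[S]_z (1 * F1 z + (a * (1 - a)) * F2 z)%:E)%E.
  rewrite ge0_integral_lin// mul1e; apply: leeD.
    by rewrite W2e_sym; exact: (W2e_le lw l11).
  by apply: lee_wpmul2l; rewrite ?lee_fin//; exact: (W2e_le l12 l22).
apply: le_trans lhs _.
apply: (@le_trans _ _ (\int[S]_z ((1 + c) * (1 - a) * G1 z + (1 + c) * a * G2 z + 4 * c)%:E)%E).
  apply: (@ge0_ae_le_integral _ _ _ _ _ _ _ _ _ _ _ _ s3).
  - by apply: measurable_funD; apply: measurable_funM.
  - by apply: measurable_funD => //; apply: measurable_funD; apply: measurable_funM.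
  - by move=> z; rewrite addr_ge0// mulr_ge0.
  - by move=> z; rewrite addr_ge0 ?addr_ge0// mulr_ge0.
  - rewrite (_ : [set _ | _] = ~` ((fun z : (Rd * Rd) * (Rd * Rd) => enorm ((z.1.1 : 'rV_d) - z.2.1)) @^-1` `]-oo, c])).
      apply: measurableC; apply: measurable_preimage; last exact: measurable_itv.
      by apply: measurable_enorm; exact: measurable_subRd.
    by apply/seteqP; split => z /=; rewrite in_itv.
  - move=> z /= /contrapT h; rewrite mul1r; exact: segment_pointwise.
rewrite ge0_integral_addc//; last 2 first.
- by apply: measurable_funD; apply: measurable_funM.
- by move=> z; rewrite addr_ge0// mulr_ge0.
rewrite ge0_integral_lin//.
apply: (@le_trans _ _ (((1 + c) * (1 - a))%:E * (A + e / 2)%:E + ((1 + c) * a)%:E * (B + e / 2)%:E + (4 * c)%:E)%E).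
  rewrite leeD2r//; apply: leeD; apply: lee_wpmul2l; rewrite ?lee_fin//; exact: ltW.
by rewrite -!EFinM -!EFinD lee_fin.
Qed.

End segment.

Lemma nbhs_enormP {R : realType} {d : nat} (x : 'rV[R]_d) (A : set 'rV[R]_d) :
  nbhs x A <-> exists2 e, 0 < e & forall y, enorm (x - y) < e -> A y.
Proof.
split=> [/nbhs_ballP[e /= e0 h]|[e e0 h]].
  exists e => // y xy; apply: h; rewrite -ball_normE/=.
  exact: le_lt_trans (mx_norm_le_enorm _) xy.
apply/nbhs_ballP; exists (e / d.+1%:R); first by rewrite /= divr_gt0 ?ltr0n.
move=> y; rewrite -ball_normE/= => xy; apply: h.
apply: le_lt_trans (enorm_le_mx_norm _) _.
apply: (@le_lt_trans _ _ (d.+1%:R * `|x - y|)).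
  by apply: ler_wpM2r => //; rewrite ler_nat.
by rewrite mulrC -ltr_pdivlMr ?ltr0n.
Qed.

Lemma lipschitz_continuousRd {R : realType} {d : nat} (f : 'rV[R]_d -> R) (C : R) :
  (forall x y, `|f x - f y| <= C * enorm (x - y)) -> continuous f.
Proof.
move=> h x; apply/(@cvgrPdist_le _ R^o _ (nbhs x) (nbhs_filter x)) => e e0.
apply/nbhs_enormP; exists (e / (`|C| + 1)); first by rewrite divr_gt0// ltr_wpDl.
move=> y xy; apply: le_trans (h x y) _.
have C1 : 0 < `|C| + 1 by rewrite ltr_wpDl.
rewrite ltr_pdivlMr// in xy; apply: le_trans (ltW xy).
rewrite mulrC; apply: ler_wpM2l; first exact: enorm_ge0.
by apply: le_trans (ler_norm _) _; rewrite lerDl.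
Qed.

Lemma continuous_enorm_sub {R : realType} {d : nat} (x : 'rV[R]_d) :
  continuous (fun y : 'rV[R]_d => enorm (x - y)).
Proof.
apply: (@lipschitz_continuousRd _ _ _ 1) => y z; rewrite mul1r.
apply: le_trans (enorm_dist _ _) _.
by rewrite (_ : x - y - (x - z) = z - y) 1?enormC//; apply/rowP => i; rewrite !mxE; ring.
Qed.

Section w2.
Context {R : realType} {d : nat}.
Local Notation Rd := (borelRd R d).
Implicit Types mu nu rho w : probability Rd R.

Definition w2 mu nu : R := Num.sqrt (fine (W2e mu nu)).

Lemma wassersteinE (mu nu : Pp R d 2) : wasserstein mu nu = w2 (sval mu) (sval nu).
Proof. by rewrite /wasserstein powR12_sqrt// fine_ge0// W2e_ge0. Qed.

Lemma w2_ge0 mu nu : 0 <= w2 mu nu.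
Proof. exact: sqrtr_ge0. Qed.

Lemma w2_sym mu nu : w2 mu nu = w2 nu mu.
Proof. by rewrite /w2 W2e_sym. Qed.

Lemma w2_refl mu : w2 mu mu = 0.
Proof. by rewrite /w2 W2e_refl sqrtr0. Qed.

Lemma w2_sqr mu nu : w2 mu nu ^+ 2 = fine (W2e mu nu).
Proof. by rewrite sqr_sqrtr// fine_ge0// W2e_ge0. Qed.

Lemma w2_sqrE mu nu : finite_moment 2 mu -> finite_moment 2 nu ->
  ((w2 mu nu ^+ 2)%:E = W2e mu nu)%E.
Proof.
move=> fmu fnu; rewrite w2_sqr fineK// ge0_fin_numE ?W2e_ge0//.
exact: W2e_lty.
Qed.

Lemma w2_sqr_le mu nu (c : R) : (W2e mu nu <= c%:E)%E -> w2 mu nu ^+ 2 <= c.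
Proof.
move=> h; rewrite w2_sqr -lee_fin fineK// ge0_fin_numE ?W2e_ge0//.
by apply: le_lt_trans h _; exact: ltry.
Qed.

Lemma w2_segment mu nu1 nu2 (a e : R) : 0 <= a <= 1 -> 0 < e ->
  finite_moment 2 mu -> finite_moment 2 nu1 -> finite_moment 2 nu2 ->
  exists (S : probability ((Rd * Rd) * (Rd * Rd))%type R) w,
  [/\ is_law S (fun z => z.1.2) nu1, is_law S (fun z => z.2.2) nu2,
    is_law S (fun z => ((1 - a) *: (z.1.2 : 'rV_d) + a *: (z.2.2 : 'rV_d)) : Rd) w,
    finite_moment 2 w &
    w2 mu w ^+ 2 + a * (1 - a) * w2 nu1 nu2 ^+ 2 <=
    (1 - a) * w2 mu nu1 ^+ 2 + a * w2 mu nu2 ^+ 2 + e].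
Proof.
move=> a01 e0 fmu fnu1 fnu2; have /andP[a0 a1] := a01.
have [S [l1 l2 h]] := W2e_segment a01 e0 (W2e_lty fmu fnu1) (W2e_lty fmu fnu2).
have [m1 _] := l1; have [m2 _] := l2.
have mw : measurableRd (fun z : (Rd * Rd) * (Rd * Rd) => ((1 - a) *: (z.1.2 : 'rV[R]_d) + a *: (z.2.2 : 'rV_d))).
  by apply: measurable_addRd; exact: measurable_scaleRd.
have [w lw] := law_exists S mw.
exists S, w.
have fw : finite_moment 2 w.
  apply/finite_moment2; rewrite (m2e_law lw).
  apply: (@le_lt_trans _ _ (\int[S]_z ((1 - a) * enorm (z.1.2 : 'rV[R]_d) ^+ 2 + a * enorm (z.2.2 : 'rV_d) ^+ 2)%:E)%E).
    apply: ge0_le_integral_EFin.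
    - exact: measurable_enorm_sqr.
    - by apply: measurable_funD; apply: measurable_funM => //; exact: measurable_enorm_sqr.
    - by move=> x; rewrite sqr_ge0.
    - move=> z; have := enorm_sqr_segment 0 (z.1.2 : 'rV[R]_d) (z.2.2 : 'rV_d) a.
      rewrite !subr0 => ->; rewrite gerBl; apply: mulr_ge0; last exact: sqr_ge0.
      by apply: mulr_ge0 => //; rewrite subr_ge0.
  rewrite ge0_integral_lin//.
  - rewrite -(m2e_law l1) -(m2e_law l2).
    by rewrite lte_add_pinfty// lte_mul_pinfty// ?lee_fin ?subr_ge0//; exact/finite_moment2.
  - exact: measurable_enorm_sqr.
  - exact: measurable_enorm_sqr.
  - by move=> x; rewrite sqr_ge0.
  - by move=> x; rewrite sqr_ge0.
  - by rewrite subr_ge0.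
split => //.
have := h w lw; rewrite -(w2_sqrE fmu fw) -(w2_sqrE fnu1 fnu2) -EFinM -EFinD lee_fin.
by rewrite !w2_sqr.
Qed.

(** In the segment inequality with base [nu], drop the distance from [nu] to the interpolant. What
    remains is a (1 - a) w2(mu, rho)^2 <= (1 - a) p^2 + a q^2, and a = p / (p + q) turns it into (p
    + q)^2. The padding by e / 2 keeps p and q positive. *)
Lemma w2_tri mu nu rho : finite_moment 2 mu -> finite_moment 2 nu -> finite_moment 2 rho ->
  w2 mu rho <= w2 mu nu + w2 nu rho.
Proof.
move=> fmu fnu frho; apply/ler_addgt0Pr => e e0.
have [A0 B0] := (w2_ge0 nu mu, w2_ge0 nu rho).
rewrite (w2_sym mu nu).
pose p := w2 nu mu + e / 2; pose q := w2 nu rho + e / 2.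
have p0 : 0 < p by rewrite /p; lra.
have q0 : 0 < q by rewrite /q; lra.
pose a := p / (p + q).
have a01 : 0 <= a <= 1.
  have pq : 0 < p + q by rewrite addr_gt0.
  by rewrite ler_pdivrMr// mul1r lerDl (ltW q0) andbT divr_ge0// ltW.
have -> : w2 nu mu + w2 nu rho + e = p + q by rewrite /p /q; lra.
have h : w2 mu rho ^+ 2 <= (p + q) ^+ 2.
  apply/ler_addgt0Pr => c c0.
  have pq0 : 0 < p * q / (p + q) ^+ 2 by apply: divr_gt0; [exact: mulr_gt0|rewrite exprn_gt0// addr_gt0].
  have [S [w [_ _ _ _]]] := w2_segment a01 (mulr_gt0 c0 pq0) fnu fmu frho.
  have Ap : w2 nu mu ^+ 2 <= p ^+ 2 by rewrite ler_pXn2r ?nnegrE ?w2_ge0 ?ltW// /p; lra.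
  have Bq : w2 nu rho ^+ 2 <= q ^+ 2 by rewrite ler_pXn2r ?nnegrE ?w2_ge0 ?ltW// /q; lra.
  have -> : a * (1 - a) = p * q / (p + q) ^+ 2.
    by rewrite /a; field; rewrite lt0r_neq0// addr_gt0.
  have e1 : (1 - a) * p ^+ 2 + a * q ^+ 2 = (p + q) ^+ 2 * (p * q / (p + q) ^+ 2).
    by rewrite /a; field; rewrite lt0r_neq0// addr_gt0.
  case/andP: a01 => a0 a1; rewrite -subr_ge0 in a1.
  have := ler_wpM2l a1 Ap; have := ler_wpM2l a0 Bq; have := sqr_ge0 (w2 nu w).
  move=> h1 h2 h3 h4; rewrite -(ler_pM2r pq0) [leRHS]mulrDl -e1; lra.
by rewrite -(@ler_pXn2r _ 2)// nnegrE ?w2_ge0// addr_ge0// ltW.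
Qed.

Lemma w2_dist mu nu rho : finite_moment 2 mu -> finite_moment 2 nu -> finite_moment 2 rho ->
  `|w2 mu rho - w2 nu rho| <= w2 mu nu.
Proof.
move=> fmu fnu frho; have := w2_tri fmu fnu frho; have := w2_tri fnu fmu frho.
by rewrite (w2_sym nu mu) ler_norml => h1 h2; apply/andP; split; lra.
Qed.

(* Markov's inequality for a nearly optimal coupling *)
Lemma measure_le_w2 mu nu (A B : set Rd) (e : R) :
  finite_moment 2 mu -> finite_moment 2 nu -> measurable A -> measurable B -> 0 < e ->
  (forall x y : 'rV[R]_d, A x -> ~ B y -> e <= enorm (x - y)) ->
  (mu A <= nu B + (w2 mu nu ^+ 2 / e ^+ 2)%:E)%E.
Proof.
move=> fmu fnu mA mB e0 hAB; apply/lee_addgt0Pr => c c0.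
have e20 : 0 < e ^+ 2 by rewrite exprn_gt0.
have [g [g1 g2 gc]] : exists gamma : probability (Rd * Rd)%type R, [/\ is_law gamma fst mu, is_law gamma snd nu &
    (\int[gamma]_z (enorm ((z.1 : 'rV_d) - z.2) ^+ 2)%:E < (w2 mu nu ^+ 2 + c * e ^+ 2)%:E)%E].
  by apply: W2e_near; rewrite -w2_sqrE// lte_fin ltrDl mulr_gt0.
have [m1 l1] := g1; have [m2 l2] := g2.
pose E := (fst @^-1` A `\` snd @^-1` B : set (Rd * Rd)).
have mE : measurable E by apply: measurableD; exact: measurable_preimage.
have gE : (g E <= (w2 mu nu ^+ 2 / e ^+ 2 + c)%:E)%E.
  have h : ((e ^+ 2)%:E * g E <= (w2 mu nu ^+ 2 + c * e ^+ 2)%:E)%E.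
    apply: le_trans (ltW gc).
    have -> : ((e ^+ 2)%:E * g E = \int[g]_z (e ^+ 2 * \1_E z + 0 * \1_E z)%:E)%E.
      by rewrite ge0_integral_lin ?(ltW e20)// integral_indic// setIT mul0e adde0.
    apply: ge0_le_integral_EFin.
    - by apply: measurable_funD; apply: measurable_funM.
    - by apply: measurable_enorm_sqr_sub.
    - by move=> x; rewrite mul0r addr0 mulr_ge0// ltW.
    - move=> z; rewrite mul0r addr0 indicE; case: (boolP (z \in E)) => [/set_mem[/= zA zB]|_].
        by rewrite mulr1 ler_pXn2r ?nnegrE ?enorm_ge0 ?(ltW e0)//; exact: hAB.
      by rewrite mulr0 sqr_ge0.
  have gfin : g E \is a fin_num by rewrite fin_num_measure.
  rewrite -(fineK gfin) lee_fin -(ler_pM2l e20) mulrDr mulrCA divff ?gt_eqF// mulr1 (mulrC _ c).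
  by rewrite -lee_fin EFinM fineK.
rewrite -addeA -EFinD; apply: (@le_trans _ _ (nu B + g E)%E); last by apply: leeD.
rewrite -l1// -l2//.
apply: (@le_trans _ _ (g ((snd @^-1` B) `|` E))%E); last first.
  by apply: measureU2 => //; exact: measurable_preimage.
apply: le_measure; rewrite ?inE.
- exact: measurable_preimage.
- by apply: measurableU => //; exact: measurable_preimage.
- by move=> z /= zA; have [zB|zB] := pselect (B z.2); [left|right; split].
Qed.

(** Serves the local slope, which tests points at positive distance only. Markov's inequality at
    distance zero bounds the mass of a closed set by that of its neighbourhoods of radius 1 / (n +
    1), which shrink to the set; equality on open sets then determines the law. *)
Lemma w2_eq0 mu nu : finite_moment 2 mu -> finite_moment 2 nu -> w2 mu nu = 0 ->
  forall A : set Rd, measurable A -> mu A = nu A.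
Proof.
have hle mu' nu' (F : set 'rV[R]_d) : finite_moment 2 mu' -> finite_moment 2 nu' ->
    w2 mu' nu' = 0 -> closed F -> (mu' (F : set Rd) <= nu' (F : set Rd))%E.
  move=> fmu fnu h0 cF.
  pose G n : set Rd := [set y : 'rV[R]_d | exists2 x, F x & enorm (x - y) < n.+1%:R^-1].
  have mG n : measurable (G n).
    have -> : G n = \bigcup_(x in F) [set y : 'rV[R]_d | enorm (x - y) < n.+1%:R^-1].
      by apply/seteqP; split => y [x]; exists x.
    apply: open_measurableRd; apply: bigcup_open => x Fx.
    rewrite (_ : [set _ | _] = (fun y => enorm (x - y)) @^-1` [set t | t < n.+1%:R^-1])//.
    apply: open_comp; last exact: open_lt.
    by move=> y _; exact: continuous_enorm_sub.
  have h n : (mu' (F : set Rd) <= nu' (G n))%E.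
    have := @measure_le_w2 mu' nu' F (G n) (n.+1%:R^-1) fmu fnu (closed_measurableRd cF) (mG n).
    rewrite h0 expr2 !mul0r adde0; apply; first by rewrite invr_gt0.
    by move=> x y Fx Gy; rewrite leNgt; apply/negP => xy; apply: Gy; exists x.
  have FG : (F : set Rd) = \bigcap_n G n.
    apply/seteqP; split=> [x Fx n _|y Gy].
      by exists x => //; rewrite subrr enorm0 invr_gt0.
    apply: contrapT => nFy.
    have /nbhs_enormP[e e0 he] : nbhs (y : 'rV[R]_d) (~` F) by apply: open_nbhs_nbhs; split => //; rewrite openC.
    have [n] := ltr_add_invr e0.
    rewrite add0r => ne; have [x Fx xy] := Gy n I.
    apply: (he x) => //; rewrite enormC; exact: lt_trans xy ne.
  have cv : (nu' \o G) n @[n --> \oo] --> nu' (\bigcap_n G n).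
    apply: nonincreasing_cvg_mu => //.
    - by rewrite ltey_eq fin_num_measure.
    - exact: bigcapT_measurable.
    - move=> m n mn; apply/subsetPset => y [x Fx xy]; exists x => //.
      by apply: lt_le_trans xy _; rewrite lef_pV2 ?posrE ?ltr0n// ler_nat ltnS.
  rewrite [X in (_ <= nu' X)%E]FG.
  rewrite -(cvg_lim _ cv)//; apply: lime_ge; first by apply/cvg_ex; exists (nu' (\bigcap_n G n)).
  by near=> n; exact: h.
move=> fmu fnu h0 A mA.
apply: (@measure_unique _ R Rd (@open 'rV[R]_d) (fun=> setT)) => //.
- by move=> U V oU oV; exact: openI.
- by move=> _; exact: openT.
- by rewrite bigcup_const//; exists 0%N.
- move=> U oU; have mU := open_measurableRd oU.
  have : mu (~` U) = nu (~` U).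
    have cU : closed (~` U) by rewrite closedC.
    by apply/eqP; rewrite eq_le !hle// w2_sym.
  rewrite !probability_setC//.
  have := @fin_num_measure _ _ _ mu _ mU; have := @fin_num_measure _ _ _ nu _ mU.
  move=> fn fm /(congr1 fine); rewrite !fineB//= => /(addrI 1)/oppr_inj h.
  by rewrite -(fineK fm) h fineK.
- by move=> k; rewrite ltey_eq fin_num_measure.
Unshelve. all: by end_near. Qed.

End w2.

Lemma directional_deriveE {R : realType} {d : nat} (f : 'rV[R]_d -> R) (x v : 'rV[R]_d) :
  differentiable f x -> 'D_v f x = dotp (grad f x) v.
Proof.
move=> df; rewrite deriveE// {1}(row_sum_delta v) linear_sum.
by apply: eq_bigr => i _; rewrite linearZ/= -deriveE// mxE mulrC.
Qed.

Lemma dnbhs0_pos {R : realType} (e : R) (P : R -> Prop) : 0 < e ->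
  (\forall h \near (0 : R)^', P h) -> exists h, [/\ 0 < h, h < e & P h].
Proof.
move=> e0; rewrite /dnbhs /within/= => /nbhs_ballP[c /= c0 hc].
have m0 : 0 < Order.min e c by rewrite lt_min e0 c0.
exists (Order.min e c / 2); split.
- by rewrite divr_gt0.
- have : Order.min e c <= e by rewrite ge_min lexx.
  lra.
- apply: hc; last by rewrite gt_eqF// divr_gt0.
  rewrite /ball/= sub0r normrN gtr0_norm ?divr_gt0//.
  have : Order.min e c <= c by rewrite ge_min lexx orbT.
  lra.
Qed.

(** * Convex potentials and the interaction energy *)

Section potential.
Context {R : realType} {d : nat} (s : R) (W : 'rV[R]_d -> R).
Hypothesis hs : 0 < s.
Hypothesis hWeven : forall x, W (- x) = W x.
Hypothesis hWconvex : convex_function setT W.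
Hypothesis hWreg : C1_holder_loc s W.
Implicit Types x y z : 'rV[R]_d.

Lemma W_diff x : differentiable W x.
Proof. by have [[h _] _] := hWreg; exact: h. Qed.

Lemma W_continuous : continuous W.
Proof. by move=> x; exact/differentiable_continuous/W_diff. Qed.

Lemma gradW_continuous i : continuous (fun x => grad W x 0 i).
Proof.
have [[_ h] _] := hWreg.
rewrite (_ : (fun x => _) = 'D_(delta_mx 0 i) W); last by apply/funext => x; rewrite mxE.
by move=> x; exact: h.
Qed.

Lemma W_convex x y (a : R) : 0 <= a <= 1 ->
  W ((1 - a) *: x + a *: y) <= (1 - a) * W x + a * W y.
Proof.
move=> /andP[a0 a1].
have := @hWconvex (Itv01 a0 a1) y x (mem_setT _) (mem_setT _).
by rewrite addrC [leRHS]addrC; exact.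
Qed.

Lemma W_min x : W 0 <= W x.
Proof.
have a01 : 0 <= (2^-1 : R) <= 1 by apply/andP; split; lra.
have := W_convex x (- x) a01; rewrite hWeven scalerN.
have -> : 1 - 2^-1 = 2^-1 :> R by lra.
by rewrite subrr; lra.
Qed.

Lemma W_tangent x y : W x + dotp (grad W x) (y - x) <= W y.
Proof.
rewrite -directional_deriveE; last exact: W_diff.
rewrite leNgt; apply/negP; rewrite -ltrBlDl => lt.
have /(cvgr_gt _)/(_ _ lt) : h^-1 *: ((W \o shift x) (h *: (y - x)) - W x) @[h --> 0^'] --> 'D_(y - x) W x.
  exact: (diff_derivable (W_diff x)).
move=> /(dnbhs0_pos ltr01)[h [h0 h1]] /=.
have h01 : 0 <= h <= 1 by rewrite !ltW.
have := W_convex x y h01.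
have -> : (1 - h) *: x + h *: y = h *: (y - x) + x by apply/rowP => i; rewrite !mxE; ring.
move=> h2; apply/negP; rewrite -leNgt -[leLHS]/(h^-1 * _) mulrC ler_pdivrMr//; lra.
Qed.

Lemma gradW_mono x y : 0 <= dotp (grad W x - grad W y) (x - y).
Proof.
have := W_tangent x y; have := W_tangent y x.
rewrite -(opprB x y) dotpNr dotpBl; lra.
Qed.

(** Testing along [v] and [- v] forces the subgradient to agree with the directional derivatives.
    Oddness of the gradient is then read off the tangent inequality at [- x]. *)
Lemma subgradient_unique x (p : 'rV[R]_d) :
  (forall y, W x + dotp p (y - x) <= W y) -> p = grad W x.
Proof.
move=> hp; have le v : dotp p v <= dotp (grad W x) v.
  rewrite -directional_deriveE; last exact: W_diff.
  rewrite leNgt; apply/negP => lt.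
  have /(cvgr_lt _)/(_ _ lt) : h^-1 *: ((W \o shift x) (h *: v) - W x) @[h --> 0^'] --> 'D_v W x.
    exact: (diff_derivable (W_diff x)).
  move=> /(dnbhs0_pos ltr01)[h [h0 _]] /=; apply/negP; rewrite -leNgt.
  rewrite -[leRHS]/(h^-1 * _) mulrC ler_pdivlMr//.
  by have := hp (h *: v + x); rewrite addrK dotpZr; lra.
apply/rowP => i; have e v : dotp p v = dotp (grad W x) v.
  by apply/eqP; rewrite eq_le le/=; have := le (- v); rewrite !dotpNr lerN2.
have c (q : 'rV[R]_d) : dotp q (delta_mx 0 i) = q 0 i.
  rewrite /dotp (bigD1 i)//= big1 ?addr0 => [|j ji]; first by rewrite mxE !eqxx mulr1.
  by rewrite mxE eqxx/= (negbTE ji) mulr0.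
by rewrite -!c.
Qed.

Lemma gradW_odd x : grad W (- x) = - grad W x.
Proof.
rewrite -[LHS]opprK; congr (- _); apply: subgradient_unique => y.
have := W_tangent (- x) (- y); rewrite !hWeven.
have -> : - y - - x = - (y - x) by rewrite opprB opprK addrC.
by rewrite dotpNr dotpNl.
Qed.

(* Affine in the squared distance, so that it can be integrated against a
   coupling controlled in [w2] only. *)
Lemma gradW_modulus (r e : R) : 0 < e -> exists2 K, 0 <= K &
  forall x y i, enorm x <= r -> enorm y <= r ->
    `|grad W x 0 i - grad W y 0 i| <= e + K * enorm (x - y) ^+ 2.
Proof.
move=> e0; have [_ hC] := hWreg.
pose B : set 'rV[R]_d := [set x | enorm x <= r].
have cB : compact B.
  apply: bounded_closed_compact; last first.
    rewrite (_ : B = (@enorm R d) @^-1` [set t | t <= r])//.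
    by apply: preimage_closed; [move=> x _; exact: continuous_enorm | exact: closed_le].
  exists r; split; first exact: num_real.
  by move=> t rt x Bx; apply: le_trans (mx_norm_le_enorm _) _; exact: le_trans Bx (ltW rt).
have [C hCB] := hC B cB.
pose r0 := (e / (`|C| + 1)) `^ (s^-1).
have C1 : 0 < `|C| + 1 by rewrite ltr_wpDl.
have r00 : 0 < r0 by rewrite powR_gt0// divr_gt0.
have L0 : 0 <= `|C| * (2 * `|r|) `^ s by rewrite mulr_ge0// powR_ge0.
exists (`|C| * (2 * `|r|) `^ s / r0 ^+ 2); first by rewrite divr_ge0// sqr_ge0.
move=> x y i hx hy.
have h1 : `|grad W x 0 i - grad W y 0 i| <= `|C| * enorm (x - y) `^ s.
  have := hCB x y hx hy; have := coord_le (grad W x - grad W y) i; rewrite !mxE.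
  move=> /le_trans h /h{h} /le_trans; apply; apply: ler_wpM2r; rewrite ?powR_ge0//.
  exact: ler_norm.
apply: le_trans h1 _.
have [xy|xy] := leP (enorm (x - y)) r0.
  apply: (@le_trans _ _ e); last by rewrite lerDl mulr_ge0 ?sqr_ge0// divr_ge0// sqr_ge0.
  have : enorm (x - y) `^ s <= r0 `^ s by apply: ge0_ler_powR; rewrite ?nnegrE ?enorm_ge0// ltW.
  rewrite /r0 -powRrM mulVf ?gt_eqF// powRr1; last by rewrite ltW// divr_gt0.
  move=> h; apply: le_trans (ler_wpM2l (normr_ge0 C) h) _.
  rewrite mulrCA ler_piMr ?(ltW e0)// ler_pdivrMr// mul1r lerDl//.
apply: (@le_trans _ _ (`|C| * (2 * `|r|) `^ s / r0 ^+ 2 * enorm (x - y) ^+ 2)); last by rewrite lerDr ltW.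
apply: (@le_trans _ _ (`|C| * (2 * `|r|) `^ s)).
  apply: ler_wpM2l => //; apply: ge0_ler_powR; rewrite ?nnegrE ?enorm_ge0 ?mulr_ge0//.
    exact: ltW.
  have := enormD x (- y); rewrite enormN; have := ler_norm r; lra.
rewrite -mulrA ler_peMr// mulrC ler_pdivlMr ?exprn_gt0// mul1r.
by rewrite ler_pXn2r ?nnegrE ?enorm_ge0 ?(ltW r00)// ltW.
Qed.

Lemma gradW_bounded (r : R) : exists2 M, 0 <= M & forall x i, enorm x <= r -> `|grad W x 0 i| <= M.
Proof.
have [K K0 h] := gradW_modulus `|r| ltr01.
exists (\sum_j `|grad W 0 0 j| + (1 + K * `|r| ^+ 2)).
  by apply: addr_ge0; [exact: sumr_ge0|apply: addr_ge0 => //; apply: mulr_ge0 => //; exact: sqr_ge0].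
move=> x i xr; have r0 := le_trans (enorm_ge0 x) xr; rewrite ger0_norm// in h *.
have := h x 0 i xr; rewrite enorm0 subr0 => /(_ r0) h1.
have -> : grad W x 0 i = grad W 0 0 i + (grad W x 0 i - grad W 0 0 i) by ring.
apply: le_trans (ler_normD _ _) _; apply: lerD.
  by rewrite (bigD1 i)//= lerDl; apply: sumr_ge0.
apply: le_trans h1 _; rewrite lerD2l; apply: ler_wpM2l => //.
by rewrite ler_pXn2r ?nnegrE ?enorm_ge0.
Qed.

End potential.

Section shift.
Context {d : measure_display} {T : measurableType d} {R : realType} (P : probability T R).
Local Open Scope ereal_scope.

Lemma integral_cst_probability (c : \bar R) : \int[P]_x cst c x = c.
Proof. by rewrite integral_cst// [X in _ * X](@probability_setT _ _ _ P) mule1. Qed.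

(** Here [c] may be negative and the integral of [g] infinite; the latter case is settled by
    bounding the negative part of [g + c] by |c|. *)
Lemma ge0_integral_shift (g : T -> \bar R) (c : R) :
  measurable_fun setT g -> (forall x, 0 <= g x) ->
  \int[P]_x (g x + c%:E) = \int[P]_x g x + c%:E.
Proof.
move=> mg g0.
have ic := integral_cst_probability c%:E.
have intc : P.-integrable setT (cst c%:E) by exact: finite_measure_integrable_cst.
have [ltoo|] := boolP (\int[P]_x g x < +oo).
  rewrite -[in RHS]ic -integralD//.
  by apply/integrableP; split => //; under eq_integral do rewrite gee0_abs//.
rewrite -leNgt leye_eq => /eqP goo; rewrite goo addye//.
pose h x := g x + c%:E.
have mh : measurable_fun setT h by apply: emeasurable_funD.
have hn x : h^\- x <= `|c|%:E.
  rewrite /h !unlock ge_max lee_fin normr_ge0 andbT leeNl.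
  apply: (@le_trans _ _ (0 + c%:E)); last by rewrite leeD2r.
  by rewrite add0e -EFinN lee_fin lerNl -normrN ler_norm.
have hn_int : \int[P]_x h^\- x <= `|c|%:E.
  have -> : `|c|%:E = \int[P]_x (cst `|c|%:E x) by rewrite integral_cst_probability.
  apply: ge0_le_integral => //.
  exact: measurable_funeneg.
have hp : \int[P]_x h^\+ x = +oo.
  apply/eqP; rewrite -leye_eq -goo.
  have : \int[P]_x g x <= \int[P]_x h^\+ x + `|c|%:E.
    have -> : `|c|%:E = \int[P]_x (cst `|c|%:E x) by rewrite integral_cst_probability.
    have mhp := measurable_funepos mh.
    rewrite -ge0_integralD//; last by move=> x _; rewrite lee_fin.
    apply: ge0_le_integral => //.
    - exact: emeasurable_funD.
    - move=> x _; rewrite /h !unlock.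
      apply: (@le_trans _ _ (g x + c%:E + `|c|%:E)); last by rewrite leeD2r// le_max lexx.
      rewrite -addeA -EFinD leeDl// lee_fin; have := ler_norm (- c)%R; rewrite normrN; lra.
  rewrite goo leye_eq => /eqP; case: (\int[P]_x h^\+ x) => // r.
rewrite [LHS]integralE hp; move: hn_int; case: (\int[P]_x h^\- x) => //.
Qed.

End shift.

Section energy.
Context {R : realType} {d : nat} (s : R) (W : 'rV[R]_d -> R).
Hypothesis hWeven : forall x, W (- x) = W x.
Hypothesis hWconvex : convex_function setT W.
Hypothesis hWreg : C1_holder_loc s W.
Local Notation Rd := (borelRd R d).

Definition energy (mu : probability Rd R) : \bar R :=
  ((2^-1)%:E * \int[mu]_x \int[mu]_y (W ((x : 'rV[R]_d) - y))%:E)%E.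

(** [W 0] is the minimum, since 0 is the midpoint of x and - x. Subtracting it makes the integrand
    nonnegative, so that Tonelli's theorem applies even where the energy is infinite. *)
Let W0 x := W x - W 0.

Let W0_ge0 x : 0 <= W0 x.
Proof. by rewrite subr_ge0; exact: W_min. Qed.

Let mW0 {d0} {T : measurableType d0} (X Y : T -> 'rV[R]_d) :
  measurableRd X -> measurableRd Y -> measurable_fun setT (fun z => W0 (X z - Y z)).
Proof.
move=> mX mY; apply: measurable_funB => //.
apply: (@measurableT_comp _ _ _ _ _ _ (W : Rd -> R) _ (fun z => X z - Y z : Rd)).
  by apply: continuous_measurableRd; exact: W_continuous hWreg.
exact: measurable_subRd.
Qed.

Lemma energyE {d0} {T : measurableType d0} (P : probability T R) (X : T -> 'rV[R]_d) mu :
  is_law P (X : T -> Rd) mu ->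
  energy mu = ((2^-1)%:E * \int[(P \x P)%E]_z (W0 (X z.1 - X z.2))%:E + (2^-1 * W 0)%:E)%E.
Proof.
move=> hX; have [mX _] := hX.
have m1 : measurable_fun setT (fun z : Rd * Rd => (W0 ((z.1 : 'rV_d) - z.2))%:E).
  by apply/measurable_EFinP; apply: mW0; [exact: measurable_fst|exact: measurable_snd].
have z0 : forall z : Rd * Rd, (0 <= (W0 ((z.1 : 'rV_d) - z.2))%:E)%E by move=> z; rewrite lee_fin.
have mF : measurable_fun setT (fubini_F mu (fun z : Rd * Rd => (W0 ((z.1 : 'rV_d) - z.2))%:E)).
  exact: measurable_fun_fubini_tonelli_F.
have F0 x : (0 <= fubini_F mu (fun z : Rd * Rd => (W0 ((z.1 : 'rV_d) - z.2))%:E) x)%E.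
  by apply: integral_ge0 => y _; rewrite lee_fin.
have step : (\int[mu]_x \int[mu]_y (W ((x : 'rV[R]_d) - y))%:E =
   \int[mu]_x \int[mu]_y (W0 ((x : 'rV[R]_d) - y))%:E + (W 0)%:E)%E.
  rewrite -[RHS]ge0_integral_shift//.
  apply: eq_integral => x _; rewrite -ge0_integral_shift.
  - by apply: eq_integral => y _; rewrite -EFinD /W0 subrK.
  - by apply/measurable_EFinP; apply: mW0; [exact: measurable_cst|exact: measurable_id].
  - by move=> y; rewrite lee_fin.
have step2 : (\int[mu]_x \int[mu]_y (W0 ((x : 'rV[R]_d) - y))%:E =
   \int[(P \x P)%E]_z (W0 (X z.1 - X z.2))%:E)%E.
  rewrite (is_law_integral hX)//.
  rewrite fubini_tonelli1//.
  - apply: eq_integral => w _; rewrite /fubini_F/= (is_law_integral hX)//.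
      by apply/measurable_EFinP; apply: mW0; [exact: measurable_cst|exact: measurable_id].
    by move=> y; rewrite lee_fin.
  - apply/measurable_EFinP; apply: mW0.
      exact: measurableT_comp mX measurable_fst.
    exact: measurableT_comp mX measurable_snd.
  - by move=> z; rewrite lee_fin.
rewrite /energy step step2 muleDr//; last by rewrite fin_num_adde_defl.
Qed.

Lemma energy_finE {d0} {T : measurableType d0} (P : probability T R) (X : T -> 'rV[R]_d) mu (e : R) :
  is_law P (X : T -> Rd) mu -> energy mu = e%:E ->
  (\int[(P \x P)%E]_z (W0 (X z.1 - X z.2))%:E = (2 * e - W 0)%:E)%E.
Proof.
move=> hX; rewrite (energyE hX).
have : (0 <= \int[(P \x P)%E]_z (W0 (X z.1 - X z.2))%:E)%E by apply: integral_ge0 => z _; rewrite lee_fin.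
case: (\int[(P \x P)%E]_z (W0 (X z.1 - X z.2))%:E)%E => //[r _|_].
  by rewrite -EFinM -EFinD => -[<-]; congr (_%:E); field.
by rewrite gt0_muley ?lte_fin// addye.
Qed.

(** With two independent copies of the pair [(X, Y)], the difference of the interpolated points
    interpolates the differences, so convexity of [W] integrates to convexity of the energy,
    whatever the coupling of [X] and [Y]. *)
Lemma energy_segment {d0} {T : measurableType d0} (P : probability T R) (X Y : T -> 'rV[R]_d)
    mu nu w (a em en : R) : 0 <= a <= 1 ->
  is_law P (X : T -> Rd) mu -> is_law P (Y : T -> Rd) nu ->
  is_law P (fun z => (1 - a) *: X z + a *: Y z : Rd) w ->
  energy mu = em%:E -> energy nu = en%:E ->
  (energy w <= ((1 - a) * em + a * en)%:E)%E.
Proof.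
move=> a01 hX hY hw Em En; have /andP[a0 a1] := a01.
have [mX _] := hX; have [mY _] := hY; have [mw _] := hw.
rewrite (energyE hw).
have mX1 : measurableRd (fun z : T * T => X z.1) by exact: measurableT_comp mX measurable_fst.
have mX2 : measurableRd (fun z : T * T => X z.2) by exact: measurableT_comp mX measurable_snd.
have mY1 : measurableRd (fun z : T * T => Y z.1) by exact: measurableT_comp mY measurable_fst.
have mY2 : measurableRd (fun z : T * T => Y z.2) by exact: measurableT_comp mY measurable_snd.
have mw1 : measurableRd (fun z : T * T => (1 - a) *: X z.1 + a *: Y z.1).
  exact: measurableT_comp mw measurable_fst.
have mw2 : measurableRd (fun z : T * T => (1 - a) *: X z.2 + a *: Y z.2).
  exact: measurableT_comp mw measurable_snd.
have le : (\int[(P \x P)%E]_z (W0 ((1 - a) *: X z.1 + a *: Y z.1 - ((1 - a) *: X z.2 + a *: Y z.2)))%:E <=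
  \int[(P \x P)%E]_z ((1 - a) * W0 (X z.1 - X z.2) + a * W0 (Y z.1 - Y z.2))%:E)%E.
  apply: ge0_le_integral_EFin.
  - exact: mW0.
  - by apply: measurable_funD; apply: measurable_funM => //; exact: mW0.
  - by move=> z; exact: W0_ge0.
  - move=> z; rewrite /W0.
    have -> : (1 - a) *: X z.1 + a *: Y z.1 - ((1 - a) *: X z.2 + a *: Y z.2) =
       (1 - a) *: (X z.1 - X z.2) + a *: (Y z.1 - Y z.2) by apply/rowP => i; rewrite !mxE; ring.
    have := W_convex hWconvex (X z.1 - X z.2) (Y z.1 - Y z.2) a01.
    move: (W _) (W _) (W _) (W 0) => p q r t; lra.
rewrite ge0_integral_lin ?subr_ge0// in le; [|exact: mW0|exact: mW0].
rewrite (energy_finE hX Em) (energy_finE hY En) -!EFinM -EFinD in le.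
apply: (@le_trans _ _ ((2^-1)%:E * ((1 - a) * (2 * em - W 0) + a * (2 * en - W 0))%:E + (2^-1 * W 0)%:E)%E).
  by rewrite leeD2r// lee_wpmul2l// lee_fin.
rewrite -EFinM -EFinD lee_fin le_eqVlt; apply/orP; left; apply/eqP.
by field.
Qed.

End energy.

(** * Growth of real functions under one-sided slope bounds *)

Section growth.
Context {R : realType}.
Implicit Types (G H : R -> R) (a b c : R).
Notation leb := (@lebesgue_measure R).

(* Induction on a real interval: upper bounds are inherited from the left
   and propagate a little to the right. *)
Lemma right_nonincreasing H a b : a <= b ->
  (forall t, a < t <= b -> forall e, 0 < e -> exists2 r, 0 < r &
    forall s, a <= s < t -> t - r < s -> H t <= H s + e) ->
  (forall t, a <= t < b -> exists2 r, 0 < r & forall s, t < s < t + r -> s <= b -> H s <= H t) ->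
  H b <= H a.
Proof.
move=> ab hl hr.
pose S : set R := [set t | a <= t <= b /\ forall r, a <= r <= t -> H r <= H a].
have Sa : S a.
  by split=> [|r /andP[r1 r2]]; [rewrite lexx ab|have -> : r = a by apply/eqP; rewrite eq_le r1 r2].
have ubS : ubound S b by move=> t [/andP[]].
have hS : has_sup S by split; [exists a|exists b].
pose c := sup S.
have ac : a <= c by apply: (ub_le_sup _ Sa); exists b.
have cb : c <= b by apply: ge_sup => //; exists a.
have below r : a <= r < c -> H r <= H a.
  move=> /andP[ar rc].
  have e0 : 0 < c - r by rewrite subr_gt0.
  have [t' [tb' ht'] rt'] := sup_adherent e0 hS.
  apply: ht'; rewrite ar /=; rewrite opprB addrC subrK in rt'; exact: ltW.
have Sc : S c.
  split=> [|r /andP[ar]]; first by rewrite ac cb.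
  rewrite le_eqVlt => /orP[/eqP->|rc]; last by apply: below; rewrite ar rc.
  have := ac; rewrite le_eqVlt => /orP[/eqP<-//|ac'].
  apply/ler_addgt0Pr => e e0.
  have [d d0 hd] : exists2 r, 0 < r & forall s, a <= s < c -> c - r < s -> H c <= H s + e.
    by apply: hl => //; rewrite ac' cb.
  pose s := Order.max a (c - d / 2).
  have s1 : a <= s < c by rewrite le_max lexx/= gt_max ac'/=; lra.
  apply: le_trans (hd s s1 _) _; last by rewrite lerD2r; exact: below.
  by rewrite lt_max; apply/orP; right; lra.
have := cb; rewrite le_eqVlt => /orP[/eqP e|cb'].
  by have [_] := Sc; apply; rewrite e ab lexx.
have [d d0 hd] : exists2 r, 0 < r & forall s, c < s < c + r -> s <= b -> H s <= H c.
  by apply: hr; rewrite ac cb'.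
pose s := Order.min b (c + d / 2).
have cs : c < s by rewrite lt_min cb'/=; lra.
suff Ss : S s.
  have : s <= c by apply: ub_le_sup => //; exists b.
  by rewrite leNgt cs.
split=> [|r /andP[ar rs]]; first by rewrite (le_trans ac (ltW cs)) ge_min lexx.
have [rc|cr] := leP r c; first by have [_] := Sc; apply; rewrite ar rc.
have [sb sd] : s <= b /\ s <= c + d / 2 by rewrite /s; split; rewrite ge_min lexx ?orbT.
apply: le_trans (hd r _ _) _; [by apply/andP; split => //; lra|exact: le_trans sb|].
by have [_] := Sc; apply; rewrite ac lexx.
Qed.

Definition cont_on a b G := forall t, a <= t <= b -> forall e, 0 < e ->
  exists2 r, 0 < r & forall s, a <= s <= b -> `|s - t| < r -> `|G s - G t| <= e.

(** The upper right Dini derivative of [G] at [t] is at most [c]; [b] caps the points at which [G]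
    is evaluated. *)
Definition right_slope_le G b t c := forall e, 0 < e -> exists2 r, 0 < r &
  forall s, t < s < t + r -> s <= b -> G s - G t <= (c + e) * (s - t).

Lemma mean_value_le G a b c : a <= b -> cont_on a b G ->
  (forall t, a <= t < b -> right_slope_le G b t c) -> G b - G a <= c * (b - a).
Proof.
move=> ab cG hG; apply/ler_addgt0Pr => e0 e00.
pose e := e0 / (b - a + 1).
have ba : 0 < b - a + 1 by lra.
have ep : 0 < e by rewrite divr_gt0.
have eb : e * (b - a) <= e0 by rewrite /e mulrAC ler_pdivrMr// ler_wpM2l ?ltW//; lra.
suff : G b - (c + e) * b <= G a - (c + e) * a by rewrite !mulrDl !mulrBr in eb *; lra.
apply: (@right_nonincreasing (fun t => G t - (c + e) * t)) => //.
  move=> t /andP[at' tb] e1 e10.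
  have tab : a <= t <= b by rewrite (ltW at').
  have e12 : 0 < e1 / 2 by rewrite divr_gt0.
  have [r r0 hr] := cG t tab _ e12.
  pose k := `|c + e| + 1.
  have k0 : 0 < k by rewrite ltr_wpDl.
  exists (Order.min r (e1 / 2 / k)); first by rewrite lt_min r0 divr_gt0.
  move=> s /andP[as' st]; rewrite ltrBlDr -ltrBlDl lt_min => /andP[h1 h2].
  have := hr s; rewrite as' (le_trans (ltW st) tb) => /(_ isT).
  rewrite distrC gtr0_norm ?subr_gt0// => /(_ h1); rewrite ler_norml => /andP[h3 h4].
  have h5 : - ((c + e) * (t - s)) <= e1 / 2.
    apply: le_trans (ler_norm _) _; rewrite normrN normrM (gtr0_norm (_ : 0 < t - s)) ?subr_gt0//.
    apply: (@le_trans _ _ (k * (t - s))); first by rewrite ler_wpM2r ?subr_ge0 ?(ltW st)// lerDl.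
    by rewrite mulrC -ler_pdivlMr// ltW.
  rewrite mulrBr in h5; lra.
move=> t tab; have [r r0 hr] := hG t tab e ep.
exists r => // s h1 h2; have := hr s h1 h2; rewrite mulrBr; lra.
Qed.

Let leb_itv (i : interval R) :
  leb [set` i] = (if (i.1 < i.2)%E then ((i.2 : \bar R) - i.1)%E else 0%E).
Proof. exact: lebesgue_measure_itv. Qed.

Let ac_growth0 G a b (k : R -> R) (N : set R) : a <= b ->
  (forall t, 0 <= k t) -> leb.-integrable setT (EFin \o k) ->
  (forall s t, a <= s -> s <= t -> t <= b -> `|G t - G s| <= \int[leb]_(r in `[s, t]) k r) ->
  leb.-negligible N ->
  (forall t, a <= t < b -> ~ N t -> right_slope_le G b t 0) ->
  G b <= G a.
Proof.
move=> ab k0 ik hG [N' [mN' N'0 NN']] hN.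
apply/ler_addgt0Pr => e0 e00.
have e02 : 0 < e0 / 2 by rewrite divr_gt0.
have small e : 0 < e -> exists2 d, 0 < d & forall A, measurable A -> (leb A < d%:E)%E ->
    \int[leb]_(x in A) k x < e.
  move=> e1; have [d0 [d00 hd0]] := integral_normr_continuous ik e1.
  exists d0 => // A mA Ad.
  have -> : \int[leb]_(x in A) k x = \int[leb]_(x in A) `|k x|.
    by apply: eq_Rintegral => x _; rewrite ger0_norm.
  exact: hd0.
have [d0 d00 hd0] := small _ e02.
have [U [oU N'U hU]] : exists U : set R, [/\ open U, N' `<=` U & (leb (U `\` N') < d0%:E)%E].
  apply: lebesgue_regularity_outer => //.
  by rewrite [X in (X < _)%E](_ : _ = 0%E).
have mU : measurable U by exact: open_measurable.
have Ud : (leb U < d0%:E)%E.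
  apply: le_lt_trans hU; rewrite -[in leLHS](setDUK N'U).
  apply: le_trans (measureU2 _ _ _) _ => //; first exact: measurableD.
  by rewrite [X in (X + _ <= _)%E](_ : _ = 0%E)// add0e.
have ikA A : measurable A -> leb.-integrable A (EFin \o k).
  by move=> mA; apply: integrableS ik.
(* [E] pays for the motion inside [U]: right of an exceptional point the interval lies in [U], so
   [G - E] cannot increase there. Elsewhere the slope bound does the work and [E] only helps. In
   total [E] costs at most e0 / 2. *)
pose E t := \int[leb]_(x in U `&` `[a, t]) k x.
have mI t : measurable (U `&` `[a, t]%classic) by apply: measurableI => //; exact: measurable_itv.
have E0 t : 0 <= E t by exact: Rintegral_ge0.
have Eb : E b <= e0 / 2.
  have lt : (leb (U `&` `[a, b]%classic) < d0%:E)%E.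
    apply: le_lt_trans Ud; apply: (@le_measure _ _ _ leb); [|by rewrite inE|exact: subIsetl].
    by rewrite inE; exact: mI.
  exact: ltW (hd0 _ (mI b) lt).
have Esplit t u : a <= t -> t <= u -> E u = E t + \int[leb]_(x in U `&` `]t, u]) k x.
  have mJ : measurable (U `&` `]t, u]%classic) by apply: measurableI => //; exact: measurable_itv.
  move=> at' tu; rewrite /E -Rintegral_setU.
  - congr (Rintegral _ _ _); rewrite -setIUr; congr (_ `&` _).
    by rewrite -itv_bndbnd_setU// bnd_simp.
  - exact: mI.
  - exact: mJ.
  - by apply: ikA; apply: measurableU; [exact: mI|exact: mJ].
  - apply/disj_setPS => x [[_ /=]]; rewrite !in_itv/= => /andP[_ h1] [_ /=].
    by move=> /andP[h2 _]; have := lt_le_trans h2 h1; rewrite ltxx.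
have Emono t u : a <= t -> t <= u -> E t <= E u.
  by move=> at' tu; rewrite (Esplit t u)// lerDl; exact: Rintegral_ge0.
suff h : forall e, 0 < e -> G b - E b - e * b <= G a - E a - e * a.
  have ba : 0 < b - a + 1 by lra.
  have e03 : 0 < e0 / 2 / (b - a + 1) by rewrite divr_gt0.
  have := h _ e03; have := E0 a.
  have : e0 / 2 / (b - a + 1) * (b - a) <= e0 / 2.
    by rewrite mulrAC ler_pdivrMr// ler_wpM2l ?ltW//; lra.
  move: (e0 / 2 / _) => q; rewrite mulrBr; lra.
move=> e e1.
apply: (@right_nonincreasing (fun t => G t - E t - e * t)) => //.
  move=> t /andP[at' tb] e2 e20.
  have [d d1 hd] := small _ e20.
  exists d => // s /andP[as' st] ts.
  have h1 : G t - G s < e2.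
    apply: le_lt_trans (ler_norm _) _; apply: le_lt_trans (hG s t as' (ltW st) tb) _.
    apply: hd; first exact: measurable_itv.
    by rewrite leb_itv/= lte_fin st -EFinB lte_fin; lra.
  have := Emono s t as' (ltW st); have : e * s <= e * t by rewrite ler_wpM2l ?ltW.
  lra.
move=> t /andP[at' tb]; have [Nt|Nt] := pselect (N t).
  have /nbhs_ballP[r /= r0 hr] : nbhs t U.
    by apply: open_nbhs_nbhs; split => //; exact/N'U/NN'.
  exists r => // s /andP[ts sr] sb.
  have h1 := hG t s at' (ltW ts) sb.
  rewrite (Esplit t s) ?(ltW ts)//.
  have -> : U `&` `]t, s]%classic = `]t, s]%classic.
    apply/setIidPr => x /=; rewrite in_itv/= => /andP[tx xs]; apply: hr.
    by rewrite /ball/= ltr0_norm; lra.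
  rewrite Rintegral_itv_obnd_cbnd; last by apply: ikA; exact: measurable_itv.
  have := ler_norm (G s - G t); have : e * t <= e * s by rewrite ler_wpM2l ?ltW.
  lra.
have [r r0 hr] := hN t (introT andP (conj at' tb)) Nt e e1.
exists r => // s ts sb; have := hr s ts sb.
have /andP[/ltW ts' _] := ts; have := Emono t s at' ts'.
rewrite add0r mulrBr; lra.
Qed.

(* The exceptional null set is covered by an open set on which the integral of
   the modulus k is small. *)
Lemma ac_growth G a b c (k : R -> R) (N : set R) : a <= b ->
  (forall t, 0 <= k t) -> leb.-integrable setT (EFin \o k) ->
  (forall s t, a <= s -> s <= t -> t <= b -> `|G t - G s| <= \int[leb]_(r in `[s, t]) k r) ->
  leb.-negligible N ->
  (forall t, a <= t < b -> ~ N t -> right_slope_le G b t c) ->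
  G b - G a <= c * (b - a).
Proof.
move=> ab k0 ik hG nN hN.
pose k' x := k x + `|c| * \1_(`[a, b]) x.
have i1 : leb.-integrable setT (fun x => `|c|%:E * (\1_(`[a, b]%classic) x)%:E)%E.
  by apply: integrableZl => //; exact: integrable_indic_itv.
have ik' : leb.-integrable setT (EFin \o k').
  rewrite (_ : EFin \o k' = (EFin \o k) \+ (fun x => `|c|%:E * (\1_(`[a, b]%classic) x)%:E)%E)//.
  exact: integrableD.
suff : G b - c * b <= G a - c * a by rewrite mulrBr; lra.
apply: (@ac_growth0 (fun t => G t - c * t) a b k' N) => //.
- by move=> t; rewrite addr_ge0// mulr_ge0.
- move=> s t as' st tb.
  have -> : \int[leb]_(r in `[s, t]) k' r = \int[leb]_(r in `[s, t]) k r + `|c| * (t - s).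
    rewrite /k' RintegralD//; last 2 first.
    - exact: integrableS ik.
    - exact: integrableS i1.
    congr (_ + _); rewrite (eq_Rintegral _ (g := fun=> `|c|)).
      rewrite Rintegral_cst// [X in fine X](leb_itv `[s, t])/= lte_fin.
      by move: st; rewrite le_eqVlt => /orP[/eqP->|->]; rewrite ?ltxx ?subrr//=.
    move=> x; rewrite inE/= in_itv/= => /andP[sx xt]; rewrite indicE mem_set ?mulr1//=.
    by rewrite in_itv/=; apply/andP; split; lra.
  have -> : G t - c * t - (G s - c * s) = (G t - G s) - c * (t - s) by ring.
  apply: le_trans (ler_normB _ _) _; apply: lerD; first exact: hG.
  by rewrite normrM (ger0_norm (_ : 0 <= t - s)) ?subr_ge0.
- move=> t tab Nt e e0; have [r r0 hr] := hN t tab Nt e e0; exists r => // s h1 h2.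
  by have := hr s h1 h2; rewrite add0r mulrDl !mulrBr; lra.
Qed.

Lemma negligible_dense (N : set R) a b : leb.-negligible N -> a < b ->
  exists2 t, a < t < b & ~ N t.
Proof.
move=> [N' [mN' N'0 NN']] ab; apply: contrapT => h.
have : (leb `]a, b[%classic <= leb N')%E.
  apply: (@le_measure _ _ _ leb); [by rewrite inE; exact: measurable_itv|by rewrite inE|].
  move=> t /=; rewrite in_itv/= => tab; apply: NN'; apply: contrapT => Nt; apply: h.
  by exists t.
rewrite [X in (_ <= X)%E](_ : _ = 0%E)// leb_itv/= lte_fin ab -EFinB lee_fin; lra.
Qed.

End growth.

(** * Local slope and the arithmetic of one comparison step *)

Section slope.
Context {R : realType} {d : nat} (W : 'rV[R]_d -> R).
Local Notation Rd := (borelRd R d).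
Implicit Types (v w : Pp R d 2).

Lemma eq_energy (mu nu : probability Rd R) :
  (forall A, measurable A -> mu A = nu A) -> energy W mu = energy W nu.
Proof.
move=> h; rewrite /energy; congr (_ * _)%E.
rewrite (eq_measure_integral nu); last by move=> A mA _; exact: h.
by apply: eq_integral => x _; apply: eq_measure_integral => A mA _; exact: h.
Qed.

Lemma local_slope_bound v (e l eta : R) : 0 < eta -> energy W (sval v) = e%:E ->
  local_slope (@wasserstein R d 2) (interaction_energy W) v = l%:E ->
  exists2 r, 0 < r & forall w ew, energy W (sval w) = ew%:E -> w2 (sval v) (sval w) < r ->
    e - ew <= (l + eta) * w2 (sval v) (sval w).
Proof.
move=> eta0 ev; rewrite /local_slope.
rewrite -[interaction_energy W v]/(energy W (sval v)) ev /= => hl.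
have : (l%:E < (l + eta)%:E)%E by rewrite lte_fin ltrDl.
rewrite -[X in (X < _)%E]hl => /ereal_inf_lt[_ [r /= r0 <-] hr].
exists r => // w ew ew_eq; have := w2_ge0 (sval v) (sval w).
(* At distance zero the slope tests nothing, but the two laws then coincide and so do their
   energies. *)
rewrite le_eqVlt => /orP[/eqP d0 _|d0 dr].
  rewrite -d0 mulr0 subr_le0.
  have := eq_energy (w2_eq0 (svalP v) (svalP w) (esym d0)).
  by rewrite ev ew_eq => -[->].
have h : (maxe 0 (e%:E - energy W (sval w)) * ((wasserstein v w)^-1)%:E < (l + eta)%:E)%E.
  apply: le_lt_trans hr; apply: ereal_sup_ubound; exists w => //=.
  by rewrite wassersteinE d0 dr.
move: h; rewrite ew_eq wassersteinE -EFinB -EFin_max -EFinM lte_fin ltr_pdivrMr// => h.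
by apply/ltW; apply: le_lt_trans h; rewrite le_max lexx orbT.
Qed.

End slope.

Lemma young_slope {R : realFieldType} (l D h : R) : 0 < h ->
  l * D <= 2^-1 * l ^+ 2 * h + 2^-1 * D ^+ 2 / h.
Proof.
move=> h0; rewrite -subr_ge0.
have -> : 2^-1 * l ^+ 2 * h + 2^-1 * D ^+ 2 / h - l * D = (l * h - D) ^+ 2 / (2 * h) by field; lra.
by rewrite divr_ge0 ?sqr_ge0// mulr_ge0// ltW.
Qed.

(** Here [h] is a time increment, [a = h * eps] the parameter on the generalized geodesic, [d1] the
    distance covered in time [h], [D] and [D'] the distances to the test law before and after.
    Young's inequality with weight [h] produces half of l^2 h plus half of d1^2 / h; as d1 is about
    m h, this is what the dissipation of energy pays for. The terms left are of order h eps, and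
    dividing by eps gives the inequality. *)
Lemma evi_arith {R : realFieldType} (e e' ey l m f' eta eta' eps h a d1 D D' C : R) :
  0 < h -> 0 < eps -> a = h * eps -> a <= 1 ->
  e - (1 - a) * e' - a * ey <= 2^-1 * (l + eta) ^+ 2 * h +
    2^-1 * ((1 - a) * d1 ^+ 2 + a * D ^+ 2 - a * (1 - a) * D' ^+ 2) / h ->
  0 <= d1 -> d1 <= (m + eta) * h -> e' - e <= (f' + eta) * h ->
  f' <= - (2^-1 * m ^+ 2) - 2^-1 * l ^+ 2 -> D' ^+ 2 <= C -> e - e' <= eta' ->
  2^-1 * D' ^+ 2 - 2^-1 * D ^+ 2 <=
    (ey - e + (((l + m) * eta + eta ^+ 2 + eta) / eps + 2^-1 * eps * C + eta')) * h.
Proof.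
move=> h0 eps0 -> a1 H1 d10 H2 H3 H4 H5 H6.
have d1h : d1 ^+ 2 <= (m + eta) ^+ 2 * h ^+ 2.
  by rewrite -exprMn ler_pXn2r// nnegrE// (le_trans d10).
have d1h' : (1 - h * eps) * d1 ^+ 2 <= (m + eta) ^+ 2 * h ^+ 2.
  apply: le_trans d1h; rewrite ler_piMl ?sqr_ge0//; have := mulr_ge0 (ltW h0) (ltW eps0); lra.
rewrite -(ler_pM2l eps0).
have E1 : 2^-1 * ((1 - h * eps) * d1 ^+ 2 + h * eps * D ^+ 2 - h * eps * (1 - h * eps) * D' ^+ 2) / h =
   2^-1 * ((1 - h * eps) * d1 ^+ 2) / h + eps * (2^-1 * D ^+ 2 - 2^-1 * D' ^+ 2) + 2^-1 * (h * eps ^+ 2) * D' ^+ 2.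
  by field; rewrite gt_eqF.
have E2 : 2^-1 * ((1 - h * eps) * d1 ^+ 2) / h <= 2^-1 * (m + eta) ^+ 2 * h.
  by rewrite ler_pdivrMr//; move: d1h'; rewrite expr2; nra.
have E3 : 2^-1 * (h * eps ^+ 2) * D' ^+ 2 <= 2^-1 * (h * eps ^+ 2) * C.
  by apply: ler_wpM2l => //; rewrite mulr_ge0// mulr_ge0 ?sqr_ge0// ltW.
have E4 : h * eps * (e - e') <= h * eps * eta'.
  by apply: ler_wpM2l => //; rewrite mulr_ge0// ltW.
have E5 : h * f' <= h * (- (2^-1 * m ^+ 2) - 2^-1 * l ^+ 2) by rewrite ler_wpM2l// ltW.
have -> : eps * ((ey - e + (((l + m) * eta + eta ^+ 2 + eta) / eps + 2^-1 * eps * C + eta')) * h) =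
  h * eps * (ey - e) + ((l + m) * eta + eta ^+ 2 + eta) * h + 2^-1 * (h * eps ^+ 2) * C + h * eps * eta'.
  by field; rewrite gt_eqF.
rewrite E1 in H1; clear E1 d1h d1h' H2 H5 H6 d10.
move: (2^-1 * ((1 - h * eps) * d1 ^+ 2) / h) H1 E2 => q1 H1 E2.
move: (2^-1 * (h * eps ^+ 2) * D' ^+ 2) H1 E3 => q2 H1 E3.
move: (2^-1 * (h * eps ^+ 2) * C) E3 => q3 E3.
move: (h * eps) H1 E4 a1 => b H1 E4 a1.
lra.
Qed.

(** Extends a slope bound across a null set: points outside [N] accumulate at [q] from the left, and
    [H] does not jump upwards there. *)
Lemma dense_slope {R : realType} (H : R -> R) (N : set R) (t c k : R) :
  (@lebesgue_measure R).-negligible N ->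
  (forall q, t < q < t + c -> ~ N q -> H q - H t <= k * (q - t)) ->
  (forall q, t < q < t + c -> forall e, 0 < e -> exists2 r, 0 < r &
    forall q', t < q' < q -> q - r < q' -> H q <= H q' + e) ->
  forall q, t < q < t + c -> H q - H t <= k * (q - t).
Proof.
move=> nN hN hc q tqc; have /andP[tq qc] := tqc.
apply/ler_addgt0Pr => e e0.
have e2 : 0 < e / 2 by rewrite divr_gt0.
have [r r0 hr] := hc q tqc _ e2.
pose E := `|k| + 1.
have E0 : 0 < E by rewrite ltr_wpDl.
have lohi : Order.max t (q - Order.min r (e / (2 * E))) < q.
  by rewrite gt_max tq/= ltrBlDr ltrDl lt_min r0 divr_gt0// mulr_gt0.
have [q' /andP[q'1 q'2] Nq'] := negligible_dense nN lohi.
move: q'1; rewrite gt_max => /andP[tq'].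
rewrite ltrBlDr -ltrBlDl lt_min => /andP[qq1 qq2].
have h1 : H q' - H t <= k * (q' - t) by apply: hN => //; rewrite tq' (lt_trans q'2).
have h2 : H q <= H q' + e / 2 by apply: hr; rewrite ?tq'// ltrBlDr -ltrBlDl.
have h3 : k * (q' - q) <= e / 2.
  apply: le_trans (ler_norm _) _; rewrite normrM distrC (gtr0_norm (_ : 0 < q - q')) ?subr_gt0//.
  apply: (@le_trans _ _ (E * (q - q'))); first by rewrite ler_wpM2r ?subr_ge0 ?(ltW q'2)// lerDl.
  by rewrite mulrC -ler_pdivlMr// -mulrA -invfM ltW.
lra.
Qed.

Lemma sqr_le_perturb {R : realFieldType} (x1 x2 x3 k : R) : 0 <= x1 -> 0 <= x2 -> 0 <= x3 ->
  x3 <= x1 + x2 -> x1 * (2 * x3) <= k -> x3 ^+ 2 <= x2 ^+ 2 + k.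
Proof.
move=> h1 h2 h3 h4 h5; have [h|h] := leP x1 x3.
  have h6 : (x3 - x1) ^+ 2 <= x2 ^+ 2 by rewrite ler_pXn2r ?nnegrE ?subr_ge0//; lra.
  have := sqr_ge0 x1; lra.
have : x3 ^+ 2 <= x1 * x3 by rewrite expr2 ler_wpM2r// ltW.
have := mulr_ge0 h1 h3; have := sqr_ge0 x2; lra.
Qed.

#[local] Opaque w2 energy wasserstein.

(** * The evolution variational inequality *)

Section evi.
Context {R : realType} {d : nat} (s : R) (W : 'rV[R]_d -> R).
Hypothesis hWeven : forall x, W (- x) = W x.
Hypothesis hWconvex : convex_function setT W.
Hypothesis hWreg : C1_holder_loc s W.
Local Notation Rd := (borelRd R d).
Notation leb := (@lebesgue_measure R).

Lemma energy_ge mu : ((2^-1 * W 0)%:E <= energy W mu)%E.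
Proof.
rewrite (energyE hWeven hWconvex hWreg (is_law_id mu)) leeDr//.
apply: mule_ge0; first by rewrite lee_fin.
by apply: integral_ge0 => z _; rewrite lee_fin subr_ge0; exact: W_min.
Qed.

(* One step of the comparison: the slope at [x] is tested along the generalized
   geodesic from [x'] to [y] with base point [x]. *)
Lemma slope_test (x x' y : Pp R d 2) (e e' ey l r a h : R) :
  energy W (sval x) = e%:E -> energy W (sval x') = e'%:E -> energy W (sval y) = ey%:E ->
  0 <= a <= 1 -> 0 < h ->
  (forall (w : Pp R d 2) ew, energy W (sval w) = ew%:E -> w2 (sval x) (sval w) < r ->
    e - ew <= l * w2 (sval x) (sval w)) ->
  (1 - a) * w2 (sval x) (sval x') ^+ 2 + a * w2 (sval x) (sval y) ^+ 2 < r ^+ 2 -> 0 < r ->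
  e - (1 - a) * e' - a * ey <= 2^-1 * l ^+ 2 * h + 2^-1 * ((1 - a) * w2 (sval x) (sval x') ^+ 2
     + a * w2 (sval x) (sval y) ^+ 2 - a * (1 - a) * w2 (sval x') (sval y) ^+ 2) / h.
Proof.
move=> Ex Ex' Ey a01 h0 hl hr r0; apply/ler_addgt0Pr => c c0.
set A := (1 - a) * _ in hr *; set B := a * w2 (sval x) _ ^+ 2 in hr *.
set C := a * (1 - a) * _.
(* The first bound makes the geodesic error, once divided by 2 h, at most [c]. The second keeps the
   interpolant within the radius where the slope bound is valid. *)
pose k := Order.min (2 * h * c) ((r ^+ 2 - (A + B)) / 2).
have k0 : 0 < k by rewrite lt_min divr_gt0 ?subr_gt0// andbT !mulr_gt0.
have [S [w [l1 l2 lw fw hw]]] := w2_segment a01 k0 (svalP x) (svalP x') (svalP y).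
have := energy_segment hWeven hWconvex hWreg a01 l1 l2 lw Ex' Ey.
have := energy_ge w; case Ew : (energy W w) => [ew| |]//; rewrite !lee_fin => _ hew.
have C0 : 0 <= C.
  by case/andP: a01 => a0 a1; rewrite mulr_ge0 ?sqr_ge0// mulr_ge0// subr_ge0.
have hk1 : k <= 2 * h * c by rewrite /k ge_min lexx.
have hk2 : k <= (r ^+ 2 - (A + B)) / 2 by rewrite /k ge_min lexx orbT.
have hC : w2 (sval x) w ^+ 2 <= A + B - C + k by rewrite -/A -/B -/C in hw; clear -hw; lra.
have dr : w2 (sval x) w < r.
  rewrite -(@ltr_pXn2r _ 2)// ?nnegrE ?w2_ge0 ?(ltW r0)//; clear -hC hk2 C0 hr; lra.
have := hl (exist _ w fw) ew Ew dr; rewrite /=.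
move: (w2 _ w) hC => D hC h1.
have h2 := young_slope l D h0.
have h3 : 2^-1 * D ^+ 2 / h <= 2^-1 * (A + B - C) / h + c.
  rewrite -lerBlDl -mulrBl ler_pdivrMr//; clear -hC hk1; lra.
clear -h1 h2 h3 hew; lra.
Qed.

(** For q right of t, the slope at [u t] is tested at parameter (q - t) eps on the generalized
    geodesic from [u q] to [y] with base [u t]. The motion of the curve is of order q - t and the
    step towards [y] of order eps (q - t), so the former must cancel exactly: this is the equality
    case of energy dissipation. *)
Lemma evi_at_point (u : R -> Pp R d 2) (f : R -> R) (N : set R) (T t m l : R) (y : Pp R d 2) (ey : R) :
  leb.-negligible N ->
  (forall r, 0 < r < T -> ~ N r -> energy W (sval (u r)) = (f r)%:E) ->
  (forall r, 0 < r < T -> forall e, 0 < e -> exists2 c, 0 < c & forall q, 0 < q < T ->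
     `|q - r| < c -> w2 (sval (u q)) (sval (u r)) <= e) ->
  0 < t < T -> ~ N t -> derivable f t 1 ->
  is_metric_derivative (@wasserstein R d 2) u t m ->
  local_slope (@wasserstein R d 2) (interaction_energy W) (u t) = l%:E ->
  derive1 f t <= - (2^-1 * m ^+ 2) - 2^-1 * l ^+ 2 ->
  energy W (sval y) = ey%:E ->
  forall b, b < T -> right_slope_le (fun r => 2^-1 * w2 (sval (u r)) (sval y) ^+ 2) b t (ey - f t).
Proof.
move=> nN hf cu tT Nt df hm hl f'le Ey b bT e e0.
have /andP[t0 tT'] := tT; have Et := hf t tT Nt.
set D := w2 (sval (u t)) (sval y); have D0 : 0 <= D := w2_ge0 _ _.
pose C := (D + 1) ^+ 2.
have C0 : 0 < C by rewrite exprn_gt0//; lra.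
(* [C] bounds the squared distances to [y] near t; the term eps C / 2 then takes at most a quarter
   of [e]. *)
pose eps := Order.min 1 (e / (2 * C)).
have eps0 : 0 < eps by rewrite lt_min ltr01 divr_gt0// mulr_gt0.
have eps1 : eps <= 1 by rewrite ge_min lexx.
have epsC : 2^-1 * eps * C <= e / 4.
  have : eps <= e / (2 * C) by rewrite ge_min lexx orbT.
  by rewrite ler_pdivlMr ?mulr_gt0//; lra.
pose K := `|l| + `|m| + 2.
have K0 : 0 < K by rewrite /K; have := normr_ge0 l; have := normr_ge0 m; lra.
(* Chosen after [eps], because the errors on slope, speed and derivative of the energy get divided
   by [eps]. *)
pose eta := Order.min 1 (eps * e / (4 * K)).
have eta0 : 0 < eta by rewrite lt_min ltr01 divr_gt0 ?mulr_gt0.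
have eta1 : eta <= 1 by rewrite ge_min lexx.
have etaK : ((l + m) * eta + eta ^+ 2 + eta) / eps <= e / 4.
  have : eta <= eps * e / (4 * K) by rewrite ge_min lexx orbT.
  rewrite ler_pdivlMr ?mulr_gt0// => h; rewrite ler_pdivrMr//.
  have h1 : (l + m) * eta + eta ^+ 2 + eta <= K * eta.
    rewrite expr2 /K !mulrDl; have := ler_norm l; have := ler_norm m.
    move=> h2 h3; have := ler_wpM2r (ltW eta0) h2; have := ler_wpM2r (ltW eta0) h3.
    have := ler_wpM2r (ltW eta0) eta1; lra.
  lra.
have [r r0 hr] := local_slope_bound eta0 Et hl.
have r20 : 0 < r ^+ 2 by rewrite exprn_gt0.
pose M := `|m| + 1.
have M0 : 0 < M by rewrite ltr_wpDl.
set f' := derive1 f t in f'le.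
have nd1 : \forall q \near t^'+, w2 (sval (u q)) (sval (u t)) <= (m + eta) * (q - t).
  have hm' : wasserstein (u q) (u t) / `|q - t| @[q --> t^'] --> m := hm.
  have lt : m < m + eta by rewrite ltrDl.
  have h := cvgr_le _ (cvg_dnbhs_at_right hm') _ lt.
  near=> q; have : 0 < q - t by rewrite subr_gt0; near: q; exact: nbhs_right_gt.
  move=> qt; rewrite -ler_pdivrMr// -wassersteinE.
  have : wasserstein (u q) (u t) / `|q - t| <= m + eta by near: q; exact: h.
  by rewrite gtr0_norm.
have ndf : (fun h : R => h^-1 *: (f (h *: 1 + t) - f t)) h @[h --> 0^'] --> f'.
  by rewrite /f' derive1E; exact: df.
have nf (P : R -> Prop) : (\forall h \near (0:R)^', P h) -> \forall q \near t^'+, P (q - t).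
  move=> /nbhs_ballP[c /= c0 hc]; near=> q.
  have qt : 0 < q - t by rewrite subr_gt0; near: q; exact: nbhs_right_gt.
  apply: hc; last by rewrite gt_eqF.
  rewrite /ball/= sub0r normrN gtr0_norm//.
  by rewrite ltrBlDl; near: q; apply: nbhs_right_lt; rewrite ltrDl.
have nf1 : \forall q \near t^'+, f q - f t <= (f' + eta) * (q - t).
  have lt : f' < f' + eta by rewrite ltrDl.
  have h := nf _ (cvgr_le _ ndf _ lt).
  near=> q; have qt : 0 < q - t by rewrite subr_gt0; near: q; exact: nbhs_right_gt.
  rewrite -ler_pdivrMr// mulrC.
  have : (q - t)^-1 *: (f ((q - t) *: 1 + t) - f t) <= f' + eta by near: q; exact: h.
  by rewrite /GRing.scale/= mulr1 subrK.
have nf2 : \forall q \near t^'+, (f' - 1) * (q - t) <= f q - f t.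
  have lt : f' - 1 < f' by rewrite gtrBl ltr01.
  have h := nf _ (cvgr_ge _ ndf _ lt).
  near=> q; have qt : 0 < q - t by rewrite subr_gt0; near: q; exact: nbhs_right_gt.
  rewrite -ler_pdivlMr// [leRHS]mulrC.
  have : f' - 1 <= (q - t)^-1 *: (f ((q - t) *: 1 + t) - f t) by near: q; exact: h.
  by rewrite /GRing.scale/= mulr1 subrK.
pose L := `|f'| + 1.
have L0 : 0 < L by rewrite /L; have := normr_ge0 f'; clear -D0; lra.
have DM0 : 0 < M + D ^+ 2 by rewrite ltr_pwDl// sqr_ge0.
have good : \forall q \near t^'+, ~ N q ->
    2^-1 * w2 (sval (u q)) (sval y) ^+ 2 - 2^-1 * D ^+ 2 <= (ey - f t + 3 / 4 * e) * (q - t).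
  near=> q => Nq.
  have qt : 0 < q - t by rewrite subr_gt0; near: q; exact: nbhs_right_gt.
  have qT : 0 < q < T.
    apply/andP; split; first by rewrite (lt_trans t0)// -subr_gt0.
    by near: q; exact: nbhs_right_lt.
  have q1 : q - t < 1 by rewrite ltrBlDl; near: q; apply: nbhs_right_lt; rewrite ltrDl.
  have qM : (q - t) * M < 1.
    by rewrite -ltr_pdivlMr// ltrBlDl; near: q; apply: nbhs_right_lt; rewrite ltrDl divr_gt0.
  have qL : (q - t) * L < e / 4.
    by rewrite -ltr_pdivlMr// ltrBlDl; near: q; apply: nbhs_right_lt; rewrite ltrDl !divr_gt0.
  have qr : (q - t) * (M + D ^+ 2) < r ^+ 2.
    by rewrite -ltr_pdivlMr// ltrBlDl; near: q; apply: nbhs_right_lt; rewrite ltrDl divr_gt0.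
  have hd1 : w2 (sval (u q)) (sval (u t)) <= (m + eta) * (q - t) by near: q.
  have hf1 : f q - f t <= (f' + eta) * (q - t) by near: q.
  have hf2 : (f' - 1) * (q - t) <= f q - f t by near: q.
  have d10 := w2_ge0 (sval (u q)) (sval (u t)).
  have mM : m + eta <= M by rewrite /M; apply: lerD => //; exact: ler_norm.
  have d1M : w2 (sval (u q)) (sval (u t)) <= (q - t) * M.
    apply: le_trans hd1 _; rewrite mulrC; apply: ler_wpM2l => //; exact: ltW.
  have D'le : w2 (sval (u q)) (sval y) ^+ 2 <= C.
    rewrite ler_pXn2r ?nnegrE ?w2_ge0//; last by rewrite addr_ge0.
    apply: le_trans (w2_tri (svalP (u q)) (svalP (u t)) (svalP y)) _; rewrite addrC lerD2l.
    exact: le_trans d1M (ltW qM).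
  have a0 : 0 < (q - t) * eps by rewrite mulr_gt0.
  have a1 : (q - t) * eps <= 1 by apply: mulr_ile1 => //; exact: ltW.
  have a01 : 0 <= (q - t) * eps <= 1 by rewrite (ltW a0).
  have small : (1 - (q - t) * eps) * w2 (sval (u t)) (sval (u q)) ^+ 2 + (q - t) * eps * D ^+ 2 < r ^+ 2.
    apply: le_lt_trans qr; rewrite mulrDr; apply: lerD; last first.
      rewrite -mulrA; apply: ler_wpM2l; first exact: ltW.
      by rewrite ler_piMl ?sqr_ge0.
    rewrite w2_sym; apply: (@le_trans _ _ (w2 (sval (u q)) (sval (u t)) ^+ 2)).
      by rewrite ler_piMl ?sqr_ge0// gerBl ltW.
    by apply: le_trans (d1M); rewrite expr2 ler_piMr// (le_trans d1M (ltW qM)).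
  have H1 := slope_test Et (hf q qT Nq) Ey a01 qt hr small r0.
  have := evi_arith qt eps0 erefl a1 H1 (w2_ge0 _ _).
  rewrite (w2_sym (sval (u t)) (sval (u q))) -/D.
  have He : f t - f q <= e / 4.
    have : (f' - 1) * (q - t) >= - ((q - t) * L).
      rewrite [leRHS]mulrC -mulrN; apply: ler_wpM2l; first exact: ltW.
      by rewrite /L opprD lerD2r lerNl -normrN ler_norm.
    move=> h; rewrite -opprB lerNl; apply: le_trans hf2; apply: le_trans h.
    by rewrite lerN2 ltW.
  move=> /(_ _ _ _ _ hd1 hf1 f'le D'le He) h; apply: le_trans h _.
  apply: ler_wpM2r; [exact: ltW|rewrite lerD2l].
  have -> : 3 / 4 * e = e / 4 + e / 4 + e / 4 by field.
  by apply: lerD => //; exact: lerD.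
have {good} [c c0 hc] : exists2 c, 0 < c & forall q, t < q < t + c -> ~ N q ->
    2^-1 * w2 (sval (u q)) (sval y) ^+ 2 - 2^-1 * D ^+ 2 <= (ey - f t + 3 / 4 * e) * (q - t).
  move: good => /nbhs_ballP[c /= c0 hc]; exists c => // q /andP[tq qc]; apply: hc => //.
  by rewrite /ball/= ltr0_norm ?subr_lt0// opprB ltrBlDl.
clear -nN cu tT e0 c0 hc.
case/andP: tT => t0 tT.
exists (Order.min c (T - t)); first by rewrite lt_min c0 subr_gt0.
move=> q tq _; have qt : 0 < q - t by case/andP: tq => tq _; rewrite subr_gt0.
apply: (@le_trans _ _ ((ey - f t + 3 / 4 * e) * (q - t))); last first.
  by apply: ler_wpM2r; [exact: ltW|rewrite lerD2l ler_piMl ?(ltW e0)// ler_pdivrMr// mul1r ler_nat].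
apply: (@dense_slope _ (fun r => 2^-1 * w2 (sval (u r)) (sval y) ^+ 2) N t _ _ nN _ _ q tq).
  move=> p /andP[tp]; rewrite -ltrBlDl lt_min => /andP[pc _] Np; apply: hc => //.
  by rewrite tp -ltrBlDl.
move=> p /andP[tp]; rewrite -ltrBlDl lt_min => /andP[_ pT] k k0.
have p0T : 0 < p < T by rewrite (lt_trans t0 tp)/= -(ltrD2r (- t)).
pose B := w2 (sval (u p)) (sval y) + 1.
have B0 : 0 < B by rewrite ltr_wpDl ?w2_ge0.
have kB : 0 < k / B by rewrite divr_gt0.
have [r r0 hr] := cu p p0T _ kB.
exists r => // p' /andP[tp' p'p] pr.
have h : w2 (sval (u p')) (sval (u p)) <= k / B.
  apply: hr; first by rewrite (lt_trans t0 tp')/= (lt_trans p'p)//; case/andP: p0T.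
  by rewrite distrC gtr0_norm ?subr_gt0// ltrBlDr -ltrBlDl.
have h5 := w2_tri (svalP (u p)) (svalP (u p')) (svalP y).
rewrite (w2_sym (sval (u p)) (sval (u p'))) in h5.
have := sqr_le_perturb (w2_ge0 (sval (u p')) (sval (u p))) (w2_ge0 (sval (u p')) (sval y))
  (w2_ge0 (sval (u p)) (sval y)) h5.
have h6 : w2 (sval (u p')) (sval (u p)) * (2 * w2 (sval (u p)) (sval y)) <= 2 * k.
  rewrite mulrCA ler_pM2l//; move: h; rewrite ler_pdivlMr//; apply: le_trans.
  by apply: ler_wpM2l; [exact: w2_ge0|rewrite lerDl].
move=> /(_ _ h6) h7.
by have := ler_wpM2l (_ : 0 <= 2^-1 :> R) h7; rewrite mulrDr mulKf//; apply.
Unshelve. all: by end_near. Qed.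

End evi.

Section evi_integrated.
Context {R : realType} {d : nat} (s : R) (W : 'rV[R]_d -> R).
Hypothesis hWeven : forall x, W (- x) = W x.
Hypothesis hWconvex : convex_function setT W.
Hypothesis hWreg : C1_holder_loc s W.
Local Notation Rd := (borelRd R d).
Notation leb := (@lebesgue_measure R).

Lemma continuous_curve_w2 (T : R) (u : R -> Pp R d 2) :
  continuous_curve (@wasserstein R d 2) T u ->
  forall t, 0 <= t <= T -> forall e, 0 < e -> exists2 c, 0 < c & forall q, 0 <= q <= T ->
     `|q - t| < c -> w2 (sval (u q)) (sval (u t)) <= e.
Proof.
move=> hu t t0T e e0; have hc : wasserstein (u q) (u t) @[q --> within [set` `[0, T]] (nbhs t)] --> (0 : R).
  by apply: hu; rewrite in_itv.
have : \forall q \near within [set` `[0, T]] (nbhs t), wasserstein (u q) (u t) <= e.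
  exact: (cvgr_le _ hc).
move=> /nbhs_ballP[c /= c0 h]; exists c => // q qT qt.
rewrite -wassersteinE; apply: h; last by rewrite /= in_itv.
by rewrite /ball/= distrC.
Qed.

Lemma w2_sqr_continuous (T : R) (u : R -> Pp R d 2) (y : Pp R d 2) :
  continuous_curve (@wasserstein R d 2) T u ->
  forall t, 0 <= t <= T -> forall e, 0 < e -> exists2 c, 0 < c & forall q, 0 <= q <= T ->
     `|q - t| < c -> `|w2 (sval (u q)) (sval y) ^+ 2 - w2 (sval (u t)) (sval y) ^+ 2| <= e.
Proof.
move=> hu t t0T e e0.
pose B := 2 * (w2 (sval (u t)) (sval y) + 1).
have B0 : 0 < B by rewrite mulr_gt0// ltr_wpDl// w2_ge0.
have eB : 0 < Order.min 1 (e / B) by rewrite lt_min ltr01 divr_gt0.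
have [c c0 hc] := continuous_curve_w2 hu t0T eB.
exists c => // q qT qt; have := hc q qT qt; rewrite le_min ler_pdivlMr// => /andP[h1 h2].
have := w2_dist (svalP (u q)) (svalP (u t)) (svalP y) => h3.
rewrite subr_sqr normrM; apply: le_trans h2; apply: ler_pM => //.
rewrite ger0_norm ?addr_ge0 ?w2_ge0//.
move: h3; rewrite ler_norml => /andP[_ h3].
rewrite /B; move: h1 h3; move: (w2 _ _) (w2 _ _) (w2 _ _) => p q1 r; lra.
Qed.

Lemma right_slope_le_mono (G : R -> R) b t c c' : c <= c' ->
  right_slope_le G b t c -> right_slope_le G b t c'.
Proof.
move=> cc h e e0; have [r r0 hr] := h e e0; exists r => // q tq qb.
apply: le_trans (hr q tq qb) _; apply: ler_wpM2r; last by rewrite lerD2r.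
by case/andP: tq => /ltW tq _; rewrite subr_ge0.
Qed.

(** The pointwise inequality at r has the constant ey - f r, at most ey - f t for r <= t since [f]
    is non-increasing. The slope bound is thus uniform on [a, t] and integrates by absolute
    continuity. *)
Lemma maximal_slope_evi (T : R) (u : R -> Pp R d 2) :
  continuous_curve (@wasserstein R d 2) T u ->
  maximal_slope_curve (@wasserstein R d 2) (interaction_energy W) 0 T u ->
  exists (f : R -> R) (N : set R),
  [/\ leb.-negligible N,
    forall p q : R, 0 < p -> p <= q -> q < T -> f q <= f p,
    forall q, 0 < q < T -> ~ N q -> energy W (sval (u q)) = (f q)%:E &
    forall (y : Pp R d 2) ey, energy W (sval y) = ey%:E ->
    forall a t, 0 <= a <= t -> 0 < t < T -> ~ N t ->
      2^-1 * w2 (sval (u t)) (sval y) ^+ 2 - 2^-1 * w2 (sval (u a)) (sval y) ^+ 2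
      <= (ey - f t) * (t - a)].
Proof.
move=> hu [[m [im hm]] [f [fmono f1 f2]]].
move: f1 f2 => [N1 [mN1 N10 hN1]] [N2 [mN2 N20 hN2]].
have nN : leb.-negligible (N1 `|` N2) by apply: negligibleU; apply/negligibleP.
exists f, (N1 `|` N2).
have hf q : 0 < q < T -> ~ (N1 `|` N2) q -> energy W (sval (u q)) = (f q)%:E.
  move=> qT /not_orP[Nq _]; apply: contrapT => h; apply/Nq/hN1 => /= /(_ _)h'; apply: h.
  by apply: h'; rewrite in_itv.
split => // y ey Ey.
have cu r : 0 < r < T -> forall e, 0 < e -> exists2 c, 0 < c & forall q, 0 < q < T ->
     `|q - r| < c -> w2 (sval (u q)) (sval (u r)) <= e.
  move=> /andP[r0 rT] e e0; have [|c c0 hc] := @continuous_curve_w2 T u hu r _ e e0; first by rewrite !ltW.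
  by exists c => // q /andP[q0 qT]; apply: hc; rewrite !ltW.
have slope r t : 0 < r -> r <= t -> t < T -> ~ (N1 `|` N2) r ->
    right_slope_le (fun p => 2^-1 * w2 (sval (u p)) (sval y) ^+ 2) t r (ey - f t).
  move=> r0 rt tT Nr; have rT : 0 < r < T by rewrite r0 (le_lt_trans rt).
  apply: (@right_slope_le_mono _ _ _ (ey - f r)); first by rewrite lerD2l lerN2 fmono.
  have [df [m' [hm' hs]]] : derivable f r 1 /\ exists m', is_metric_derivative (@wasserstein R d 2) u r m' /\
      ((derive1 f r)%:E <= - (2^-1 * m' ^+ 2)%:E
             - (2^-1)%:E * (local_slope (@wasserstein R d 2) (interaction_energy W) (u r) ^+ 2))%E.
    apply: contrapT => h; apply: Nr; right; apply: hN2 => /= h'; apply: h.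
    by apply: h'; rewrite in_itv.
  (* An infinite slope would make the right-hand side equal to -oo, below the real derivative of
     [f]. *)
  have [l hl] : exists l, local_slope (@wasserstein R d 2) (interaction_energy W) (u r) = l%:E.
    move: hs; case: (local_slope _ _ _) => [l| |]; first by exists l.
    - by rewrite expe2 mulyy gt0_muley// ?lte_fin// addeNy leeNy_eq.
    - by rewrite expe2 mulNyNy gt0_muley// ?lte_fin// addeNy leeNy_eq.
  rewrite hl -EFin_expe -EFinM -EFinN -EFinB lee_fin in hs.
  exact: (evi_at_point hWeven hWconvex hWreg nN hf cu rT Nr df hm' hl hs Ey tT).
have pos a t : 0 < a -> a <= t -> t < T -> ~ (N1 `|` N2) t ->
    2^-1 * w2 (sval (u t)) (sval y) ^+ 2 - 2^-1 * w2 (sval (u a)) (sval y) ^+ 2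
      <= (ey - f t) * (t - a).
  move=> a0 at' tT Nt.
  (* [m] is integrable on compact subintervals of ]0, T[ only. Cut off to [a, t] and made
     nonnegative, it becomes a modulus integrable on the whole line. *)
  pose k0 r : R := `|(m \_ `[a, t]%classic) r|.
  have mI p q : measurable (`[p, q]%classic : set R) by exact: measurable_itv.
  have ik0 : leb.-integrable setT (EFin \o k0).
    have h : leb.-integrable setT (EFin \o m \_ `[a, t]).
      by rewrite -restrict_EFin; apply/integrable_restrict => //=; rewrite setTI; exact: im.
    exact: (integrable_norm h).
  have k0E p q r : a <= p -> q <= t -> r \in `[p, q]%classic -> k0 r = `|m r|.
    move=> ap qt; rewrite inE/= in_itv/= => /andP[pr rq].
    by rewrite /k0 patchE mem_set//= in_itv/= (le_trans ap pr) (le_trans rq qt).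
  have k00 r : 0 <= k0 r by exact: normr_ge0.
  have ik p q : leb.-integrable `[p, q]%classic (EFin \o k0) by exact: integrableS ik0.
  have w2m p q : a <= p -> p <= q -> q <= t ->
      w2 (sval (u p)) (sval (u q)) <= \int[leb]_(r in `[p, q]) k0 r.
    move=> ap pq qt; rewrite -wassersteinE.
    apply: le_trans (hm p q (lt_le_trans a0 ap) pq (le_lt_trans qt tT)) _.
    apply: le_Rintegral => //.
    - exact: im (lt_le_trans a0 ap) pq (le_lt_trans qt tT).
    - by move=> r rpq; rewrite (k0E p q) ?inE//; exact: ler_norm.
  pose J := \int[leb]_(r in `[a, t]) k0 r.
  have J0 : 0 <= J by exact: Rintegral_ge0.
  have w2J p : a <= p -> p <= t -> w2 (sval (u a)) (sval (u p)) <= J.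
    move=> ap pt; apply: le_trans (w2m a p (lexx a) ap pt) _.
    have := Rintegral_itvB (ik a t) (_ : (BLeft a <= BRight p)%O) (_ : (BRight p <= BRight t)%O).
    rewrite !bnd_simp => /(_ ap pt) h; rewrite -subr_ge0 h; exact: Rintegral_ge0.
  pose B := w2 (sval (u a)) (sval y) + J.
  have B0 : 0 <= B by rewrite addr_ge0// w2_ge0.
  have DB p : a <= p -> p <= t -> w2 (sval (u p)) (sval y) <= B.
    move=> ap pt; apply: le_trans (w2_tri (svalP (u p)) (svalP (u a)) (svalP y)) _.
    by rewrite addrC lerD2l w2_sym w2J.
  apply: (@ac_growth _ (fun p => 2^-1 * w2 (sval (u p)) (sval y) ^+ 2) a t (ey - f t) (fun r => B * k0 r) (N1 `|` N2)) => //.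
  - by move=> r; rewrite mulr_ge0.
  - by rewrite (_ : EFin \o _ = (fun r => B%:E * (EFin \o k0) r)%E); [exact: integrableZl|apply/funext].
  - move=> p q ap pq qt.
    rewrite RintegralZl// -mulrBr subr_sqr.
    have h1 := w2_dist (svalP (u q)) (svalP (u p)) (svalP y).
    have h2 := w2m p q ap pq qt; rewrite w2_sym in h2.
    have h3 := DB p ap (le_trans pq qt); have h4 := DB q (le_trans ap pq) qt.
    rewrite normrM (ger0_norm (_ : 0 <= 2^-1))// normrM mulrCA mulrC.
    apply: ler_pM => //; last exact: le_trans h2.
    rewrite ger0_norm ?addr_ge0 ?w2_ge0//.
    move: h3 h4; move: (w2 _ _) (w2 _ _) => x1 x2; lra.
  - move=> r /andP[ar rt] Nr; apply: slope => //; [exact: lt_le_trans ar|exact: ltW].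
(* Absolute continuity stops short of time 0, so the case a = 0 is a limit of small positive initial
   times, by continuity of the curve up to 0. *)
move=> a1 t /andP[]; rewrite le_eqVlt => /orP[/eqP<- _|a0 at'] /andP[t0 tT] Nt; last exact: pos.
apply/ler_addgt0Pr => e e0.
have T0 : 0 < T by exact: lt_trans tT.
have [|c c0 hc] := @w2_sqr_continuous T u y hu 0 _ e e0; first by rewrite lexx ltW.
pose E := `|ey - f t| + 1.
have E0 : 0 < E by rewrite ltr_wpDl.
pose a := Order.min (c / 2) (Order.min (e / 2 / E) t).
have a0 : 0 < a by rewrite !lt_min t0 !divr_gt0.
have ac : a <= c / 2 by rewrite ge_min lexx.
have aE : a <= e / 2 / E by rewrite /a !ge_min lexx orbT.
have at' : a <= t by rewrite /a !ge_min lexx !orbT.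
have h1 := pos a t a0 at' tT Nt.
have := hc a; rewrite (ltW a0) (le_trans at' (ltW tT)) subr0 gtr0_norm// => /(_ isT).
have ac' : a < c by apply: le_lt_trans ac _; rewrite ltr_pdivrMr// ltr_pMr// ltr1n.
move=> /(_ ac'); rewrite ler_norml => /andP[_ h2].
have h3 : (ey - f t) * (t - a) <= (ey - f t) * t + e / 2.
  rewrite mulrBr lerD2l; apply: le_trans (ler_norm _) _; rewrite normrN normrM (gtr0_norm a0).
  apply: (@le_trans _ _ (E * a)); first by rewrite ler_wpM2r ?(ltW a0)// lerDl.
  by rewrite mulrC -ler_pdivlMr.
rewrite subr0; move: h1 h2 h3; move: (w2 _ _) (w2 _ _) (w2 _ _) => x1 x2 x3; lra.
Qed.

End evi_integrated.

Section bounded_integrals.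
Context {d : measure_display} {T : measurableType d} {R : realType} (P : probability T R).

Lemma bounded_integrable (f : T -> R) (M : R) : measurable_fun setT f ->
  (forall x, `|f x| <= M) -> P.-integrable setT (EFin \o f).
Proof.
move=> mf fM; apply: measurable_bounded_integrable => //.
  by rewrite ltey_eq fin_num_measure.
by exists M; split; [exact: num_real|move=> t Mt x _; exact: le_trans (fM x) (ltW Mt)].
Qed.

Lemma Rintegral_cst_probability (c : R) : \int[P]_x c = c.
Proof. by rewrite /Rintegral (integral_cst_probability P c%:E). Qed.

Lemma Rintegral_le_bound (f : T -> R) (M : R) : measurable_fun setT f ->
  (forall x, `|f x| <= M) -> `|\int[P]_x f x| <= M.
Proof.
move=> mf fM; have fi := bounded_integrable mf fM.
apply: le_trans (le_normr_Rintegral _ fi) _ => //.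
rewrite -[leRHS]Rintegral_cst_probability; apply: le_Rintegral => //.
- exact: integrable_norm.
- by apply: (@bounded_integrable _ `|M|).
Qed.

Lemma integrableB_EFin (f g : T -> R) : P.-integrable setT (EFin \o f) ->
  P.-integrable setT (EFin \o g) -> P.-integrable setT (EFin \o (fun x => f x - g x)).
Proof.
move=> hf hg; rewrite (_ : EFin \o _ = (EFin \o f) \- (EFin \o g))%E//.
exact: integrableB.
Qed.

Lemma integrableD_EFin (f g : T -> R) : P.-integrable setT (EFin \o f) ->
  P.-integrable setT (EFin \o g) -> P.-integrable setT (EFin \o (fun x => f x + g x)).
Proof.
move=> hf hg; rewrite (_ : EFin \o _ = (EFin \o f) \+ (EFin \o g))%E//.
exact: integrableD.
Qed.

Lemma integrableZl_EFin (f : T -> R) (c : R) : P.-integrable setT (EFin \o f) ->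
  P.-integrable setT (EFin \o (fun x => c * f x)).
Proof.
move=> hf; rewrite (_ : EFin \o _ = (fun x => c%:E * (EFin \o f) x)%E); last exact/funext.
exact: integrableZl.
Qed.

Lemma Rintegral_sum (I : Type) (s : seq I) (f : I -> T -> R) :
  (forall i, P.-integrable setT (EFin \o f i)) ->
  \int[P]_x (\sum_(i <- s) f i x) = \sum_(i <- s) \int[P]_x f i x.
Proof.
move=> hf; elim: s => [|i s IH].
  rewrite big_nil; under eq_Rintegral do rewrite big_nil.
  exact: Rintegral_cst_probability.
rewrite big_cons -IH -RintegralD//; first by apply: eq_Rintegral => x _; rewrite big_cons.
rewrite (_ : EFin \o _ = (fun x => \sum_(j <- s) (EFin \o f j) x)%E); first exact: integrable_sum.
by apply/funext => x; rewrite /= sumEFin.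
Qed.

End bounded_integrals.

Lemma coordB {R : realType} {d : nat} (x y : 'rV[R]_d) i : (x - y) 0 i = x 0 i - y 0 i.
Proof. by rewrite !mxE. Qed.

(** * The velocity field *)

Section conv_grad.
Context {R : realType} {d : nat} (s : R) (W : 'rV[R]_d -> R).
Hypothesis hs : 0 < s.
Hypothesis hWeven : forall x, W (- x) = W x.
Hypothesis hWconvex : convex_function setT W.
Hypothesis hWreg : C1_holder_loc s W.
Local Notation Rd := (borelRd R d).

Definition supp_in (r : R) (mu : probability Rd R) :=
  mu [set x : 'rV[R]_d | ~ (enorm x <= r)] = 0%E.

(* Truncation turns almost sure bounds into bounds that hold everywhere. *)
Definition clip (r : R) (x : 'rV[R]_d) : 'rV[R]_d := if enorm x <= r then x else 0.

Lemma measurable_enorm_gt {d0} {T : measurableType d0} (X : T -> 'rV[R]_d) (r : R) :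
  measurableRd X -> measurable [set t | ~ (enorm (X t) <= r)].
Proof.
move=> mX; rewrite (_ : [set _ | _] = ~` ((fun t => enorm (X t)) @^-1` `]-oo, r])).
  by apply: measurableC; apply: measurable_preimage; [exact: measurable_enorm|exact: measurable_itv].
by apply/seteqP; split => t /=; rewrite in_itv.
Qed.

Lemma supp_in_law {d0} {T : measurableType d0} (P : probability T R) (X : T -> 'rV[R]_d) mu r :
  is_law P (X : T -> Rd) mu -> supp_in r mu <-> P [set t | ~ (enorm (X t) <= r)] = 0%E.
Proof.
move=> [mX h]; rewrite /supp_in -h//.
by apply: (@measurable_enorm_gt _ _ (fun x : Rd => x)); exact: measurable_id.
Qed.

Lemma clip_le r x : 0 <= r -> enorm (clip r x) <= r.
Proof. by move=> r0; rewrite /clip; case: ifP => //; rewrite enorm0. Qed.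

Lemma measurable_clip r : measurable_fun setT (clip r : Rd -> Rd).
Proof.
apply: measurable_coordP => i.
rewrite (_ : (fun t => _) = (fun x : 'rV[R]_d => (if enorm x <= r then x 0 i else 0))); last first.
  by apply/funext => x; rewrite /clip; case: ifP => //; rewrite mxE.
apply: measurable_fun_ifT => //; last exact: measurable_coord.
by apply: measurable_fun_ler => //; apply: measurable_enorm; exact: measurable_id.
Qed.

Lemma is_law_clip {d0} {T : measurableType d0} (P : probability T R) (X : T -> 'rV[R]_d) mu r :
  is_law P (X : T -> Rd) mu -> supp_in r mu -> is_law P (fun t => clip r (X t) : Rd) mu.
Proof.
move=> hX hr; have [mX h] := hX.
have mc : measurableRd (fun t => clip r (X t)) by exact: measurableT_comp (measurable_clip r) mX.
split => // A mA; rewrite -h//.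
have N0 := (supp_in_law r hX).1 hr; set N := [set t | _] in N0.
have mN : measurable N by exact: measurable_enorm_gt.
have e t : ~ N t -> clip r (X t) = X t by move=> /contrapT ht; rewrite /clip ht.
have le (Y Z : T -> 'rV[R]_d) : measurableRd Y -> measurableRd Z -> (forall t, ~ N t -> Y t = Z t) ->
    (P ((Y : T -> Rd) @^-1` A) <= P ((Z : T -> Rd) @^-1` A))%E.
  move=> mY mZ YZ; apply: (@le_trans _ _ (P (N `|` (Z : T -> Rd) @^-1` A))).
    apply: le_measure; rewrite ?inE.
    - exact: measurable_preimage.
    - by apply: measurableU => //; exact: measurable_preimage.
    - by move=> t /= At; have [Nt|Nt] := pselect (N t); [left|right; rewrite /= -YZ].
  apply: le_trans (measureU2 _ _ _) _ => //; first exact: measurable_preimage.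
  by rewrite [X in (X + _ <= _)%E](_ : _ = 0%E)// add0e.
by apply/eqP; rewrite eq_le !le// => t /e.
Qed.

Lemma measurable_gradW {d0} {T : measurableType d0} (X : T -> 'rV[R]_d) i :
  measurableRd X -> measurable_fun setT (fun t => grad W (X t) 0 i).
Proof.
move=> mX; apply: (@measurableT_comp _ _ _ _ _ _ ((fun x => grad W x 0 i) : Rd -> R) _ X) => //.
have h := @gradW_continuous R d s W hWreg i; exact: (continuous_measurableRd h).
Qed.

Lemma supp_in_finite_moment r mu : supp_in r mu -> finite_moment 2 mu.
Proof.
move=> hr; apply/finite_moment2; rewrite (m2e_law (is_law_clip (is_law_id mu) hr)).
have mc := measurable_clip r.
apply: (@le_lt_trans _ _ (\int[mu]_x (cst (`|r| ^+ 2)%:E x))%E).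
  apply: ge0_le_integral => //.
  - by move=> x _; rewrite lee_fin sqr_ge0.
  - by apply/measurable_EFinP; exact: measurable_enorm_sqr.
  - move=> x _; rewrite lee_fin ler_pXn2r ?nnegrE ?enorm_ge0//.
    by rewrite /clip; case: ifP => [h|_]; [exact: le_trans h (ler_norm r)|rewrite enorm0].
by rewrite (integral_cst_probability mu (`|r| ^+ 2)%:E) ltry.
Qed.

Section law.
Context {d0 : measure_display} {T : measurableType d0} (P : probability T R).
Implicit Types (X Y : T -> 'rV[R]_d).

Lemma conv_gradE X mu z i : is_law P (X : T -> Rd) mu ->
  conv_grad W mu z 0 i = \int[P]_t grad W (z - X t) 0 i.
Proof.
move=> hX; rewrite mxE (is_law_Rintegral hX)//.
by apply: (@measurable_gradW _ _ (fun y : Rd => z - y)); apply: measurable_subRd;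
  [exact: measurable_cst|exact: measurable_id].
Qed.

Lemma measurable_gradW_sub X z i : measurableRd X ->
  measurable_fun setT (fun t => grad W (z - X t) 0 i).
Proof. by move=> mX; apply: measurable_gradW; apply: measurable_subRd => //; exact: measurable_cst. Qed.

Lemma gradW_integrable X r z i : measurableRd X -> (forall t, enorm (X t) <= r) ->
  P.-integrable setT (fun t => (grad W (z - X t) 0 i)%:E).
Proof.
move=> mX Xr; have [M M0 hM] := gradW_bounded hs hWreg (enorm z + r).
apply: (@bounded_integrable _ _ _ _ _ M); first exact: measurable_gradW_sub.
by move=> t; apply: hM; apply: le_trans (enormD _ _) _; rewrite enormN lerD2l.
Qed.

Lemma conv_grad_bound X mu z i (rho M : R) : is_law P (X : T -> Rd) mu ->
  (forall x i, enorm x <= rho -> `|grad W x 0 i| <= M) ->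
  (forall t, enorm (z - X t) <= rho) -> `|conv_grad W mu z 0 i| <= M.
Proof.
move=> hX hM hr; rewrite (conv_gradE z i hX); apply: Rintegral_le_bound.
  by apply: measurable_gradW_sub; have [] := hX.
by move=> t; exact: hM.
Qed.

Lemma conv_grad_monoX X mu r z z' : is_law P (X : T -> Rd) mu -> (forall t, enorm (X t) <= r) ->
  0 <= dotp (conv_grad W mu z - conv_grad W mu z') (z - z').
Proof.
move=> hX Xr; have [mX _] := hX.
have ii z0 i : P.-integrable setT (EFin \o (fun t => grad W (z0 - X t) 0 i)) by exact: gradW_integrable Xr.
have -> : dotp (conv_grad W mu z - conv_grad W mu z') (z - z') =
    \int[P]_t dotp (grad W (z - X t) - grad W (z' - X t)) (z - z').
  rewrite /dotp Rintegral_sum; last first.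
    move=> i; under eq_fun do rewrite coordB mulrC.
    by apply: integrableZl_EFin; exact: integrableB_EFin.
  apply: eq_bigr => i _.
  have -> : (conv_grad W mu z - conv_grad W mu z') 0 i =
      \int[P]_t grad W (z - X t) 0 i - \int[P]_t grad W (z' - X t) 0 i.
    by rewrite coordB; congr (_ - _); exact: conv_gradE.
  under [RHS]eq_Rintegral do rewrite coordB mulrC.
  rewrite RintegralZl//; last exact: integrableB_EFin.
  by rewrite RintegralB// mulrC.
apply: Rintegral_ge0 => t _.
have := gradW_mono hWconvex hWreg (z - X t) (z' - X t).
by rewrite opprB addrA subrK.
Qed.

End law.
End conv_grad.

#[local] Opaque w2 energy wasserstein conv_grad.

Section field.
Context {R : realType} {d : nat} (s : R) (W : 'rV[R]_d -> R).
Hypothesis hs : 0 < s.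
Hypothesis hWeven : forall x, W (- x) = W x.
Hypothesis hWconvex : convex_function setT W.
Hypothesis hWreg : C1_holder_loc s W.
Local Notation Rd := (borelRd R d).

Lemma Rintegral_le {d0} {T : measurableType d0} (P : probability T R) (f : T -> R) (c : R) :
  P.-integrable setT (EFin \o f) -> (\int[P]_x (f x)%:E <= c%:E)%E -> \int[P]_x f x <= c.
Proof. by move=> fi h; rewrite -lee_fin fineK//; exact: integrable_fin_num. Qed.

(** A bound by e plus K times a squared distance integrates against a nearly optimal coupling and
    yields w2^2. The constant depends on the ball only, hence is common to all laws supported there;
    [r + r] bounds the differences of two points of the ball. *)
Lemma conv_grad_modulus (r e : R) : 0 < e -> exists2 K, 0 <= K &
  forall mu nu z z' i, supp_in r mu -> supp_in r nu -> enorm z <= r -> enorm z' <= r ->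
    `|conv_grad W mu z 0 i - conv_grad W nu z' 0 i| <=
    e + K * (enorm (z - z') ^+ 2 + w2 mu nu ^+ 2).
Proof.
move=> e0; have e2 : 0 < e / 2 by rewrite divr_gt0.
have [K K0 hK] := gradW_modulus hs hWreg (r + r) e2.
exists (2 * K); first by rewrite mulr_ge0.
move=> mu nu z z' i hmu hnu zr zr'.
have r0 : 0 <= r := le_trans (enorm_ge0 z) zr.
have fmu := supp_in_finite_moment hmu; have fnu := supp_in_finite_moment hnu.
pose eta := e / (4 * K + 4).
have K40 : 0 < 4 * K + 4 by rewrite ltr_wpDl// mulr_ge0.
have eta0 : 0 < eta by rewrite divr_gt0.
have etaK : 2 * K * eta <= e / 2.
  rewrite /eta mulrA ler_pdivrMr// mulrDr (_ : e / 2 * (4 * K) = 2 * K * e); last by field.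
  by rewrite lerDl mulr_ge0// ltW.
have [g [g1 g2 gc]] : exists gamma : probability (Rd * Rd)%type R, [/\ is_law gamma fst mu, is_law gamma snd nu &
    (\int[gamma]_z (enorm ((z.1 : 'rV_d) - z.2) ^+ 2)%:E < (w2 mu nu ^+ 2 + eta)%:E)%E].
  by apply: W2e_near; rewrite -w2_sqrE// lte_fin ltrDl.
have [m1 _] := g1; have [m2 _] := g2.
pose X (w : Rd * Rd) := clip r w.1; pose Y (w : Rd * Rd) := clip r w.2.
have lX : is_law g (X : _ -> Rd) mu by exact: is_law_clip.
have lY : is_law g (Y : _ -> Rd) nu by exact: is_law_clip.
have [mX _] := lX; have [mY _] := lY.
have Xr w : enorm (X w) <= r by exact: clip_le.
have Yr w : enorm (Y w) <= r by exact: clip_le.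
pose Q w := enorm (X w - Y w) ^+ 2.
have mQ : measurable_fun setT Q by exact: measurable_enorm_sqr_sub.
have Q0 w : 0 <= Q w by exact: sqr_ge0.
have iQ : g.-integrable setT (EFin \o Q).
  apply: (@bounded_integrable _ _ _ _ _ ((r + r) ^+ 2)) => // w.
  rewrite ger0_norm// ler_pXn2r ?nnegrE ?enorm_ge0 ?addr_ge0//.
  by apply: le_trans (enormD _ _) _; rewrite enormN; apply: lerD.
have QI : \int[g]_w Q w <= w2 mu nu ^+ 2 + eta.
  apply: Rintegral_le; [exact: iQ|apply: le_trans (ltW gc)].
  pose N := [set w : Rd * Rd | ~ (enorm (w.1 : 'rV[R]_d) <= r)] `|` [set w : Rd * Rd | ~ (enorm (w.2 : 'rV[R]_d) <= r)].
  have mN1 : measurable [set w : Rd * Rd | ~ (enorm (w.1 : 'rV[R]_d) <= r)] by exact: measurable_enorm_gt.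
  have mN2 : measurable [set w : Rd * Rd | ~ (enorm (w.2 : 'rV[R]_d) <= r)] by exact: measurable_enorm_gt.
  have mN : measurable N by exact: measurableU.
  apply: (@ge0_ae_le_integral _ _ _ _ _ _ N) => //.
  - exact: measurable_enorm_sqr_sub.
  - by move=> w; exact: sqr_ge0.
  - apply/eqP; rewrite -measure_le0; apply: le_trans (measureU2 _ _ _) _ => //.
    by rewrite [X in (X + _)%E]((supp_in_law r g1).1 hmu) [X in (_ + X)%E]((supp_in_law r g2).1 hnu) adde0.
  - by move=> w /not_orP[/= /contrapT h1 /contrapT h2]; rewrite /Q /X /Y /clip h1 h2.
have ii1 : g.-integrable setT (EFin \o (fun w => grad W (z - X w) 0 i)) by exact: (gradW_integrable hs hWreg g z i mX Xr).
have ii2 : g.-integrable setT (EFin \o (fun w => grad W (z' - Y w) 0 i)) by exact: (gradW_integrable hs hWreg g z' i mY Yr).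
have -> : conv_grad W mu z 0 i - conv_grad W nu z' 0 i =
    \int[g]_w (grad W (z - X w) 0 i - grad W (z' - Y w) 0 i).
  by rewrite RintegralB//; congr (_ - _); exact: (conv_gradE hWreg).
have ii3 := integrableB_EFin ii1 ii2.
apply: le_trans (le_normr_Rintegral measurableT ii3) _.
pose c := e / 2 + 2 * K * enorm (z - z') ^+ 2.
apply: (@le_trans _ _ (\int[g]_w (c + (2 * K) * Q w))).
  apply: le_Rintegral => //.
  - exact: (integrable_norm ii3).
  - apply: integrableD_EFin; last exact: integrableZl_EFin.
    exact: (@bounded_integrable _ _ _ _ _ `|c|).
  - move=> w _; have := hK (z - X w) (z' - Y w) i.
    have b (x y : 'rV[R]_d) : enorm x <= r -> enorm y <= r -> enorm (x - y) <= r + r.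
      by move=> xr yr; apply: le_trans (enormD _ _) _; rewrite enormN; exact: lerD.
    move=> /(_ (b _ _ zr (Xr w)) (b _ _ zr' (Yr w))) h; apply: le_trans h _.
    have := enorm_sqrD_young (z - z') (- (X w - Y w)) ltr01; rewrite enormN invr1 -/(Q w).
    have -> : z - z' - (X w - Y w) = z - X w - (z' - Y w) by apply/rowP => j; rewrite !mxE; ring.
    by move=> /(ler_wpM2l K0); rewrite /c; clear; lra.
rewrite RintegralD//; last 2 first.
- exact: (@bounded_integrable _ _ _ _ _ `|c|).
- exact: integrableZl_EFin.
rewrite RintegralZl// Rintegral_cst_probability.
have K20 : 0 <= 2 * K by rewrite mulr_ge0.
by have := ler_wpM2l K20 QI; move: etaK; rewrite /c mulrDr; clear; lra.
Qed.

Lemma conv_grad_continuous r mu i : supp_in r mu ->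
  continuous (fun z => conv_grad W mu z 0 i).
Proof.
move=> hmu z; apply/(@cvgrPdist_le _ R^o _ (nbhs z) (nbhs_filter z)) => e e0.
have e2 : 0 < e / 2 by rewrite divr_gt0.
(* A ball that contains the support and the unit neighbourhood of [z], as the modulus is uniform on
   balls only. *)
pose r' := `|r| + enorm z + 1.
have hmu' : supp_in r' mu.
  apply/eqP; rewrite -measure_le0 -[leRHS]hmu; apply: le_measure; rewrite ?inE;
    try by apply: (@measurable_enorm_gt _ _ _ _ (fun x : Rd => x)); exact: measurable_id.
  move=> x /=; apply: contra_not => /le_trans; apply; rewrite /r'.
  by have := ler_norm r; have := enorm_ge0 z; lra.
have [K K0 hK] := conv_grad_modulus r' e2.
apply/nbhs_enormP; exists (Order.min 1 (e / 2 / (K + 1))).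
  by rewrite lt_min ltr01 !divr_gt0// ltr_wpDl.
move=> y; rewrite lt_min => /andP[y1 y2].
have zr' : enorm z <= r' by rewrite /r'; have := normr_ge0 r; lra.
have yr' : enorm y <= r'.
  have -> : y = z - (z - y) by rewrite opprB addrCA subrr addr0.
  by apply: le_trans (enormD _ _) _; rewrite enormN /r'; have := normr_ge0 r; lra.
apply: le_trans (hK _ _ _ _ i hmu' hmu' zr' yr') _.
rewrite w2_refl expr0n/= addr0 [leRHS](splitr e) lerD2l.
move: y2; rewrite ltr_pdivlMr ?ltr_wpDl// => y2; apply: le_trans (ltW y2).
rewrite mulrC expr2; apply: ler_pM; rewrite ?mulr_ge0 ?enorm_ge0//.
  by rewrite ler_piMl ?enorm_ge0 ?ltW.
by rewrite lerDl.
Qed.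

End field.

Section product_law.
Context {d1 d2 : measure_display} {T1 : measurableType d1} {T2 : measurableType d2} {R : realType}
  (P1 : probability T1 R) (P2 : probability T2 R).

Lemma fst_law : is_law (P1 \x P2)%E fst P1.
Proof.
split=> [|A mA]; first exact: measurable_fst.
rewrite -[RHS]mule1 -(@probability_setT _ _ _ P2) -product_measure1E//; congr ((P1 \x P2)%E _).
by apply/seteqP; split => -[x y]//= [].
Qed.

Lemma snd_law : is_law (P1 \x P2)%E snd P2.
Proof.
split=> [|A mA]; first exact: measurable_snd.
rewrite -[RHS]mul1e -(@probability_setT _ _ _ P1) -product_measure1E//; congr ((P1 \x P2)%E _).
by apply/seteqP; split => -[x y]//= [].
Qed.

End product_law.

Lemma integrable_dominated {R : realType} {d1} {T1 : measurableType d1} (Q : probability T1 R) (f k : T1 -> R) :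
  measurable_fun setT f -> (forall x, `|f x| <= k x) -> Q.-integrable setT (EFin \o k) ->
  Q.-integrable setT (EFin \o f).
Proof.
move=> mf fk ik; apply: (@le_integrable _ _ _ _ _ _ _ (EFin \o k)) => //.
  exact/measurable_EFinP.
by move=> x _; rewrite /= lee_fin; exact: le_trans (fk x) (ler_norm _).
Qed.

Section product_weight.
Context {d0 : measure_display} {T : measurableType d0} {R : realType} (P : probability T R).
Variables (h : T * T -> R) (g : T -> R) (M : R).
Hypothesis mh : measurable_fun setT h.
Hypothesis hM : forall z, `|h z| <= M.
Hypothesis ig : P.-integrable setT (EFin \o g).

Let mg : measurable_fun setT g.
Proof. exact/measurable_EFinP/(measurable_int _ ig). Qed.

Let dominated (p : T * T -> T) : is_law (P \x P)%E p P ->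
  (P \x P)%E.-integrable setT (EFin \o (fun z => h z * g (p z))).
Proof.
move=> hp; have [mp _] := hp.
apply: (@integrable_dominated _ _ _ _ _ (fun z => M * `|g (p z)|)).
- by apply: measurable_funM => //; exact: measurableT_comp.
- by move=> z; rewrite normrM ler_wpM2r.
- apply: integrableZl_EFin.
  apply/(is_law_integrable hp (f := EFin \o (fun t => `|g t|))).
    by apply/measurable_EFinP; exact: measurableT_comp.
  exact: (integrable_norm ig).
Qed.

Let section_integrable (k : T -> R) : measurable_fun setT k -> (forall t, `|k t| <= M) ->
  P.-integrable setT (EFin \o k).
Proof. by move=> mk hk; exact: bounded_integrable hk. Qed.

Lemma prod_weight1_integrable : (P \x P)%E.-integrable setT (EFin \o (fun z => h z * g z.1)).
Proof. exact: (dominated (fst_law P P)). Qed.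

Lemma prod_weight2_integrable : (P \x P)%E.-integrable setT (EFin \o (fun z => h z * g z.2)).
Proof. exact: (dominated (snd_law P P)). Qed.

(** Fubini for a bounded weight times an integrable factor: [h] will be a coordinate of grad W at a
    difference of bounded particles, [g] a coordinate of their displacement. *)
Lemma prod_weight1 :
  \int[(P \x P)%E]_z (h z * g z.1) = \int[P]_t ((\int[P]_t' h (t, t')) * g t).
Proof.
rewrite /Rintegral; congr fine.
rewrite -(integral12_prod_meas1 prod_weight1_integrable).
apply: eq_integral => t _; rewrite /fubini_F/= .
have mk : measurable_fun setT (fun t' => h (t, t')) by exact: measurableT_comp mh (pair1_measurable t).
have ik := section_integrable mk (fun t' => hM (t, t')).
rewrite -[RHS]/((Rintegral _ _ _ * g t)%:E) -(RintegralZr _ measurableT ik) /Rintegral fineK//.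
apply: integrable_fin_num => //.
rewrite (_ : (fun x => _) = EFin \o (fun x => g t * h (t, x))); first exact: integrableZl_EFin.
by apply/funext => x; rewrite /= mulrC.
Qed.

Lemma prod_weight2 :
  \int[(P \x P)%E]_z (h z * g z.2) = \int[P]_t ((\int[P]_t' h (t', t)) * g t).
Proof.
rewrite /Rintegral; congr fine.
rewrite -(integral21_prod_meas1 prod_weight2_integrable).
apply: eq_integral => t _; rewrite /fubini_G/= .
have mk : measurable_fun setT (fun t' => h (t', t)) by exact: measurableT_comp mh (pair2_measurable t).
have ik := section_integrable mk (fun t' => hM (t', t)).
rewrite -[RHS]/((Rintegral _ _ _ * g t)%:E) -(RintegralZr _ measurableT ik) /Rintegral fineK//.
apply: integrable_fin_num => //.
rewrite (_ : (fun x => _) = EFin \o (fun x => g t * h (x, t))); first exact: integrableZl_EFin.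
by apply/funext => x; rewrite /= mulrC.
Qed.

End product_weight.

(** * The Euler scheme *)

Section energy_inequality.
Context {R : realType} {d : nat} (s : R) (W : 'rV[R]_d -> R).
Hypothesis hs : 0 < s.
Hypothesis hWeven : forall x, W (- x) = W x.
Hypothesis hWconvex : convex_function setT W.
Hypothesis hWreg : C1_holder_loc s W.
Local Notation Rd := (borelRd R d).
Context {d0 : measure_display} {T : measurableType d0} (P : probability T R).
Variables (X Y : T -> 'rV[R]_d) (mu nu : probability Rd R) (r : R).
Hypothesis hX : is_law P (X : T -> Rd) mu.
Hypothesis hY : is_law P (Y : T -> Rd) nu.
Hypothesis Xr : forall t, enorm (X t) <= r.
Hypothesis fnu : finite_moment 2 nu.

Lemma supp_in_bounded : supp_in r mu.
Proof.
by apply/(supp_in_law r hX); rewrite (_ : [set t | _] = set0) ?measure0//; apply/seteqP; split => t //=; rewrite Xr.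
Qed.

Lemma measurable_conv_grad i : measurable_fun setT (fun t => conv_grad W mu (X t) 0 i).
Proof.
have [mX _] := hX.
apply: (@measurableT_comp _ _ _ _ _ _ ((fun x => conv_grad W mu x 0 i) : Rd -> R) _ X) => //.
have h := conv_grad_continuous hs hWreg supp_in_bounded (i := i); exact: (continuous_measurableRd h).
Qed.

Let Z t := Y t - X t.

Lemma displacement_integrable i : P.-integrable setT (EFin \o (fun t => Z t 0 i)).
Proof.
have [mX _] := hX; have [mY _] := hY.
have mZ : measurableRd Z by exact: measurable_subRd.
apply: (@integrable_dominated _ _ _ _ _ (fun t => (1 + r) + enorm (Y t) ^+ 2)).
- exact: measurable_coord_comp.
- move=> t; apply: le_trans (coord_le _ _) _; apply: le_trans (enormD _ _) _; rewrite enormN.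
  have := Xr t; have := sqr_ge0 (enorm (Y t) - 1); rewrite sqrrB1 expr2; have := enorm_ge0 (Y t); nra.
- apply: integrableD_EFin; first by apply: (@bounded_integrable _ _ _ _ _ `|1 + r|).
  apply/integrableP; split.
    by apply/measurable_EFinP; exact: measurable_enorm_sqr.
  under eq_integral do rewrite /= ger0_norm ?sqr_ge0//.
  by rewrite -(m2e_law hY); exact/finite_moment2.
Qed.

(** The tangent inequality of [W] at a difference of two independent copies of [X], integrated.
    Exchanging the copies changes the sign of grad W, so the displacements of the two copies
    contribute equally and cancel the factor 1/2 of the energy. Only [mu] is bounded: [nu] will be
    mu_t, whose support is not yet controlled. *)
Lemma energy_inequality (em en : R) : energy W mu = em%:E -> energy W nu = en%:E ->
  em + \int[P]_t dotp (conv_grad W mu (X t)) (Y t - X t) <= en.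
Proof.
move=> Em En; have [mX _] := hX; have [mY _] := hY.
pose W0 x := W x - W 0.
have W00 x : 0 <= W0 x by rewrite subr_ge0; exact: W_min.
have mXi (X' : T -> 'rV[R]_d) (p : T * T -> T) : measurableRd X' -> measurable_fun setT p ->
   measurableRd (fun z => X' (p z)) by move=> m1 m2; exact: measurableT_comp m1 m2.
have mXY (X' : T -> 'rV[R]_d) : measurableRd X' -> measurableRd (fun z : T * T => X' z.1 - X' z.2).
  by move=> m; apply: measurable_subRd; apply: mXi.
have iW (X' : T -> 'rV[R]_d) m e : is_law P (X' : T -> Rd) m -> energy W m = e%:E ->
   (P \x P)%E.-integrable setT (EFin \o (fun z => W0 (X' z.1 - X' z.2))) /\
   \int[(P \x P)%E]_z W0 (X' z.1 - X' z.2) = 2 * e - W 0.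
  move=> hX' E; have [mX' _] := hX'.
  have I := energy_finE hWeven hWconvex hWreg hX' E; split; last by rewrite /Rintegral I.
  apply/integrableP; split.
    apply/measurable_EFinP; apply: measurable_funB => //.
    apply: (@measurableT_comp _ _ _ _ _ _ (W : Rd -> R) _ (fun z : T * T => X' z.1 - X' z.2 : Rd)); last exact: mXY.
    by apply: continuous_measurableRd; exact: W_continuous hWreg.
  under eq_integral do rewrite /= ger0_norm//.
  by rewrite I ltry.
have [iX IX] := iW _ _ _ hX Em; have [iY IY] := iW _ _ _ hY En.
pose h i (z : T * T) := grad W (X z.1 - X z.2) 0 i.
have mh i : measurable_fun setT (h i) by apply: (measurable_gradW hWreg); exact: mXY.
have [M M0 hM] := gradW_bounded hs hWreg (r + r).
have hb i z : `|h i z| <= M.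
  by apply: hM; apply: le_trans (enormD _ _) _; rewrite enormN; exact: lerD.
have iZ := displacement_integrable.
have i1 i := prod_weight1_integrable (mh i) (hb i) (iZ i).
have i2 i := prod_weight2_integrable (mh i) (hb i) (iZ i).
have iF i := integrableB_EFin (i1 i) (i2 i).
have iS : (P \x P)%E.-integrable setT (EFin \o (fun z => \sum_(i < d) (h i z * Z z.1 0 i - h i z * Z z.2 0 i))).
  rewrite (_ : EFin \o _ = (fun z => \sum_(i < d) (EFin \o (fun z => (h i z * Z z.1 0 i - h i z * Z z.2 0 i)%R)) z)%E).
    exact: integrable_sum.
  by apply/funext => z; rewrite /= sumEFin.
have iHZ i : P.-integrable setT (EFin \o (fun t => conv_grad W mu (X t) 0 i * Z t 0 i)).
  apply: (@integrable_dominated _ _ _ _ _ (fun t => M * `|Z t 0 i|)).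
  - by apply: measurable_funM; [exact: measurable_conv_grad|exact/measurable_EFinP/(measurable_int _ (iZ i))].
  - move=> t; rewrite normrM ler_wpM2r//; apply: (conv_grad_bound hWreg i hX hM).
    by move=> t'; apply: le_trans (enormD _ _) _; rewrite enormN; exact: lerD.
  - by apply: integrableZl_EFin; exact: (integrable_norm (iZ i)).
have J1 i : \int[(P \x P)%E]_z (h i z * Z z.1 0 i) = \int[P]_t (conv_grad W mu (X t) 0 i * Z t 0 i).
  rewrite (prod_weight1 (mh i) (hb i) (iZ i)); apply: eq_Rintegral => t _; congr (_ * _).
  by rewrite (conv_gradE hWreg _ _ hX).
have J2 i : \int[(P \x P)%E]_z (h i z * Z z.2 0 i) = - \int[P]_t (conv_grad W mu (X t) 0 i * Z t 0 i).
  rewrite (prod_weight2 (mh i) (hb i) (iZ i)) -mulN1r -RintegralZl//.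
  apply: eq_Rintegral => t _; rewrite mulrA; congr (_ * _).
  rewrite (conv_gradE hWreg _ _ hX) -RintegralZl//; last exact: (gradW_integrable hs hWreg P (X t) i mX Xr).
  by apply: eq_Rintegral => t' _; rewrite /h/= -opprB (gradW_odd hWeven hWconvex hWreg) mxE mulN1r.
have J : \int[(P \x P)%E]_z (\sum_(i < d) (h i z * Z z.1 0 i - h i z * Z z.2 0 i)) =
   2 * \int[P]_t dotp (conv_grad W mu (X t)) (Y t - X t).
  rewrite Rintegral_sum// /dotp (Rintegral_sum _ iHZ).
  rewrite mulr_sumr; apply: eq_bigr => i _.
  by rewrite (RintegralB measurableT (i1 i) (i2 i)) J1 J2 opprK mulrDl mul1r.
have : \int[(P \x P)%E]_z (W0 (X z.1 - X z.2) + \sum_(i < d) (h i z * Z z.1 0 i - h i z * Z z.2 0 i)) <=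
    \int[(P \x P)%E]_z W0 (Y z.1 - Y z.2).
  apply: le_Rintegral => //; first exact: integrableD_EFin.
  move=> z _; have := W_tangent hWconvex hWreg (X z.1 - X z.2) (Y z.1 - Y z.2).
  rewrite (_ : dotp _ _ = \sum_(i < d) (h i z * Z z.1 0 i - h i z * Z z.2 0 i)); first by rewrite /W0; lra.
  by apply: eq_bigr => i _; rewrite !coordB /h; ring.
rewrite IY => H; have := RintegralD measurableT iX iS; rewrite IX J => e.
by move: H; rewrite [leLHS]e; lra.
Qed.

End energy_inequality.

(** Moves a map between representations of the same law: the Euler step is defined on the space of
    the particles, but has to be performed on that of a coupling. *)
Lemma is_law_transport {R : realType} {d1 d2 d3 d4} {T1 : measurableType d1} {T2 : measurableType d2}
    {T3 : measurableType d3} {T4 : measurableType d4} (P : probability T1 R) (Q : probability T2 R)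
    (X : T1 -> T3) (Z : T2 -> T3) (F : T3 -> T4) mu nu : measurable_fun setT F ->
  is_law P X mu -> is_law Q Z mu -> is_law P (fun t => F (X t)) nu -> is_law Q (fun t => F (Z t)) nu.
Proof.
move=> mF [mX hX] [mZ hZ] [_ hFX]; split; first exact: measurableT_comp mF mZ.
move=> A mA; rewrite -hFX//.
have mFA := measurable_preimage mF mA.
by rewrite -[LHS]/(Q (Z @^-1` (F @^-1` A))) -[RHS]/(P (X @^-1` (F @^-1` A))) hZ// hX.
Qed.

Section euler_step.
Context {R : realType} {d : nat} (s : R) (W : 'rV[R]_d -> R).
Hypothesis hs : 0 < s.
Hypothesis hWeven : forall x, W (- x) = W x.
Hypothesis hWconvex : convex_function setT W.
Hypothesis hWreg : C1_holder_loc s W.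
Local Notation Rd := (borelRd R d).

Lemma measurable_conv_grad_comp r v {d1} {T1 : measurableType d1} (Z : T1 -> 'rV[R]_d) : supp_in r v -> measurableRd Z ->
  measurableRd (fun t => conv_grad W v (Z t)).
Proof.
move=> hv mZ; apply: measurable_coordP => i.
apply: (@measurableT_comp _ _ _ _ _ _ ((fun x => conv_grad W v x 0 i) : Rd -> R) _ Z) => //.
have h := conv_grad_continuous hs hWreg hv (i := i); exact: (continuous_measurableRd h).
Qed.

Lemma measurable_euler_map r v h {d1} {T1 : measurableType d1} (Z : T1 -> 'rV[R]_d) : supp_in r v -> measurableRd Z ->
  measurableRd (fun t => Z t - h *: conv_grad W v (Z t)).
Proof.
move=> hv mZ; apply: measurable_subRd => //; apply: measurable_scaleRd.
exact: (measurable_conv_grad_comp hv mZ).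
Qed.

(** On a nearly optimal coupling of [v] and [nu], move the first point by the Euler step and expand
    the square: the cross term is the energy inequality, the last one is at most h^2 B^2. *)
Lemma euler_step_w2 {d0} {T : measurableType d0} (P : probability T R) (X : T -> 'rV[R]_d)
    v v' nu (r B h ev en : R) :
  is_law P (X : T -> Rd) v -> (forall t, enorm (X t) <= r) ->
  (forall t, enorm (conv_grad W v (X t)) <= B) ->
  is_law P (fun t => X t - h *: conv_grad W v (X t) : Rd) v' -> finite_moment 2 nu ->
  0 <= r -> 0 <= h -> energy W v = ev%:E -> energy W nu = en%:E ->
  w2 v' nu ^+ 2 <= w2 v nu ^+ 2 + 2 * h * (en - ev) + h ^+ 2 * B ^+ 2.
Proof.
move=> hX Xr hB hX' fnu r0 h0 Ev En.
have sv := supp_in_bounded hX Xr; have fv := supp_in_finite_moment sv.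
apply/ler_addgt0Pr => e e0.
have [g [g1 g2 gc]] : exists gamma : probability (Rd * Rd)%type R, [/\ is_law gamma fst v, is_law gamma snd nu &
    (\int[gamma]_z (enorm ((z.1 : 'rV_d) - z.2) ^+ 2)%:E < (w2 v nu ^+ 2 + e)%:E)%E].
  by apply: W2e_near; rewrite -w2_sqrE// lte_fin ltrDl.
pose Z (w : Rd * Rd) := clip r w.1; pose Y (w : Rd * Rd) : 'rV[R]_d := w.2.
have lZ : is_law g (Z : _ -> Rd) v by exact: is_law_clip.
have [mZ _] := lZ; have [mY _] := g2.
have Zr w : enorm (Z w) <= r by exact: clip_le.
pose b x := conv_grad W v x.
have mb : measurableRd (fun x : Rd => b x) by exact: (measurable_conv_grad_comp sv (@measurable_id _ Rd setT)).
have mbZ : measurableRd (fun w => b (Z w)) by exact: measurable_conv_grad_comp sv mZ.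
have lZ' : is_law g (fun w => Z w - h *: b (Z w) : Rd) v'.
  exact: (is_law_transport (F := fun x : Rd => (x : 'rV_d) - h *: conv_grad W v x : Rd)
    (measurable_euler_map h sv (@measurable_id _ Rd setT)) hX lZ hX').
have Dint : g.-integrable setT (EFin \o (fun w => enorm (Z w - Y w) ^+ 2)) /\
    \int[g]_w enorm (Z w - Y w) ^+ 2 <= w2 v nu ^+ 2 + e.
  have le : (\int[g]_w (enorm (Z w - Y w) ^+ 2)%:E <= (w2 v nu ^+ 2 + e)%:E)%E.
    apply: le_trans (ltW gc).
    apply: (@ge0_ae_le_integral _ _ _ _ _ _ [set w : Rd * Rd | ~ (enorm (w.1 : 'rV[R]_d) <= r)]) => //.
    - exact: measurable_enorm_sqr_sub.
    - by apply: measurable_enorm_sqr_sub; [exact: measurable_fst|exact: measurable_snd].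
    - by move=> w; exact: sqr_ge0.
    - by move=> w; exact: sqr_ge0.
    - by apply: measurable_enorm_gt; exact: measurable_fst.
    - exact: ((supp_in_law r g1).1 sv).
    - by move=> w /contrapT hw; rewrite /Z /clip hw.
  have iD : g.-integrable setT (EFin \o (fun w => enorm (Z w - Y w) ^+ 2)).
    apply/integrableP; split; first by apply/measurable_EFinP; exact: measurable_enorm_sqr_sub.
    by under eq_integral do rewrite /= ger0_norm ?sqr_ge0//; apply: le_lt_trans le (ltry _).
  by split => //; exact: Rintegral_le.
have [iD ID] := Dint.
have [M M0 hM] := gradW_bounded hs hWreg (r + r).
have bi w i : `|b (Z w) 0 i| <= M.
  apply: (conv_grad_bound hWreg i hX hM) => t.
  by apply: le_trans (enormD _ _) _; rewrite enormN; exact: lerD.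
have iI : g.-integrable setT (EFin \o (fun w => dotp (b (Z w)) (Y w - Z w))).
  rewrite (_ : EFin \o _ = (fun w => \sum_(i < d) (EFin \o (fun w => (b (Z w) 0 i * (Y w - Z w) 0 i)%R)) w)%E).
    apply: integrable_sum => // i _.
    have iZ : g.-integrable setT (EFin \o (fun t => (Y t - Z t) 0 i)) := displacement_integrable lZ g2 Zr fnu i.
    apply: (@integrable_dominated _ _ _ _ _ (fun t => M * `|(Y t - Z t) 0 i|)).
    - apply: measurable_funM; first exact: (measurable_coord_comp i mbZ).
      by have := measurable_int _ iZ => /measurable_EFinP.
    - by move=> t; rewrite normrM ler_wpM2r.
    - by apply: integrableZl_EFin; exact: (integrable_norm iZ).
  by apply/funext => z; rewrite /= sumEFin.
have mbb : measurable_fun setT (fun x : Rd => enorm (b x) ^+ 2) := measurable_enorm_sqr mb.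
have iB : g.-integrable setT (EFin \o (fun w => enorm (b (Z w)) ^+ 2)).
  apply: (@bounded_integrable _ _ _ _ _ ((d%:R * M) ^+ 2)); first exact: (measurable_enorm_sqr mbZ).
  move=> w; rewrite ger0_norm ?sqr_ge0// ler_pXn2r ?nnegrE ?enorm_ge0 ?mulr_ge0//.
  exact: enorm_le_bound.
have IB : \int[g]_w enorm (b (Z w)) ^+ 2 <= B ^+ 2.
  rewrite -(is_law_Rintegral lZ (f := fun x : Rd => enorm (b x) ^+ 2))// (is_law_Rintegral hX)//.
  apply: le_trans (ler_norm _) _; apply: Rintegral_le_bound; first exact: measurableT_comp mbb hX.1.
  move=> t; rewrite ger0_norm ?sqr_ge0// ler_pXn2r ?nnegrE ?enorm_ge0//.
  exact: le_trans (enorm_ge0 _) (hB t).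
have EI := energy_inequality hs hWeven hWconvex hWreg lZ g2 Zr fnu Ev En.
apply: (@le_trans _ _ (\int[g]_w (enorm (Z w - Y w) ^+ 2 + (2 * h * dotp (b (Z w)) (Y w - Z w) + h ^+ 2 * enorm (b (Z w)) ^+ 2)))).
  apply: w2_sqr_le; apply: le_trans (W2e_le lZ' g2) _.
  have i2 := integrableD_EFin iD (integrableD_EFin (integrableZl_EFin (2 * h) iI) (integrableZl_EFin (h ^+ 2) iB)).
  rewrite le_eqVlt; apply/orP; left; apply/eqP.
  rewrite /Rintegral fineK; last exact: (integrable_fin_num _ i2).
  apply: eq_integral => w _; congr (_%:E).
  rewrite !enorm_sqr !dotpE -/(Y w) (dotpC (Y w) (Z w)) (dotpC (Z w) (b _)) (dotpC (Y w) (b _)); ring.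
rewrite RintegralD//; last by apply: integrableD_EFin; exact: integrableZl_EFin.
rewrite RintegralD//; [|exact: integrableZl_EFin|exact: integrableZl_EFin].
rewrite !RintegralZl//.
have h2 : 0 <= 2 * h by rewrite mulr_ge0.
have EI' : \int[g]_w dotp (b (Z w)) (Y w - Z w) <= en - ev by rewrite lerBrDl.
move: (ler_wpM2l h2 EI') (ler_wpM2l (sqr_ge0 h) IB) ID; clear; lra.
Qed.

Lemma energy_fin_bounded {d0} {T : measurableType d0} (P : probability T R) (X : T -> 'rV[R]_d) v r :
  is_law P (X : T -> Rd) v -> (forall t, enorm (X t) <= r) -> exists e, energy W v = e%:E.
Proof.
move=> hX Xr; have [mX _] := hX.
rewrite (energyE hWeven hWconvex hWreg hX).
suff : (\int[(P \x P)%E]_z (W (X z.1 - X z.2) - W 0)%:E)%E \is a fin_num.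
  by move=> /fineK <-; rewrite -EFinM -EFinD; eexists.
apply: integrable_fin_num => //.
have [M M0 hM] := gradW_bounded hs hWreg (r + r).
apply: (@bounded_integrable _ _ _ _ _ (d%:R * M * (r + r))).
  apply: measurable_funB => //.
  apply: (@measurableT_comp _ _ _ _ _ _ (W : Rd -> R) _ (fun z : T * T => X z.1 - X z.2 : Rd)).
    by apply: continuous_measurableRd; exact: W_continuous hWreg.
  by apply: measurable_subRd; [exact: measurableT_comp mX measurable_fst|exact: measurableT_comp mX measurable_snd].
move=> z; rewrite [X in X - _]/=; set x := X z.1 - X z.2.
have xr : enorm x <= r + r by apply: le_trans (enormD _ _) _; rewrite enormN; exact: lerD.
have := W_min hWeven hWconvex x; have := W_tangent hWconvex hWreg x 0.
rewrite sub0r dotpNr => h1 h2; rewrite ger0_norm ?subr_ge0//.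
apply: (@le_trans _ _ (dotp (grad W x) x)); first by lra.
apply: le_trans (dotp_le _ _) _; apply: ler_pM; rewrite ?enorm_ge0//.
by apply: enorm_le_bound => // i; exact: hM.
Qed.

End euler_step.

Section law_of.
Context {R : realType} {d : nat} (P : probability (borelRd R d) R).
Local Notation Rd := (borelRd R d).

(* Junk value [P] when [X] is not measurable. *)
Definition law_of (X : Rd -> Rd) : probability Rd R :=
  if pselect (exists Q, is_law P X Q) is left h then projT1 (cid h) else P.

Lemma is_law_of (X : Rd -> Rd) : measurable_fun setT X -> is_law P X (law_of X).
Proof.
move=> mX; rewrite /law_of; case: pselect => [h|[]]; first exact: (projT2 (cid h)).
exact: law_exists.
Qed.

End law_of.

Lemma euler_pair_sqr {R : realType} {d : nat} (x y a b : 'rV[R]_d) (h : R) :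
  enorm (x - h *: a - (y - h *: b)) ^+ 2 =
  enorm (x - y) ^+ 2 - 2 * h * dotp (a - b) (x - y) + h ^+ 2 * enorm (a - b) ^+ 2.
Proof.
have -> : x - h *: a - (y - h *: b) = (x - y) - h *: (a - b) by apply/rowP => j; rewrite !mxE; ring.
move: (x - y) (a - b) => {y b} {}x {}a.
by rewrite !enorm_sqr !dotpE (dotpC x a); ring.
Qed.

Section euler_scheme.
Context {R : realType} {d : nat} (s : R) (W : 'rV[R]_d -> R).
Hypothesis hs : 0 < s.
Hypothesis hWeven : forall x, W (- x) = W x.
Hypothesis hWconvex : convex_function setT W.
Hypothesis hWreg : C1_holder_loc s W.
Local Notation Rd := (borelRd R d).
Variables (mu0 : probability Rd R) (r0 : R).

(** A particle is a function of its starting point, so that all steps live on the space of [mu0];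
    the velocity at each step is generated by the law of all particles at that step. *)
Fixpoint euler (h : R) (k : nat) : 'rV[R]_d -> 'rV[R]_d :=
  if k is k'.+1 then
    fun x => euler h k' x - h *: conv_grad W (law_of mu0 (euler h k' : Rd -> Rd)) (euler h k' x)
  else clip r0.

Definition euler_law h k := law_of mu0 (euler h k : Rd -> Rd).

Variables (M T h : R).
Hypothesis r00 : 0 <= r0.
Hypothesis M0 : 0 <= M.
Hypothesis hM : forall x i, enorm x <= 2 * r0 + 1 -> `|grad W x 0 i| <= M.
Let B := d%:R * M.
Hypothesis T0 : 0 <= T.
Hypothesis h0 : 0 <= h.
Hypothesis hsmall : 4 * B ^+ 2 * h * T <= 1.

Let B0 : 0 <= B. Proof. by rewrite mulr_ge0. Qed.

(** The velocity is at most [B] as long as any two particles are within 2 r0 + 1. By monotonicity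
    the square of their distance grows by at most (2 B h)^2 per step, hence by 4 B^2 h T <= 1 in
    all, and (2 r0)^2 + 1 <= (2 r0 + 1)^2 closes the induction. *)
Lemma euler_bounds k : k%:R * h <= T ->
  [/\ is_law mu0 (euler h k : Rd -> Rd) (euler_law h k),
    (forall x, enorm (euler h k x) <= r0 + k%:R * h * B),
    (forall x y, enorm (euler h k x - euler h k y) ^+ 2 <= (2 * r0) ^+ 2 + 4 * B ^+ 2 * h * (k%:R * h)) &
    (forall x, enorm (conv_grad W (euler_law h k) (euler h k x)) <= B)].
Proof.
elim: k => [|k IH] kT.
  have lX : is_law mu0 (euler h 0 : Rd -> Rd) (euler_law h 0) by apply: is_law_of; exact: measurable_clip.
  have close (x y : 'rV[R]_d) : enorm (euler h 0 x - euler h 0 y) <= 2 * r0.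
    apply: le_trans (enormD _ _) _; rewrite enormN.
    by have := clip_le x r00; have := clip_le y r00 => /=; lra.
  split => //.
  - by move=> x; rewrite mul0r mul0r addr0; exact: clip_le.
  - move=> x y; rewrite mul0r mulr0 addr0 ler_pXn2r ?nnegrE ?enorm_ge0//.
    by rewrite mulr_ge0.
  - move=> x; apply: enorm_le_bound => // i; apply: (conv_grad_bound hWreg i lX hM).
    by move=> y; apply: le_trans (close _ _) _; rewrite lerDl.
have kT' : k%:R * h <= T by apply: le_trans kT; apply: ler_wpM2r => //; rewrite ler_nat.
have [lX b1 b2 b3] := IH kT'; have [mX _] := lX.
have sX := supp_in_bounded lX b1.
have lX' : is_law mu0 (euler h k.+1 : Rd -> Rd) (euler_law h k.+1).
  apply: is_law_of; exact: (measurable_euler_map hs hWreg h sX mX).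
have c1 (x : 'rV[R]_d) : enorm (euler h k.+1 x) <= r0 + k.+1%:R * h * B.
  rewrite /= -/(euler_law h k); apply: le_trans (enormD _ _) _; rewrite enormN enormZ ger0_norm//.
  have := ler_wpM2l h0 (b3 x); have := b1 x; rewrite -natr1; lra.
have c2 (x y : 'rV[R]_d) : enorm (euler h k.+1 x - euler h k.+1 y) ^+ 2 <=
    (2 * r0) ^+ 2 + 4 * B ^+ 2 * h * (k.+1%:R * h).
  rewrite /= -/(euler_law h k).
  set bx := conv_grad W _ (euler h k x); set by' := conv_grad W _ (euler h k y).
  have mono : 0 <= dotp (bx - by') (euler h k x - euler h k y).
    exact: (conv_grad_monoX hs hWconvex hWreg _ _ lX b1).
  rewrite euler_pair_sqr.
  have le : enorm (bx - by') ^+ 2 <= (2 * B) ^+ 2.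
    rewrite ler_pXn2r ?nnegrE ?enorm_ge0 ?mulr_ge0//.
    by apply: le_trans (enormD _ _) _; rewrite enormN mulr_natl; exact: lerD (b3 x) (b3 y).
  have := ler_wpM2l (sqr_ge0 h) le; have := b2 x y; have := mulr_ge0 h0 mono.
  move: (enorm (euler h k x - _)) (enorm (bx - _)) (dotp _ _) => p q o.
  rewrite -natr1; lra.
split; [exact: lX'|exact: c1|exact: c2|].
move=> x; apply: enorm_le_bound => // i; apply: (conv_grad_bound hWreg i lX' hM).
move=> y; rewrite -(@ler_pXn2r _ 2)// ?nnegrE ?enorm_ge0 ?addr_ge0 ?mulr_ge0//.
apply: le_trans (c2 x y) _.
have c40 : 0 <= 4 * B ^+ 2 * h by rewrite !mulr_ge0// sqr_ge0.
have := ler_wpM2l c40 kT; have := hsmall; have := r00; rewrite sqrrD; nra.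
Qed.

Lemma euler_le_radius k x : k%:R * h <= T -> enorm (euler h k x) <= r0 + T * B.
Proof.
move=> kT; have [_ b _ _] := euler_bounds kT; apply: le_trans (b x) _.
by rewrite lerD2l ler_wpM2r.
Qed.

(** The curve from t0 to t, tested against the Euler law, contributes 2 (e - f t) (t - t0); the
    Euler step, tested against [u t], contributes 2 h (f t - e). For t near t1 = t0 + h they cancel
    up to 2 (f t - e) (t1 - t). The time t1 itself may be exceptional, so t increases to t1 and
    continuity concludes. *)
Lemma euler_w2 (u : R -> Pp R d 2) :
  continuous_curve (@wasserstein R d 2) T u ->
  maximal_slope_curve (@wasserstein R d 2) (interaction_energy W) 0 T u ->
  sval (u 0) = mu0 -> supp_in r0 mu0 -> 0 < h -> forall k, k%:R * h <= T ->
  w2 (sval (u (k%:R * h))) (euler_law h k) ^+ 2 <= k%:R * h * (h * B ^+ 2).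
Proof.
move=> hu slope u0 smu0 hpos.
have [f [N [N0 fmono fE evi]]] := maximal_slope_evi hWeven hWconvex hWreg hu slope.
elim=> [|k IH] kT.
  have [lX _ _ _] := euler_bounds kT.
  rewrite !mul0r u0; apply: w2_sqr_le.
  have := W2e_le (is_law_clip (is_law_id mu0) smu0) lX.
  by under eq_integral do rewrite subrr enorm0 expr2 mul0r; rewrite integral0.
have kT' : k%:R * h <= T by apply: le_trans kT; apply: ler_wpM2r => //; rewrite ler_nat.
have [lX b1 _ b3] := euler_bounds kT'; have [lX' b1' _ _] := euler_bounds kT.
have fX := supp_in_finite_moment (supp_in_bounded lX b1).
have fX' := supp_in_finite_moment (supp_in_bounded lX' b1').
have [e eE] := energy_fin_bounded hs hWeven hWconvex hWreg lX b1.
set t0 := k%:R * h in IH kT' *; set t1 := k.+1%:R * h in kT *.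
have t01 : t1 = t0 + h by rewrite /t1 -natr1 mulrDl mul1r.
have t00 : 0 <= t0 by rewrite mulr_ge0.
have h20 : 0 < h / 2 by rewrite divr_gt0.
(* A fixed positive time before t: the bound f t <= f p0 does not depend on t, even in the first
   step, where t0 = 0 and [f] is controlled on ]0, T[ only. *)
pose p0 := t0 + h / 2.
have p00 : 0 < p0 by rewrite ltr_wpDl.
have hrad : 0 <= r0 + k%:R * h * B by rewrite addr_ge0// mulr_ge0.
have step t : p0 <= t < t1 -> ~ N t ->
   w2 (sval (u t)) (euler_law h k.+1) ^+ 2 <=
   w2 (sval (u t0)) (euler_law h k) ^+ 2 + 2 * (`|f p0 - e| * (t1 - t)) + h ^+ 2 * B ^+ 2.
  move=> /andP[p0t tt1] Nt.
  have tT : t < T by exact: lt_le_trans tt1 kT.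
  have t0t : t0 <= t by apply: le_trans p0t; rewrite lerDl ltW.
  have tpos : 0 < t by exact: lt_le_trans p00 p0t.
  have := evi (exist _ _ fX) e eE t0 t; rewrite t00 t0t tpos tT /= => /(_ isT isT Nt) evi_t.
  have tE : energy W (sval (u t)) = (f t)%:E by apply: fE; rewrite ?tpos.
  have := euler_step_w2 hs hWeven hWconvex hWreg lX b1 b3 lX' (svalP (u t)) hrad h0 eE tE.
  rewrite (w2_sym (euler_law h k.+1)) (w2_sym (euler_law h k)) => step_t.
  have fle : (f t - e) * (t1 - t) <= `|f p0 - e| * (t1 - t).
    apply: ler_wpM2r; first by rewrite subr_ge0 ltW.
    by apply: le_trans (ler_norm _); rewrite lerD2r; exact: fmono.
  by move: evi_t step_t fle; rewrite t01; nra.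
apply/ler_addgt0Pr => eps eps0.
have eps20 : 0 < eps / 2 by rewrite divr_gt0.
have t1T : 0 <= t1 <= T by rewrite kT mulr_ge0.
have [c c0 hc] := w2_sqr_continuous (exist _ _ fX') hu t1T eps20.
pose a := `|f p0 - e|.
have a0 : 0 < 2 * a + 1 by rewrite ltr_wpDl// mulr_ge0// normr_ge0.
(* In turn: t stays right of [p0], the distance at t is within eps / 2 of that at t1, and the
   uncancelled energy term is below eps / 2. *)
pose dl := Order.min (h / 2) (Order.min c (eps / 2 / (2 * a + 1))).
have dl0 : 0 < dl by rewrite !lt_min h20 c0 divr_gt0.
have [t /andP[t1t tt1] Nt] : exists2 t, t1 - dl < t < t1 & ~ N t.
  by apply: negligible_dense => //; rewrite ltrBlDr ltrDl.
move: (t1t); rewrite ltrBlDr -ltrBlDl !lt_min => /and3P[d1 d2 d3].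
have p0t : p0 <= t < t1 by rewrite tt1 andbT; move: d1; rewrite /p0 t01; lra.
have tT : 0 <= t <= T.
  case/andP: p0t => h1 _; rewrite (ltW (lt_le_trans p00 h1)) /=; case/andP: t1T => _ h2; exact: ltW (lt_le_trans tt1 h2).
have := hc t tT; rewrite distrC gtr0_norm ?subr_gt0// => /(_ d2); rewrite ler_norml => /andP[h1 _].
move: h1 => /= h1.
have := step t p0t Nt; rewrite -/a; have := IH kT'.
move: d3; rewrite ltr_pdivlMr// -/a => d3.
have -> : t1 * (h * B ^+ 2) = t0 * (h * B ^+ 2) + h ^+ 2 * B ^+ 2 by rewrite t01; ring.
by move: tt1; rewrite -subr_gt0 => tt1; lra.
Qed.

End euler_scheme.

(** * The flow of a monotone field *)

Section right_derivative.
Context {R : realType} {d : nat}.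
Implicit Types (f g : R -> 'rV[R]_d) (p q : 'rV[R]_d).

(** One-sided, as Euler polygons have corners at the nodes; [c] is the end of the interval on which
    the curve is considered. *)
Definition right_deriv f c t p := forall e, 0 < e -> exists2 r, 0 < r &
  forall s, t < s < t + r -> s <= c -> enorm (f s - f t - (s - t) *: p) <= e * (s - t).

Definition lipschitz_on (a c L : R) f := forall s t, a <= s <= c -> a <= t <= c ->
  enorm (f s - f t) <= L * `|s - t|.

Lemma lipschitz_cont_on a c L (G : R -> R) :
  (forall s t, a <= s <= c -> a <= t <= c -> `|G s - G t| <= L * `|s - t|) -> cont_on a c G.
Proof.
move=> h t tac e e0; exists (e / (`|L| + 1)); first by rewrite divr_gt0// ltr_wpDl.
move=> q qac; rewrite ltr_pdivlMr ?ltr_wpDl// => /ltW qt; apply: le_trans (h _ _ qac tac) _.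
apply: le_trans qt; rewrite mulrC; apply: ler_wpM2l => //.
by apply: le_trans (ler_norm _) _; rewrite lerDl.
Qed.

Lemma right_derivB f g c t p q : right_deriv f c t p -> right_deriv g c t q ->
  right_deriv (fun s => f s - g s) c t (p - q).
Proof.
move=> hf hg e e0; have e2 : 0 < e / 2 by rewrite divr_gt0.
have [r1 r10 h1] := hf _ e2; have [r2 r20 h2] := hg _ e2.
exists (Order.min r1 r2); first by rewrite lt_min r10.
move=> s /andP[ts]; rewrite -ltrBlDl lt_min => /andP[s1 s2] sc.
have -> : f s - g s - (f t - g t) - (s - t) *: (p - q) =
  (f s - f t - (s - t) *: p) - (g s - g t - (s - t) *: q) by apply/rowP => j; rewrite !mxE; ring.
apply: le_trans (enormD _ _) _; rewrite enormN.
rewrite (splitr e) mulrDl; apply: lerD; [apply: h1|apply: h2] => //; by rewrite ts -ltrBlDl.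
Qed.

Lemma right_deriv_dotp f c t p w : right_deriv f c t p ->
  right_slope_le (fun s => dotp (f s) w) c t (dotp p w).
Proof.
move=> hf e e0; have w1 : 0 < enorm w + 1 by rewrite ltr_wpDl// enorm_ge0.
have [|r r0 h] := hf (e / (enorm w + 1)); first by rewrite divr_gt0.
exists r => // s tsr sc; have := h s tsr sc; have /andP[/ltW ts _] := tsr.
set D := _ - _ - _ => hD.
have -> : dotp (f s) w - dotp (f t) w = dotp D w + (s - t) * dotp p w by rewrite /D !dotpE; ring.
have hw : dotp D w <= e * (s - t).
  apply: le_trans (dotp_le _ _) _; apply: (@le_trans _ _ (enorm D * (enorm w + 1))).
    by rewrite ler_wpM2l ?enorm_ge0// lerDl.
  by rewrite -ler_pdivlMr//; apply: le_trans hD _; rewrite mulrAC.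
lra.
Qed.

Lemma right_deriv_sqr f c t p : right_deriv f c t p ->
  right_slope_le (fun s => enorm (f s) ^+ 2) c t (2 * dotp p (f t)).
Proof.
move=> hf e e0; pose n := enorm (f t); pose m := enorm p + 1.
have n0 : 0 <= n := enorm_ge0 _; have m0 : 0 <= m by rewrite addr_ge0// enorm_ge0.
have n1 : 0 < 4 * n + 2 by rewrite ltr_wpDl// mulr_ge0.
have m1 : 0 < 2 * m ^+ 2 + 1 by rewrite ltr_wpDl// mulr_ge0// sqr_ge0.
have k0 : 0 < Order.min 1 (e / (4 * n + 2)) by rewrite lt_min ltr01 divr_gt0.
have [r r0 h] := hf _ k0.
exists (Order.min r (e / (2 * m ^+ 2 + 1))); first by rewrite lt_min r0 divr_gt0.
move=> s /andP[ts]; rewrite -ltrBlDl lt_min => /andP[s1 s2] sc.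
have := h s; rewrite ts -ltrBlDl s1 => /(_ isT sc); have ts' : 0 <= s - t by rewrite subr_ge0 ltW.
set D := _ - _ - _; set k := Order.min 1 _ => hD.
have k1 : k <= 1 by rewrite ge_min lexx.
have k2 : k * (4 * n + 2) <= e by rewrite -ler_pdivlMr// ge_min lexx orbT.
have -> : enorm (f s) ^+ 2 - enorm (f t) ^+ 2 =
    2 * (s - t) * dotp p (f t) + 2 * dotp D (f t) + enorm (f s - f t) ^+ 2.
  by rewrite /D !enorm_sqr !dotpE (dotpC (f t) (f s)); ring.
have hDn : dotp D (f t) <= k * (s - t) * n.
  by apply: le_trans (dotp_le _ _) _; rewrite ler_wpM2r.
have hfm : enorm (f s - f t) <= m * (s - t).
  rewrite (_ : f s - f t = D + (s - t) *: p); last by rewrite /D subrK.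
  apply: le_trans (enormD _ _) _; rewrite enormZ ger0_norm//.
  have := ler_wpM2r ts' k1; rewrite /m; lra.
have hfm2 : enorm (f s - f t) ^+ 2 <= m ^+ 2 * (s - t) ^+ 2.
  by rewrite -exprMn ler_pXn2r ?nnegrE ?enorm_ge0 ?mulr_ge0.
move: s2; rewrite ltr_pdivlMr// => /ltW s2.
have := ler_wpM2r ts' s2; have := ler_wpM2r ts' k2; have := sqr_ge0 (s - t).
have k00 : 0 <= k := ltW k0.
have := mulr_ge0 k00 ts'.
move: hDn hfm2; move: (dotp D _) (dotp p _) (enorm (f s - f t)) => a b q.
move: (s - t) => st; lra.
Qed.

End right_derivative.

Section approx_sol.
Context {R : realType} {d : nat} (b : R -> 'rV[R]_d -> 'rV[R]_d) (T : R).
Hypothesis bmono : forall t x y, 0 <= t <= T -> 0 <= dotp (b t x - b t y) (x - y).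

(** Solutions of f' = - b(t, f) with an error [e] on the velocity: Euler polygons for e > 0, exact
    solutions for e = 0, under the same comparison estimates. *)
Definition approx_sol (e a c L : R) (f : R -> 'rV[R]_d) :=
  lipschitz_on a c L f /\
  forall t, a <= t < c -> exists2 p, enorm (p - b t (f t)) <= e & right_deriv f c t (- p).

Lemma approx_sol_bound e a c L f t : 0 <= L -> approx_sol e a c L f -> a <= t <= c ->
  enorm (f t) <= enorm (f a) + L * (c - a).
Proof.
move=> L0 [fL _] /andP[at1 tc].
have -> : f t = f a + (f t - f a) by rewrite addrC subrK.
apply: le_trans (enormD _ _) _; rewrite lerD2l.
apply: le_trans (fL _ _ _ _) _; rewrite ?at1 ?lexx ?(le_trans at1)//.
by rewrite ger0_norm ?subr_ge0//; apply: ler_wpM2l => //; rewrite lerD2r.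
Qed.

(** In the derivative of the squared distance, monotonicity discards the contribution of the field;
    the velocity errors remain, against a distance at most [D]. The bound is linear in time, with no
    exponential factor. *)
Lemma approx_sol_dist e1 e2 a c L1 L2 f1 f2 D : 0 <= a -> a <= c -> c <= T -> 0 <= D ->
  (forall t, a <= t <= c -> enorm (f1 t - f2 t) <= D) ->
  approx_sol e1 a c L1 f1 -> approx_sol e2 a c L2 f2 ->
  forall t, a <= t <= c ->
  enorm (f1 t - f2 t) ^+ 2 <= enorm (f1 a - f2 a) ^+ 2 + 2 * D * (e1 + e2) * (t - a).
Proof.
move=> a0 ac cT D0 hD [l1 h1] [l2 h2] t /andP[at1 tc].
rewrite -lerBlDl; pose G s := enorm (f1 s - f2 s) ^+ 2.
apply: (@mean_value_le _ G) => //.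
  apply: (@lipschitz_cont_on _ _ _ ((L1 + L2) * (2 * D))) => p q /andP[ap pt] /andP[aq qt].
  have pac : a <= p <= c by rewrite ap (le_trans pt).
  have qac : a <= q <= c by rewrite aq (le_trans qt).
  rewrite /G subr_sqr normrM -mulrA (mulrC (2 * D)) mulrA; apply: ler_pM => //.
    apply: le_trans (enorm_dist _ _) _.
    have -> : f1 p - f2 p - (f1 q - f2 q) = (f1 p - f1 q) - (f2 p - f2 q) by apply/rowP => j; rewrite !mxE; ring.
    apply: le_trans (enormD _ _) _; rewrite enormN mulrDl; apply: lerD; [exact: l1|exact: l2].
  rewrite ger0_norm ?addr_ge0 ?enorm_ge0// mulr_natl; exact: lerD (hD _ pac) (hD _ qac).
move=> p /andP[ap pt]; have pc : p < c by exact: lt_le_trans pt tc.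
have pac : a <= p <= c by rewrite ap ltW.
have pac' : a <= p < c by rewrite ap.
have [p1 e1p d1] := h1 p pac'; have [p2 e2p d2] := h2 p pac'.
have {}d1 := right_deriv_sqr (right_derivB d1 d2).
have sl : right_slope_le G t p (2 * dotp (- p1 - - p2) (f1 p - f2 p)).
  by move=> e e0; have [r r0 h] := d1 e e0; exists r => // q qp qt; apply: h => //; exact: le_trans tc.
apply: right_slope_le_mono sl.
have := bmono (f1 p) (f2 p) (t := p); rewrite (le_trans a0 ap) (le_trans (ltW pc) cT) => /(_ isT) mono.
have -> : dotp (- p1 - - p2) (f1 p - f2 p) =
    - dotp (b p (f1 p) - b p (f2 p)) (f1 p - f2 p)
    + dotp ((p2 - b p (f2 p)) - (p1 - b p (f1 p))) (f1 p - f2 p).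
  by rewrite !dotpE; ring.
have le : dotp ((p2 - b p (f2 p)) - (p1 - b p (f1 p))) (f1 p - f2 p) <= (e1 + e2) * D.
  apply: le_trans (dotp_le _ _) _; apply: ler_pM; rewrite ?enorm_ge0//; last exact: hD.
  by apply: le_trans (enormD _ _) _; rewrite enormN addrC; exact: lerD.
lra.
Qed.

Lemma approx_sol_restrict e a c L f a' c' : a <= a' -> c' <= c -> approx_sol e a c L f ->
  approx_sol e a' c' L f.
Proof.
move=> aa cc [l h]; split.
  by move=> s t /andP[s1 s2] /andP[t1 t2]; apply: l; apply/andP; split;
    [exact: le_trans s1|exact: le_trans s2 _|exact: le_trans t1|exact: le_trans t2 _].
move=> t /andP[t1 t2]; have [|p pe hp] := h t; first by rewrite (le_trans aa t1) (lt_le_trans t2).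
exists p => // e0 e00; have [r r0 hr] := hp _ e00; exists r => // s st sc.
by apply: hr => //; exact: le_trans cc.
Qed.

Lemma approx_sol_extend e a c c' L f p : a <= c -> c < c' -> 0 <= L -> enorm p <= L ->
  approx_sol e a c L f ->
  (forall t, c <= t < c' -> enorm (p - b t (f c - (t - c) *: p)) <= e) ->
  exists g, approx_sol e a c' L g /\ (forall t, t <= c -> g t = f t) /\ g c' = f c - (c' - c) *: p.
Proof.
move=> ac cc L0 pL [l h] hp.
pose g t := if t <= c then f t else f c - (t - c) *: p.
have gc t : c <= t -> g t = f c - (t - c) *: p.
  rewrite /g => ct; case: ifP => // tc.
  have -> : t = c by apply/eqP; rewrite eq_le tc.
  by rewrite subrr scale0r subr0.
have gf t : t <= c -> g t = f t by rewrite /g => ->.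
have lc s t : c <= s -> s <= t -> enorm (g t - g s) <= L * (t - s).
  move=> cs st; rewrite !gc ?(le_trans cs)//.
  have -> : f c - (t - c) *: p - (f c - (s - c) *: p) = (s - t) *: p by apply/rowP => j; rewrite !mxE; ring.
  by rewrite enormZ distrC ger0_norm ?subr_ge0// mulrC ler_wpM2r// subr_ge0.
have ll s t : a <= s -> s <= t -> t <= c' -> enorm (g t - g s) <= L * (t - s).
  move=> as1 st tc'; have [tc|ct] := leP t c.
    rewrite !gf ?(le_trans st)//; apply: le_trans (l _ _ _ _) _.
    - by rewrite tc (le_trans as1).
    - by rewrite as1 (le_trans st).
    - by rewrite ger0_norm ?subr_ge0.
  have [cs|sc] := leP c s; first exact: lc.
  have -> : g t - g s = (g t - g c) + (g c - g s) by rewrite addrA subrK.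
  apply: le_trans (enormD _ _) _.
  rewrite (_ : L * (t - s) = L * (t - c) + L * (c - s)); last by ring.
  apply: lerD; first by apply: lc => //; exact: ltW.
  rewrite !gf ?(ltW sc)//; apply: le_trans (l _ _ _ _) _; rewrite ?ac ?lexx ?as1 ?(ltW sc)//.
  by rewrite ger0_norm// subr_ge0 ltW.
exists g; split; last by split => //; rewrite gc// ltW.
split.
  move=> s t /andP[s1 s2] /andP[t1 t2]; have [st|ts] := leP s t.
    by rewrite enormC distrC ger0_norm ?subr_ge0//; exact: ll.
  by rewrite gtr0_norm ?subr_gt0//; apply: ll => //; exact: ltW.
move=> t /andP[at1 tc']; have [tc|ct] := ltP t c.
  have [|q qe hq] := h t; first by rewrite at1.
  exists q; first by rewrite gf// ltW.
  move=> e0 e00; have [r r0 hr] := hq _ e00.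
  exists (Order.min r (c - t)); first by rewrite lt_min r0 subr_gt0.
  move=> s /andP[ts]; rewrite -ltrBlDl lt_min => /andP[s1 s2] sc'.
  have sc : s <= c by rewrite ltW//; move: s2; rewrite ltrD2r.
  by rewrite !gf ?(ltW tc)//; apply: hr => //; rewrite ts -ltrBlDl.
exists p; first by rewrite gc//; apply: hp; rewrite ct.
move=> e0 e00; exists 1 => // s /andP[ts _] sc'.
rewrite !gc ?(le_trans ct (ltW ts))//.
rewrite (_ : _ - _ = 0) ?enorm0; first by rewrite mulr_ge0// ?ltW// subr_gt0.
by apply/rowP => j; rewrite !mxE; ring.
Qed.

(** The velocities [p k] are arbitrary, provided they stay close to the field over a whole step.
    This covers the Euler scheme of the field and also the mean-field scheme, whose velocities come
    from its own laws. *)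
Lemma scheme_approx_sol e a h L (x p : nat -> 'rV[R]_d) n : 0 < h -> 0 <= L ->
  (forall k, (k < n)%N -> x k.+1 = x k - h *: p k) ->
  (forall k, (k < n)%N -> enorm (p k) <= L) ->
  (forall k t y, (k < n)%N -> a + k%:R * h <= t < a + k.+1%:R * h ->
     enorm (y - x k) <= h * L -> enorm (p k - b t y) <= e) ->
  exists2 f, approx_sol e a (a + n%:R * h) L f &
    forall k, (k <= n)%N -> f (a + k%:R * h) = x k.
Proof.
move=> h0 L0; elim: n => [|n IH] hx hL hp.
  exists (fun=> x 0%N); last by move=> k; rewrite leqn0 => /eqP ->.
  rewrite mul0r addr0; split; first by move=> s t _ _; rewrite subrr enorm0 mulr_ge0.
  by move=> t /andP[t1 t2]; have := le_lt_trans t1 t2; rewrite ltxx.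
have [|k kn|k t y kn|f hf fx] := IH; first by move=> k kn; apply: hx; exact: ltnW.
- by apply: hL; exact: ltnW.
- by apply: hp; exact: ltnW.
have an : a <= a + n%:R * h by rewrite lerDl mulr_ge0// ltW.
have nn : a + n%:R * h < a + n.+1%:R * h by rewrite ltrD2l ltr_pM2r// ltr_nat.
have hh : a + n.+1%:R * h - (a + n%:R * h) = h by rewrite -natr1; ring.
have [t /andP[t1 t2]|g [hg [gf gn]]] := approx_sol_extend an nn L0 (hL n (ltnSn n)) hf.
  apply: hp => //; first by rewrite t1.
  rewrite fx// addrAC subrr add0r enormN enormZ ger0_norm ?subr_ge0//.
  by apply: ler_pM; rewrite ?subr_ge0 ?enorm_ge0 ?hL// -{2}hh lerD2r ltW.
exists g => // k; rewrite leq_eqVlt => /orP[/eqP ->|].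
  by rewrite gn hh hx// fx.
rewrite ltnS => kn; rewrite gf ?fx// lerD2l ler_wpM2r ?ler_nat// ltW//.
Qed.

End approx_sol.

Lemma cauchy_sequence_limit {R : realType} {d : nat} (u : nat -> 'rV[R]_d) :
  (forall e, 0 < e -> exists N, forall n m, (N <= n)%N -> (N <= m)%N -> enorm (u n - u m) <= e) ->
  exists l, forall e, 0 < e -> exists N, forall n, (N <= n)%N -> enorm (u n - l) <= e.
Proof.
move=> hu; have cu : cvg (u @ \oo).
  apply/cauchy_cvgP/cauchy_exP => e e0; have e2 : 0 < e / 2 by rewrite divr_gt0.
  have [N hN] := hu _ e2; exists (u N); exists N => // n /= Nn.
  rewrite -ball_normE/=; apply: le_lt_trans (mx_norm_le_enorm _) _.
  by apply: le_lt_trans (hN _ _ (leqnn N) Nn) _; rewrite ltr_pdivrMr// ltr_pMr// ltr1n.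
exists (lim (u @ \oo)) => e e0.
have : nbhs (lim (u @ \oo)) [set y | enorm (y - lim (u @ \oo)) <= e].
  by apply/nbhs_enormP; exists e => // y; rewrite enormC => /ltW.
by move=> /cu [N _ hN]; exists N => n Nn; exact: hN.
Qed.

Section flow.
Context {R : realType} {d : nat} (b : R -> 'rV[R]_d -> 'rV[R]_d) (T : R).
Hypothesis bmono : forall t x y, 0 <= t <= T -> 0 <= dotp (b t x - b t y) (x - y).
Hypothesis bbound : forall rho, exists2 M, 0 <= M & forall t x, 0 <= t <= T -> enorm x <= rho ->
  enorm (b t x) <= M.
Hypothesis bunif : forall rho e, 0 < e -> exists2 c, 0 < c & forall t t' x y, 0 <= t <= T -> 0 <= t' <= T ->
  enorm x <= rho -> enorm y <= rho -> `|t - t'| <= c -> enorm (x - y) <= c -> enorm (b t x - b t' y) <= e.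

(** The comparison estimate makes the sequence uniformly Cauchy. Derivatives do not pass to the
    limit, increments do: over [t, q] each f_n moves by - (q - t) b(t, g t) up to a small multiple
    of q - t. *)
Lemma approx_sol_limit a c L x (f : nat -> R -> 'rV[R]_d) : 0 <= a -> a <= c -> c <= T -> 0 <= L ->
  (forall n, approx_sol b n.+1%:R^-1 a c L (f n)) -> (forall n, f n a = x) ->
  exists2 g, approx_sol b 0 a c L g & g a = x.
Proof.
move=> a0 ac cT L0 hf fx.
pose D := enorm x + L * (c - a).
have D0 : 0 <= D by rewrite addr_ge0 ?enorm_ge0// mulr_ge0// subr_ge0.
have fD n t : a <= t <= c -> enorm (f n t) <= D.
  by move=> tac; have := approx_sol_bound L0 (hf n) tac; rewrite fx.
have dist n m t : a <= t <= c -> enorm (f n t - f m t) ^+ 2 <= 4 * D * (c - a) * (n.+1%:R^-1 + m.+1%:R^-1).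
  move=> tac; have DD (q : R) : a <= q <= c -> enorm (f n q - f m q) <= 2 * D.
    move=> qac; apply: le_trans (enormD _ _) _; rewrite enormN mulr_natl.
    exact: lerD (fD _ _ qac) (fD _ _ qac).
  have D20 : 0 <= 2 * D by rewrite mulr_ge0.
  have := approx_sol_dist bmono a0 ac cT D20 DD (hf n) (hf m) tac.
  rewrite !fx subrr enorm0 expr0n/= add0r => h; apply: le_trans h _.
  have /andP[_ tc] := tac; rewrite (_ : 4 * D * (c - a) * _ = 2 * (2 * D) * (n.+1%:R^-1 + m.+1%:R^-1) * (c - a)); last by ring.
  by apply: ler_wpM2l; [rewrite !mulr_ge0// addr_ge0|rewrite lerD2r].
have cau e : 0 < e -> exists N, forall n m t, (N <= n)%N -> (N <= m)%N -> a <= t <= c -> enorm (f n t - f m t) <= e.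
  move=> e0; pose C := 4 * D * (c - a); have C0 : 0 <= C by rewrite !mulr_ge0// subr_ge0.
  exists (Num.bound (2 * C / e ^+ 2)) => n m t Nn Nm tac.
  have inv k : (Num.bound (2 * C / e ^+ 2) <= k)%N -> C * k.+1%:R^-1 <= e ^+ 2 / 2.
    move=> hk; rewrite ler_pdivrMr ?ltr0n// -ler_pdivrMl ?divr_gt0 ?exprn_gt0// invfM invrK.
    have e20 : 0 <= 2 * C / e ^+ 2 by apply: divr_ge0; [exact: mulr_ge0|exact: sqr_ge0].
    rewrite (_ : (e ^+ 2)^-1 * 2 * C = 2 * C / e ^+ 2); last by ring.
    apply: le_trans (ltW (archi_boundP e20)) _; rewrite ler_nat; exact: leq_trans hk (leqnSn k).
  rewrite -(@ler_pXn2r _ 2)// ?nnegrE ?enorm_ge0 ?(ltW e0)//.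
  apply: le_trans (dist _ _ _ tac) _; rewrite -/C mulrDr [leRHS](splitr (e ^+ 2)).
  by apply: lerD; apply: inv.
have /choice[g0 hg0] : forall t, exists l, a <= t <= c -> forall e, 0 < e -> exists N, forall n, (N <= n)%N -> enorm (f n t - l) <= e.
  move=> t; have [tac|//] := boolP (a <= t <= c); last by exists 0.
  have [|l hl] := @cauchy_sequence_limit _ _ (f ^~ t); last by exists l.
  by move=> e e0; have [N hN] := cau e e0; exists N => n m Nn Nm; exact: hN.
have lim e : 0 < e -> exists N, forall n t, (N <= n)%N -> a <= t <= c -> enorm (f n t - g0 t) <= e.
  move=> e0; have e2 : 0 < e / 2 by rewrite divr_gt0.
  have [N hN] := cau _ e2; exists N => n t Nn tac.
  have [N' hN'] := hg0 t tac _ e2; pose m := maxn N N'.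
  have -> : f n t - g0 t = (f n t - f m t) + (f m t - g0 t) by rewrite addrA subrK.
  apply: le_trans (enormD _ _) _; rewrite (splitr e); apply: lerD.
    by apply: hN => //; rewrite leq_maxl.
  by apply: hN'; rewrite leq_maxr.
have gD t : a <= t <= c -> enorm (g0 t) <= D.
  move=> tac; apply/ler_addgt0Pr => e e0; have [N hN] := lim e e0.
  rewrite (_ : g0 t = f N t - (f N t - g0 t)); last by rewrite opprB addrC subrK.
  apply: le_trans (enormD _ _) _; rewrite enormN; apply: lerD; first exact: fD.
  exact: hN.
exists g0; last first.
  apply/eqP; rewrite -subr_eq0; apply/eqP/enorm_eq0/eqP; rewrite eq_le enorm_ge0 andbT.
  apply/ler_addgt0Pr => e e0; have [N hN] := lim e e0; rewrite add0r enormC -(fx N).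
  by apply: hN => //; rewrite lexx.
split.
  move=> p q pac qac; apply/ler_addgt0Pr => e e0; have e2 : 0 < e / 2 by rewrite divr_gt0.
  have [N hN] := lim _ e2.
  rewrite (_ : g0 p - g0 q = (f N p - f N q) - (f N p - g0 p) + (f N q - g0 q)); last first.
    by apply/rowP => j; rewrite !mxE; ring.
  apply: le_trans (enormD _ _) _; rewrite (splitr e) addrA; apply: lerD; last exact: hN.
  apply: le_trans (enormD _ _) _; rewrite enormN; apply: lerD; last exact: hN.
  by have [l _] := hf N; exact: l.
move=> t tac; have tac' : a <= t <= c by have /andP[-> /ltW ->] := tac.
exists (b t (g0 t)); first by rewrite subrr enorm0.
set v := b t (g0 t) => e e0.
have [at0 tc] : a <= t /\ t < c by have /andP[] := tac.
have e4 : 0 < e / 4 by rewrite divr_gt0.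
have [c1 c10 hc1] := bunif D e4.
pose r := Order.min c1 (c1 / (2 * (L + 1))).
have L10 : 0 < 2 * (L + 1) by rewrite mulr_gt0// ltr_wpDl.
exists r; first by rewrite lt_min c10 divr_gt0.
move=> q /andP[tq]; rewrite -ltrBlDl lt_min => /andP[q1 q2] qc.
have qac : a <= q <= c by rewrite qc (le_trans at0)// ltW.
have qt0 : 0 < q - t by rewrite subr_gt0.
have {}q2 : L * (q - t) <= c1 / 2.
  move: q2; rewrite ltr_pdivlMr// => q2; rewrite ler_pdivlMr//.
  move: q2; rewrite mulrDr mulr1; move: (q - t) qt0 => w w0; lra.
apply: (@le_trans _ _ (e / 2 * (q - t) + e / 2 * (q - t))); last by rewrite -mulrDl -splitr.
(* The index n depends on q: the uniform error must be small compared with q - t. *)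
pose eta := Order.min (e / 4 * (q - t)) (c1 / 2).
have eta0 : 0 < eta by rewrite lt_min !mulr_gt0.
have [N1 hN1] := lim _ eta0.
pose n := maxn N1 (Num.bound (e / 4)^-1).
have hn t' : a <= t' <= c -> enorm (f n t' - g0 t') <= eta.
  by move=> h; apply: hN1 => //; rewrite leq_maxl.
have en : n.+1%:R^-1 <= e / 4.
  rewrite invf_ple ?posrE ?ltr0n//.
  have h : 0 <= (e / 4)^-1 by rewrite invr_ge0 ltW.
  apply: le_trans (ltW (archi_boundP h)) _; rewrite ler_nat.
  by apply: leqW; rewrite leq_maxr.
(* The defect of the increment. Its norm is estimated by the scalar mean value inequality in the
   direction of [w] itself, which gives |w|^2 <= (e / 2) |w| (q - t). *)
pose w := f n q - f n t + (q - t) *: v.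
have hw : enorm w <= e / 2 * (q - t).
  have [lf df] := hf n.
  have slope p : t <= p < q -> right_slope_le (fun s => dotp (f n s - (- s) *: v) w) q p (e / 2 * enorm w).
    move=> /andP[tp pq]; have pac : a <= p < c by rewrite (le_trans at0 tp) (lt_le_trans pq).
    have pac' : a <= p <= c by have /andP[-> /ltW ->] := pac.
    have [z ze dz] := df p pac.
    have dv : right_deriv (fun s => (- s) *: v) c p (- v).
      move=> e' e'0; exists 1 => // s /andP[ps _] _.
      rewrite (_ : _ - _ = 0) ?enorm0; first by rewrite mulr_ge0// ?ltW// subr_gt0.
      by apply/rowP => j; rewrite !mxE; ring.
    have sl := right_deriv_dotp w (right_derivB dz dv).
    have sl' : right_slope_le (fun s => dotp (f n s - (- s) *: v) w) q p (dotp (- z - - v) w).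
      by move=> e' e'0; have [r' r'0 h'] := sl e' e'0; exists r' => // s' s1 s2; apply: h' => //; exact: le_trans qc.
    apply: right_slope_le_mono sl'; apply: le_trans (dotp_le _ _) _; apply: ler_wpM2r; first exact: enorm_ge0.
    rewrite (_ : - z - - v = - (z - b p (f n p)) - (b p (f n p) - v)); last by apply/rowP => j; rewrite !mxE; ring.
    apply: le_trans (enormD _ _) _; rewrite !enormN.
    have pq' : p - t <= q - t by rewrite lerD2r ltW.
    have p1 : enorm (b p (f n p) - v) <= e / 4.
      apply: hc1.
      - by case/andP: pac' => h1 h2; rewrite (le_trans a0 h1) (le_trans h2).
      - by rewrite (le_trans a0 at0) (le_trans (ltW tc)).
      - exact: fD.
      - exact: gD.
      - by rewrite ger0_norm ?subr_ge0//; apply: le_trans pq' (ltW q1).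
      - rewrite (_ : f n p - g0 t = (f n p - f n t) + (f n t - g0 t)); last by rewrite addrA subrK.
        apply: le_trans (enormD _ _) _; rewrite (splitr c1); apply: lerD.
          apply: le_trans (lf _ _ pac' tac') _; rewrite ger0_norm ?subr_ge0//.
          by apply: le_trans q2; exact: ler_wpM2l.
        by apply: le_trans (hn _ tac') _; rewrite ge_min lexx orbT.
    by move: p1 (le_trans ze en); clear; lra.
  have cont : cont_on t q (fun s => dotp (f n s - (- s) *: v) w).
    apply: (@lipschitz_cont_on _ _ _ ((L + enorm v) * enorm w)) => p p' /andP[p1 p2] /andP[p1' p2'].
    rewrite -dotpBl; apply: le_trans (cauchy_schwarz _ _) _.
    rewrite mulrAC; apply: ler_wpM2r; first exact: enorm_ge0.
    rewrite (_ : _ - _ = (f n p - f n p') + (p - p') *: v); last by apply/rowP => j; rewrite !mxE; ring.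
    apply: le_trans (enormD _ _) _; rewrite enormZ mulrDl (mulrC (enorm v)); apply: lerD => //.
    by apply: lf; rewrite ?(le_trans at0)//= (le_trans _ qc).
  have := mean_value_le (ltW tq) cont slope.
  rewrite -dotpBl (_ : _ - _ - _ = w); last by rewrite /w; apply/rowP => j; rewrite !mxE; ring.
  rewrite -enorm_sqr expr2 => hww.
  have [w0|w0] := eqVneq (enorm w) 0; first by rewrite w0 mulr_ge0// ?divr_ge0 ?ltW.
  have wpos : 0 < enorm w by rewrite lt_neqAle eq_sym w0 enorm_ge0.
  by rewrite -(ler_pM2r wpos); apply: le_trans hww _; rewrite mulrAC.
rewrite scalerN opprK.
rewrite (_ : g0 q - g0 t + _ = w - (f n q - g0 q) + (f n t - g0 t)); last by rewrite /w; apply/rowP => j; rewrite !mxE; ring.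
apply: le_trans (enormD _ _) _.
have h1 : enorm (f n t - g0 t) <= e / 4 * (q - t) by apply: le_trans (hn _ tac') _; rewrite ge_min lexx.
have h2 : enorm (f n q - g0 q) <= e / 4 * (q - t) by apply: le_trans (hn _ qac) _; rewrite ge_min lexx.
have := enormD w (- (f n q - g0 q)); by rewrite enormN; move: hw h1 h2; clear; lra.
Qed.

End flow.

Section flow.
Context {R : realType} {d : nat} (b : R -> 'rV[R]_d -> 'rV[R]_d) (T : R).
Hypothesis T0 : 0 <= T.
Hypothesis bmono : forall t x y, 0 <= t <= T -> 0 <= dotp (b t x - b t y) (x - y).
Hypothesis bbound : forall rho, exists2 M, 0 <= M & forall t x, 0 <= t <= T -> enorm x <= rho ->
  enorm (b t x) <= M.
Hypothesis bunif : forall rho e, 0 < e -> exists2 c, 0 < c & forall t t' x y, 0 <= t <= T -> 0 <= t' <= T ->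
  enorm x <= rho -> enorm y <= rho -> `|t - t'| <= c -> enorm (x - y) <= c -> enorm (b t x - b t' y) <= e.

(** The field may grow arbitrarily fast, but monotonicity against the origin gives b(t, x) . x >= -
    |b(t, 0)| |x|, so the polygons stay bounded. [L] depends on [rho] alone and not on [e], as the
    passage to the limit requires. *)
Lemma euler_flow_approx rho : 0 <= rho -> exists2 L, 0 <= L & forall a x e, 0 <= a <= T -> enorm x <= rho -> 0 < e ->
  exists2 f, approx_sol b e a T L f & f a = x.
Proof.
move=> rho0; have [B0 B00 hB0] := bbound 0.
(* Large enough for rho^2 + (2 B0 R0 + 1) T <= R0^2, which closes the induction on |X_k|^2. *)
pose R0 := rho + 2 * B0 * T + 1 + T.
have R00 : 0 <= R0 by rewrite !addr_ge0// !mulr_ge0.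
have [L L0 hL] := bbound (R0 + 1); exists L => // a x e /andP[a0 aT] xrho e0.
have [aeT|aT'] := eqVneq a T.
  exists (fun=> x) => //; split; first by move=> s t _ _; rewrite subrr enorm0 mulr_ge0.
  by move=> t /andP[t1 t2]; have := le_lt_trans t1 t2; rewrite aeT ltxx.
have {aT'} Ta : 0 < T - a by rewrite subr_gt0 lt_neqAle aT'.
have [c c0 hc] := bunif (R0 + 1) e0.
(* A sum of nonnegative terms, one for each requirement on the step: [h * K <= 1] implies them
   all. *)
pose K := (1 + L ^+ 2) + ((1 + L) / c + (1 + L)).
have L1 : 0 <= 1 + L by rewrite addr_ge0.
have K1 : 0 <= 1 + L ^+ 2 by rewrite addr_ge0// sqr_ge0.
have K2 : 0 <= (1 + L) / c by rewrite divr_ge0// ltW.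
pose n := (Num.bound ((T - a) * K)).+1.
pose h := (T - a) / n%:R.
have h0 : 0 < h by rewrite divr_gt0// ltr0n.
have nh : a + n%:R * h = T by rewrite /h mulrC divfK ?pnatr_eq0// addrC subrK.
have hK : h * K <= 1.
  rewrite /h mulrAC ler_pdivrMr ?ltr0n// mul1r.
  have K0 : 0 <= K by apply: addr_ge0 => //; exact: addr_ge0.
  have P0 := mulr_ge0 (ltW Ta) K0.
  by apply: le_trans (ltW (archi_boundP P0)) _; rewrite ler_nat.
have hL2 : h * L ^+ 2 <= 1.
  apply: le_trans hK; apply: ler_wpM2l; first exact: ltW.
  by rewrite /K -addrA addrCA lerDl !addr_ge0.
have hL1 : h * (1 + L) <= 1.
  apply: le_trans hK; apply: ler_wpM2l; first exact: ltW.
  by rewrite /K addrA lerDr addr_ge0.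
have hLc : h * (1 + L) <= c.
  rewrite -(ler_pM2r (_ : 0 < c^-1)) ?invr_gt0// mulfV ?gt_eqF// -mulrA; apply: le_trans hK; apply: ler_wpM2l; first exact: ltW.
  by rewrite /K addrCA lerDl addr_ge0.
have hc1 : h <= c by apply: le_trans hLc; rewrite mulrDr mulr1 lerDl mulr_ge0// ltW.
have hLc1 : h * L <= c by apply: le_trans hLc; rewrite mulrDr mulr1 lerDr ltW.
have hL11 : h * L <= 1 by apply: le_trans hL1; rewrite mulrDr mulr1 lerDr ltW.
pose X := fix X k := if k is k'.+1 then X k' - h *: b (a + k'%:R * h) (X k') else x.
have tk k : (k <= n)%N -> 0 <= a + k%:R * h <= T.
  move=> kn; apply/andP; split; first by rewrite addr_ge0// mulr_ge0// ltW.
  rewrite -[leRHS]nh lerD2l; apply: ler_wpM2r; first exact: ltW.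
  by rewrite ler_nat.
have XR k : (k <= n)%N -> enorm (X k) ^+ 2 <= rho ^+ 2 + (2 * B0 * R0 + 1) * (k%:R * h).
  elim: k => [_|k IH kn]; first by rewrite mul0r mulr0 addr0 ler_pXn2r ?nnegrE ?enorm_ge0.
  have {}IH := IH (ltnW kn); have kT := tk k (ltnW kn).
  have cst : 0 <= 2 * B0 * R0 + 1 by rewrite addr_ge0// !mulr_ge0.
  have XkR : enorm (X k) <= R0.
    rewrite -(@ler_pXn2r _ 2)// ?nnegrE ?enorm_ge0//; apply: le_trans IH _.
    have khT : k%:R * h <= T by case/andP: kT => _; apply: le_trans; rewrite lerDr.
    have := ler_wpM2l cst khT; rewrite /R0.
    have := mulr_ge0 B00 T0; have := mulr_ge0 rho0 T0; have := sqr_ge0 T.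
    have := mulr_ge0 rho0 (mulr_ge0 B00 T0).
    move: (_ * h) => kh; rewrite !expr2; nra.
  have bL : enorm (b (a + k%:R * h) (X k)) <= L.
    by apply: hL => //; apply: le_trans XkR _; rewrite lerDl.
  have bX : - (B0 * R0) <= dotp (b (a + k%:R * h) (X k)) (X k).
    have := bmono (X k) 0 kT; rewrite subr0 dotpBl subr_ge0; apply: le_trans.
    rewrite lerNl; apply: le_trans (ler_norm _) _; rewrite normrN.
    apply: le_trans (cauchy_schwarz _ _) _; apply: ler_pM; rewrite ?enorm_ge0//.
    by apply: hB0; rewrite ?enorm0.
  rewrite /= enorm_sqrD enormN enormZ dotpNr dotpZr exprMn (ger0_norm (ltW h0)) dotpC.
  have -> : k.+1%:R * h = k%:R * h + h by rewrite -natr1 mulrDl mul1r.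
  have bL2 : enorm (b (a + k%:R * h) (X k)) ^+ 2 <= L ^+ 2 by rewrite ler_pXn2r ?nnegrE ?enorm_ge0.
  have q1 := ler_wpM2l (sqr_ge0 h) bL2; have q2 := ler_wpM2l (ltW h0) bX; have q3 := ler_wpM2l (ltW h0) hL2.
  move: IH q1 q2 q3.
  move: (enorm (X k)) (enorm (b _ _)) (dotp _ _) => p q o.
  move: (k%:R * h) => kh; lra.
have XkR k : (k <= n)%N -> enorm (X k) <= R0.
  move=> kn; rewrite -(@ler_pXn2r _ 2)// ?nnegrE ?enorm_ge0//; apply: le_trans (XR k kn) _.
  have khT : k%:R * h <= T by have /andP[_] := tk k kn; apply: le_trans; rewrite lerDr.
  have cst : 0 <= 2 * B0 * R0 + 1 by rewrite addr_ge0// !mulr_ge0.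
  have := ler_wpM2l cst khT; rewrite /R0.
  have := mulr_ge0 B00 T0; have := mulr_ge0 rho0 T0; have := sqr_ge0 T.
  have := mulr_ge0 rho0 (mulr_ge0 B00 T0).
  move: (_ * h) => kh; rewrite !expr2; nra.
have [|k kn|k t y kn /andP[t1 t2] yX|f hf fX] := @scheme_approx_sol _ _ b e a h L X (fun k => b (a + k%:R * h) (X k)) n h0 L0.
- by [].
- apply: hL; first exact: tk (ltnW kn).
  by apply: le_trans (XkR k (ltnW kn)) _; rewrite lerDl.
- have XkRn := XkR k (ltnW kn).
  apply: hc.
  + exact: tk (ltnW kn).
  + have /andP[p1 _] := tk k (ltnW kn); have /andP[_ p2] := tk k.+1 kn.
    by rewrite (le_trans p1 t1) (le_trans (ltW t2) p2).
  + by apply: le_trans XkRn _; rewrite lerDl.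
  + rewrite (_ : y = X k + (y - X k)); last by rewrite addrC subrK.
    by apply: le_trans (enormD _ _) _; apply: lerD => //; exact: le_trans yX _.
  + rewrite distrC ger0_norm ?subr_ge0//; apply: le_trans hc1.
    by rewrite lerBlDl; move: (ltW t2); rewrite -natr1 mulrDl mul1r addrA.
  + by rewrite enormC; exact: le_trans yX _.
exists f; first by rewrite nh in hf.
by have := fX 0%N (leq0n _); rewrite mul0r addr0.
Qed.

Lemma flow_exists rho : 0 <= rho -> exists2 L, 0 <= L & forall a x, 0 <= a <= T -> enorm x <= rho ->
  exists2 f, approx_sol b 0 a T L f & f a = x.
Proof.
move=> rho0; have [L L0 hL] := euler_flow_approx rho0; exists L => // a x aT xrho.
have /choice[f hf] : forall n : nat, exists f, approx_sol b n.+1%:R^-1 a T L f /\ f a = x.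
  by move=> n; have [|f h1 h2] := hL a x n.+1%:R^-1 aT xrho; [rewrite invr_gt0 ltr0n|exists f].
have /andP[a0 aT'] := aT.
apply: (approx_sol_limit bmono bunif a0 aT' (lexx T) L0 (f := f)).
  by move=> n; have [] := hf n.
by move=> n; have [] := hf n.
Qed.

Lemma approx_sol_contract a c L1 L2 f1 f2 t : 0 <= a -> a <= t <= c -> c <= T -> 0 <= L1 -> 0 <= L2 ->
  approx_sol b 0 a c L1 f1 -> approx_sol b 0 a c L2 f2 ->
  enorm (f1 t - f2 t) <= enorm (f1 a - f2 a).
Proof.
move=> a0 tac cT L10 L20 h1 h2; have /andP[at1 tc] := tac; have ac := le_trans at1 tc.
pose D := enorm (f1 a) + L1 * (c - a) + (enorm (f2 a) + L2 * (c - a)).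
have D0 : 0 <= D by rewrite !addr_ge0 ?enorm_ge0// mulr_ge0// subr_ge0.
have hD (q : R) : a <= q <= c -> enorm (f1 q - f2 q) <= D.
  move=> qac; apply: le_trans (enormD _ _) _; rewrite enormN.
  by apply: lerD; apply: approx_sol_bound; eassumption.
have := approx_sol_dist bmono a0 ac cT D0 hD h1 h2 tac.
by rewrite addr0 mulr0 mul0r addr0 ler_pXn2r ?nnegrE ?enorm_ge0.
Qed.

(* Junk value: the constant [x] when there is no solution. *)
Definition flow (a : R) (x : 'rV[R]_d) : R -> 'rV[R]_d :=
  if pselect (exists f, exists2 L, 0 <= L & approx_sol b 0 a T L f /\ f a = x) is left h
  then projT1 (cid h) else fun=> x.

Lemma flow_start a x : flow a x a = x.
Proof.
by rewrite /flow; case: pselect => // h; case: cid => f /= [L _ []].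
Qed.

Lemma flow_unique a x t f L : 0 <= a -> a <= t <= T -> 0 <= L -> approx_sol b 0 a T L f -> f a = x -> flow a x t = f t.
Proof.
move=> a0 taT L0 hf fa; rewrite /flow; case: pselect => [h|[]]; last by exists f, L.
case: cid => g /= [L' L'0 [hg ga]].
apply/eqP; rewrite -subr_eq0; apply/eqP/enorm_eq0/eqP; rewrite eq_le enorm_ge0 andbT.
have := approx_sol_contract a0 taT (lexx T) L'0 L0 hg hf.
by rewrite ga fa subrr enorm0.
Qed.

Lemma flow_sol rho : 0 <= rho -> exists2 L, 0 <= L & forall a x, 0 <= a <= T -> enorm x <= rho ->
  approx_sol b 0 a T L (flow a x).
Proof.
move=> rho0; have [L L0 hL] := flow_exists rho0; exists L => // a x aT xrho.
have [f hf fa] := hL a x aT xrho; have /andP[a0 aT'] := aT.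
have e t : a <= t <= T -> flow a x t = f t by move=> taT; exact: flow_unique hf fa.
have [lf df] := hf; split; first by move=> s t sa ta; rewrite !e//; exact: lf.
move=> t tac; have [p pe dp] := df t tac; have /andP[t1 t2] := tac.
exists p; first by rewrite e// t1 ltW.
move=> e0 e00; have [r r0 hr] := dp e0 e00; exists r => // s st sT.
have /andP[ts _] := st; rewrite !e ?t1 ?(ltW t2)//; first exact: hr.
by rewrite sT (le_trans t1 (ltW ts)).
Qed.

Lemma flow_contract a x y t : 0 <= a -> a <= t <= T -> enorm (flow a x t - flow a y t) <= enorm (x - y).
Proof.
move=> a0 taT; have /andP[at1 tT] := taT; have aT : 0 <= a <= T by rewrite a0 (le_trans at1).
have [L1 L10 h1] := flow_sol (enorm_ge0 x); have [L2 L20 h2] := flow_sol (enorm_ge0 y).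
have := approx_sol_contract a0 taT (lexx T) L10 L20 (h1 a x aT (lexx _)) (h2 a y aT (lexx _)).
by rewrite !flow_start.
Qed.

Lemma flow_semigroup a x t q : 0 <= a -> a <= t -> t <= q -> q <= T -> flow t (flow a x t) q = flow a x q.
Proof.
move=> a0 at1 tq qT; have aT : 0 <= a <= T by rewrite a0 (le_trans at1) ?(le_trans tq).
have [L L0 h] := flow_sol (enorm_ge0 x); have ha := h a x aT (lexx _).
apply: (@flow_unique _ _ _ (flow a x) L) => //; first exact: le_trans at1.
  by rewrite tq.
exact: approx_sol_restrict ha.
Qed.

Lemma flow_lipschitz rho : 0 <= rho -> exists2 L, 0 <= L & forall a x t, 0 <= a -> a <= t <= T -> enorm x <= rho ->
  enorm (flow a x t - x) <= L * (t - a).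
Proof.
move=> rho0; have [L L0 h] := flow_sol rho0; exists L => // a x t a0 taT xrho.
have /andP[at1 tT] := taT; have aT : 0 <= a <= T by rewrite a0 (le_trans at1).
have [l _] := h a x aT xrho; have := l t a taT; rewrite flow_start lexx (le_trans at1 tT) => /(_ isT).
by rewrite ger0_norm// subr_ge0.
Qed.

Lemma flow_right_deriv a x : 0 <= a < T -> right_deriv (flow a x) T a (- b a x).
Proof.
move=> /andP[a0 aT]; have [L L0 h] := flow_sol (enorm_ge0 x).
have [|_ d1] := h a x _ (lexx _); first by rewrite a0 ltW.
have [|p] := d1 a; first by rewrite lexx.
rewrite flow_start => hp; have -> : p = b a x; last by [].
by apply/eqP; rewrite -subr_eq0; apply/eqP/enorm_eq0/eqP; rewrite eq_le enorm_ge0 andbT.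
Qed.

End flow.

Lemma continuous_curve_uniform {R : realType} {d : nat} (T : R) (u : R -> Pp R d 2) :
  continuous_curve (@wasserstein R d 2) T u ->
  forall e, 0 < e -> exists2 c, 0 < c & forall q t, 0 <= q <= T -> 0 <= t <= T ->
    `|q - t| <= c -> w2 (sval (u q)) (sval (u t)) <= e.
Proof.
move=> hu e e0; have e2 : 0 < e / 2 by rewrite divr_gt0.
pose P c x := 0 <= x <= T -> forall q, 0 <= q <= T -> `|q - x| <= c -> w2 (sval (u q)) (sval (u x)) <= e.
have : \forall c \near (0 : R)^'+, (`[0, T]%classic `<=` P c).
  apply: (compact_near_coveringP _).1; first exact: segment_compact.
  move=> x; rewrite /= in_itv/= => x0T.
  have [c c0 hc] := continuous_curve_w2 hu x0T e2.
  have c2 : 0 < c / 2 by rewrite divr_gt0.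
  exists (ball x (c / 2), [set c' | c' < c / 2]).
    by split; [exact: nbhsx_ballx|exact: nbhs_right_lt].
  move=> [y c'] /= [xy c'c] y0T q q0T qy.
  have h1 : `|y - x| < c by apply: lt_trans (_ : c / 2 < c); [rewrite distrC|rewrite ltr_pdivrMr// ltr_pMr// ltr1n].
  have h2 : `|q - x| < c.
    rewrite (_ : q - x = (q - y) + (y - x)); last by rewrite addrA subrK.
    apply: le_lt_trans (ler_normD _ _) _; rewrite (splitr c) distrC.
    by apply: ltrD; [apply: le_lt_trans c'c; rewrite distrC|rewrite distrC].
  have := w2_tri (svalP (u q)) (svalP (u x)) (svalP (u y)).
  move=> /le_trans; apply; rewrite (splitr e); apply: lerD; first exact: hc.
  by rewrite w2_sym; exact: hc.
move=> h.
have : \forall c \near (0 : R)^'+, 0 < c /\ (`[0, T]%classic `<=` P c).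
  by near=> c; split; [near: c; exact: nbhs_right_gt|near: c; exact: h].
move=> /filter_ex[c [c0 hc]]; exists c => // q t qT tT qt.
by apply: hc => //=; rewrite in_itv.
Unshelve. all: by end_near.
Qed.

Lemma supp_in_le {R : realType} {d : nat} (r r' : R) (mu : probability (borelRd R d) R) :
  r <= r' -> supp_in r mu -> supp_in r' mu.
Proof.
move=> rr hmu; apply/eqP; rewrite -measure_le0 -[leRHS]hmu; apply: le_measure; rewrite ?inE;
  try by apply: (@measurable_enorm_gt _ _ _ _ (fun x : borelRd R d => x)); exact: measurable_id.
by move=> x /=; apply: contra_not => /le_trans; apply.
Qed.

(** * The velocity field along the gradient flow *)

Section field.
Context {R : realType} {d : nat} (s : R) (W : 'rV[R]_d -> R).
Hypothesis hs : 0 < s.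
Hypothesis hWeven : forall x, W (- x) = W x.
Hypothesis hWconvex : convex_function setT W.
Hypothesis hWreg : C1_holder_loc s W.
Local Notation Rd := (borelRd R d).
Variables (T r : R) (u : R -> Pp R d 2).
Hypothesis r0 : 0 <= r.
Hypothesis hu : continuous_curve (@wasserstein R d 2) T u.
Hypothesis hr : forall t, 0 <= t <= T -> supp_in r (sval (u t)).

Definition field t x := conv_grad W (sval (u t)) x.

Let clip_law t : 0 <= t <= T -> is_law (sval (u t)) (clip r : Rd -> Rd) (sval (u t)).
Proof. by move=> tT; exact: is_law_clip (is_law_id _) (hr tT). Qed.

Lemma field_mono t x y : 0 <= t <= T -> 0 <= dotp (field t x - field t y) (x - y).
Proof.
move=> tT; apply: (conv_grad_monoX hs hWconvex hWreg _ _ (clip_law tT)) => z; exact: clip_le.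
Qed.

Lemma field_bound rho : exists2 M, 0 <= M & forall t x, 0 <= t <= T -> enorm x <= rho ->
  enorm (field t x) <= M.
Proof.
have [M M0 hM] := gradW_bounded hs hWreg (rho + r).
exists (d%:R * M); first by rewrite mulr_ge0.
move=> t x tT xrho; apply: enorm_le_bound => i; apply: (conv_grad_bound hWreg i (clip_law tT) hM).
move=> z; apply: le_trans (enormD _ _) _; rewrite enormN; apply: lerD => //; exact: clip_le.
Qed.

(* Stated for two laws rather than along the curve, so as to compare also with
   the Euler scheme. *)
Lemma conv_grad_close rho e : 0 < e -> exists2 c, 0 < c & forall mu nu x y,
  supp_in rho mu -> supp_in rho nu -> enorm x <= rho -> enorm y <= rho ->
  w2 mu nu <= c -> enorm (x - y) <= c -> enorm (conv_grad W mu x - conv_grad W nu y) <= e.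
Proof.
move=> e0; pose e1 := e / (2 * (d%:R + 1)).
have d0 : 0 < 2 * (d%:R + 1) :> R by rewrite mulr_gt0// ltr_wpDl.
have e10 : 0 < e1 by rewrite divr_gt0.
have [K K0 hK] := conv_grad_modulus hs hWreg rho e10.
have K1 : 0 < 2 * K + 1 by rewrite ltr_wpDl// mulr_ge0.
pose c := Order.min 1 (e1 / (2 * K + 1)).
have c0 : 0 < c by rewrite lt_min ltr01 divr_gt0.
exists c => // mu nu x y hmu hnu xr yr wc xyc.
have c1 : c <= 1 by rewrite ge_min lexx.
have c2 : c * (2 * K + 1) <= e1 by rewrite -ler_pdivlMr// ge_min lexx orbT.
have sq (a : R) : 0 <= a -> a <= c -> a ^+ 2 <= c.
  move=> a0 ac; rewrite expr2; apply: le_trans (_ : a * 1 <= _); last by rewrite mulr1.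
  by apply: ler_wpM2l => //; exact: le_trans ac c1.
apply: (@le_trans _ _ (d%:R * (2 * e1))).
  apply: enorm_le_bound => i; rewrite coordB; apply: le_trans (hK _ _ _ _ i hmu hnu xr yr) _.
  have q1 := sq _ (w2_ge0 _ _) wc; have q2 := sq _ (enorm_ge0 _) xyc.
  have q3 : K * (enorm (x - y) ^+ 2 + w2 mu nu ^+ 2) <= K * (c + c) by apply: ler_wpM2l => //; exact: lerD.
  by move: q3 c2 c0; lra.
have -> : d%:R * (2 * e1) = e * (d%:R / (d%:R + 1)).
  by rewrite /e1; field; rewrite gt_eqF// ltr_wpDl.
by rewrite ler_piMr ?(ltW e0)// ler_pdivrMr ?ltr_wpDl// mul1r lerDl.
Qed.

Lemma field_unif rho e : 0 < e -> exists2 c, 0 < c & forall t t' x y, 0 <= t <= T -> 0 <= t' <= T ->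
  enorm x <= rho -> enorm y <= rho -> `|t - t'| <= c -> enorm (x - y) <= c ->
  enorm (field t x - field t' y) <= e.
Proof.
move=> e0; pose rho' := Order.max rho r.
have [c1 c10 h1] := conv_grad_close rho' e0.
have [c2 c20 h2] := continuous_curve_uniform hu c10.
exists (Order.min c1 c2); first by rewrite lt_min c10.
move=> t t' x y tT tT' xr yr; rewrite !le_min => /andP[_ tt] /andP[xy _].
apply: h1 => //.
- by apply: supp_in_le (hr tT); rewrite le_max lexx orbT.
- by apply: supp_in_le (hr tT'); rewrite le_max lexx orbT.
- by apply: le_trans xr _; rewrite le_max lexx.
- by apply: le_trans yr _; rewrite le_max lexx.
- exact: h2.
Qed.

End field.

(** A step that reaches [t] exactly; all smallness requirements on it are gathered in one [K]. *)
Lemma step_size {R : realType} (t K : R) : 0 < t -> 0 <= K ->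
  exists n h, [/\ 0 < h, n%:R * h = t & h * K <= 1].
Proof.
move=> t0 K0; pose n := (Num.bound (t * K)).+1.
have n0 : 0 < n%:R :> R by rewrite ltr0n.
exists n, (t / n%:R); split; first by rewrite divr_gt0.
  by rewrite mulrC divfK ?gt_eqF.
rewrite mulrAC ler_pdivrMr// mul1r.
by apply: le_trans (ltW (archi_boundP (mulr_ge0 (ltW t0) K0))) _; rewrite ler_nat.
Qed.

(** * The gradient flow is the push-forward of its initial law by the flow *)

Section flow_law.
Context {R : realType} {d : nat} (s : R) (W : 'rV[R]_d -> R).
Hypothesis hs : 0 < s.
Hypothesis hWeven : forall x, W (- x) = W x.
Hypothesis hWconvex : convex_function setT W.
Hypothesis hWreg : C1_holder_loc s W.
Local Notation Rd := (borelRd R d).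
Variables (T r0 : R) (u : R -> Pp R d 2) (mu0 : probability Rd R).
Hypothesis T0 : 0 < T.
Hypothesis r00 : 0 <= r0.
Hypothesis hu : continuous_curve (@wasserstein R d 2) T u.
Hypothesis slope : maximal_slope_curve (@wasserstein R d 2) (interaction_energy W) 0 T u.
Hypothesis u0 : sval (u 0) = mu0.
Hypothesis smu0 : supp_in r0 mu0.

Lemma curve_euler : exists B, 0 <= B /\ forall (h : R) k, 0 < h -> 4 * B ^+ 2 * h * T <= 1 -> k%:R * h <= T ->
  [/\ is_law mu0 (euler W mu0 r0 h k : Rd -> Rd) (euler_law W mu0 r0 h k),
    (forall x, enorm (euler W mu0 r0 h k x) <= r0 + T * B),
    (forall x, enorm (conv_grad W (euler_law W mu0 r0 h k) (euler W mu0 r0 h k x)) <= B) &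
    w2 (sval (u (k%:R * h))) (euler_law W mu0 r0 h k) ^+ 2 <= T * h * B ^+ 2].
Proof.
have [M M0 hM] := gradW_bounded hs hWreg (2 * r0 + 1).
exists (d%:R * M); split; first by rewrite mulr_ge0.
move=> h k h0 hsm kT; have h0' := ltW h0.
have [lX _ _ b3] := euler_bounds hs hWconvex hWreg mu0 r00 M0 hM h0' hsm kT.
split => //.
- by move=> x; exact: (euler_le_radius hs hWconvex hWreg mu0 r00 M0 hM h0' hsm x kT).
- apply: le_trans (euler_w2 hs hWeven hWconvex hWreg r00 M0 hM h0' hsm hu slope u0 smu0 h0 kT) _.
  rewrite -[leRHS]mulrA; apply: ler_wpM2r => //; by rewrite mulr_ge0// sqr_ge0.
Qed.

(** The Euler laws stay in the ball of radius r0 + T B and converge to the curve in [w2]; Markov's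
    inequality with a margin of 1 carries the support bound to the limit. *)
Lemma curve_supp : exists2 r, 0 <= r & forall t, 0 <= t <= T -> supp_in r (sval (u t)).
Proof.
have [B [B0 hB]] := curve_euler; pose r := r0 + T * B.
have rr : 0 <= r by rewrite addr_ge0// mulr_ge0// ltW.
exists (r + 1); first by rewrite addr_ge0.
move=> t /andP[t0 tT]; have [->|tn0] := eqVneq t 0.
  by rewrite u0; apply: supp_in_le smu0; rewrite /r -addrA lerDl addr_ge0// mulr_ge0// ltW.
have {tn0} {}t0 : 0 < t by rewrite lt_neqAle eq_sym tn0.
apply/eqP; rewrite -measure_le0; apply/lee_addgt0Pr => e e0; rewrite add0e.
pose K := 4 * B ^+ 2 * T + T * B ^+ 2 / e.
have K1 : 0 <= 4 * B ^+ 2 * T by rewrite !mulr_ge0 ?sqr_ge0// ltW.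
have K2 : 0 <= T * B ^+ 2 / e by rewrite divr_ge0 ?mulr_ge0 ?sqr_ge0// ltW.
have [n [h [h0 nh hK]]] := step_size t0 (addr_ge0 K1 K2).
have hK1 : 4 * B ^+ 2 * h * T <= 1.
  by apply: le_trans hK; rewrite mulrAC mulrC ler_wpM2l ?(ltW h0)// lerDl.
have hK2 : T * h * B ^+ 2 <= e.
  have : h * (T * B ^+ 2 / e) <= 1 by apply: le_trans hK; rewrite ler_wpM2l ?(ltW h0)// lerDr.
  by rewrite mulrA ler_pdivrMr// mul1r mulrCA mulrA.
have nT : n%:R * h <= T by rewrite nh.
have [lX Xr _ hw] := hB h n h0 hK1 nT; rewrite nh in hw.
have sX := supp_in_bounded lX Xr.
have mA q : measurable ([set x : 'rV[R]_d | ~ (enorm x <= q)] : set Rd).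
  by apply: (@measurable_enorm_gt _ _ _ _ (fun x : Rd => x)); exact: measurable_id.
apply: le_trans (measure_le_w2 (svalP (u t)) (supp_in_finite_moment sX) (mA (r + 1)) (mA r) ltr01 _) _.
  move=> x y /negP; rewrite -ltNge => xr /contrapT yr.
  by have := enormB_tri x y 0; rewrite !subr0; lra.
by rewrite [X in (X + _)%E]sX add0e lee_fin expr1n divr1; exact: le_trans hw hK2.
Qed.

Variable r : R.
Hypothesis rr : 0 <= r.
Hypothesis hr : forall t, 0 <= t <= T -> supp_in r (sval (u t)).
Local Notation b := (field W u).

Let bmono := field_mono hs hWconvex hWreg rr hr.
Let bbound := field_bound hs hWreg rr hr.
Let bunif := field_unif hs hWreg hu hr.

Lemma flow_measurable t : 0 <= t <= T -> measurable_fun setT (fun x : Rd => flow b T 0 (clip r0 x) t : Rd).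
Proof.
move=> tT; apply: measurable_coordP => i.
have c : continuous (fun x => flow b T 0 x t 0 i).
  apply: (@lipschitz_continuousRd _ _ _ 1) => x y; rewrite mul1r -coordB.
  by apply: le_trans (coord_le _ _) _; exact: (flow_contract (ltW T0) bmono bbound bunif).
exact: (measurableT_comp (continuous_measurableRd c) (measurable_clip r0)).
Qed.

(** The Euler laws are close to the curve, so their fields are close too, and every Euler particle
    is an approximate solution for the field of the curve. It stays near the exact solution with the
    same starting point, uniformly in that point, which bounds the distance between the two laws at
    time t. *)
Lemma flow_law_clip t : 0 <= t <= T -> is_law mu0 (fun x : Rd => flow b T 0 (clip r0 x) t : Rd) (sval (u t)).
Proof.
move=> tT; have mF := flow_measurable tT; have /andP[t0 tT'] := tT.
have [L L0 hL] := flow_sol (ltW T0) bmono bbound bunif r00.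
have T00 : (0 : R) <= 0 <= T by rewrite lexx ltW.
have sol x : approx_sol b 0 0 t L (flow b T 0 (clip r0 x)).
  by apply: approx_sol_restrict (hL 0 _ T00 (clip_le x r00)).
have Fr x : enorm (flow b T 0 (clip r0 x) t) <= r0 + L * t.
  have := @approx_sol_bound _ _ _ _ _ _ _ _ t L0 (sol x); rewrite lexx t0 => /(_ isT).
  rewrite flow_start subr0 => h; apply: le_trans h _; rewrite lerD2r; exact: clip_le.
have lF := is_law_of mu0 mF; set nu := law_of mu0 _ in lF.
have fnu := supp_in_finite_moment (supp_in_bounded lF Fr).
suff w0 : w2 (sval (u t)) nu = 0.
  by have [_ h] := lF; split => // A mA; rewrite h// (w2_eq0 (svalP (u t)) fnu w0).
have [tz|tn0] := eqVneq t 0.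
  have : w2 (sval (u t)) nu ^+ 2 <= 0.
    apply: w2_sqr_le; rewrite tz u0.
    apply: le_trans (W2e_le (is_law_clip (is_law_id mu0) smu0) lF) _.
    rewrite (_ : (\int[mu0]_w _)%E = 0%E)//; apply: integral0_eq => x _.
    by rewrite tz flow_start subrr enorm0 expr2 mul0r.
  by rewrite le_eqVlt ltNge sqr_ge0 orbF sqrf_eq0 => /eqP.
have {tn0} {}t0 : 0 < t by rewrite lt_neqAle eq_sym tn0.
have [B [B0 hB]] := curve_euler.
pose rho := Order.max r (r0 + T * B + 1).
pose D := (r0 + B * t) + (r0 + L * t).
have t0' := ltW t0.
have D0 : 0 <= D by rewrite !addr_ge0// mulr_ge0.
apply/eqP; rewrite eq_le w2_ge0 andbT; apply/ler_addgt0Pr => eta eta0; rewrite add0r.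
have eta2 : 0 < eta / 2 by rewrite divr_gt0.
(* Makes 2 D e t, the squared distance granted by the comparison of approximate solutions, at most
   (eta / 2)^2. *)
pose e := (eta / 2) ^+ 2 / (2 * D * t + 1).
have Dt : 0 <= 2 * D * t by rewrite !mulr_ge0.
have e0 : 0 < e by rewrite divr_gt0 ?exprn_gt0// ltr_wpDl.
have [c1 c10 close] := conv_grad_close hs hWreg rho e0.
(* From an Euler law to the curve at a time inside the step there are two distances, each at most c1
   / 2: Euler law to the curve at the node, then node to that time. *)
pose c := Order.min (c1 / 2) (eta / 2).
have c0 : 0 < c by rewrite lt_min !divr_gt0.
have [c2 c20 unif] := continuous_curve_uniform hu c0.
(* In order: the smallness required by the scheme, its distance to the curve, the variation of the
   curve over a step, and the motion of a particle over a step against 1 and against [c1]. *)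
pose K := (4 * B ^+ 2 * T + T * B ^+ 2 / c ^+ 2) + (c2^-1 + (B + B / c1)).
have K1 : 0 <= 4 * B ^+ 2 * T by rewrite !mulr_ge0 ?sqr_ge0// ltW.
have K2 : 0 <= T * B ^+ 2 / c ^+ 2 by rewrite divr_ge0 ?mulr_ge0 ?sqr_ge0// ltW.
have K3 : 0 <= c2^-1 by rewrite invr_ge0 ltW.
have K4 : 0 <= B / c1 by rewrite divr_ge0// ltW.
have K12 := addr_ge0 K1 K2; have K45 := addr_ge0 B0 K4; have K345 := addr_ge0 K3 K45.
have [n [h [h0 nh hK]]] := step_size t0 (addr_ge0 K12 K345).
have sub (q : R) : q <= K -> h * q <= 1 by move=> qK; apply: le_trans hK; rewrite ler_wpM2l ?(ltW h0).
have h1 : 4 * B ^+ 2 * h * T <= 1.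
  by rewrite (_ : 4 * B ^+ 2 * h * T = h * (4 * B ^+ 2 * T)); [apply: sub; rewrite /K; lra|ring].
have h2 : T * h * B ^+ 2 <= c ^+ 2.
  have : h * (T * B ^+ 2 / c ^+ 2) <= 1 by apply: sub; rewrite /K; lra.
  by rewrite mulrA ler_pdivrMr ?exprn_gt0// mul1r mulrCA mulrA.
have h3 : h <= c2 by have : h * c2^-1 <= 1; [apply: sub; rewrite /K; lra|rewrite ler_pdivrMr// mul1r].
have h4 : h * B <= 1 by apply: sub; rewrite /K; lra.
have h5 : h * B <= c1 by have : h * (B / c1) <= 1; [apply: sub; rewrite /K; lra|rewrite mulrA ler_pdivrMr// mul1r].
have kt k : (k <= n)%N -> k%:R * h <= t by move=> kn; rewrite -nh ler_wpM2r ?(ltW h0)// ler_nat.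
have kT k : (k <= n)%N -> k%:R * h <= T by move=> kn; exact: le_trans (kt k kn) tT'.
have w2c k : (k <= n)%N -> w2 (sval (u (k%:R * h))) (euler_law W mu0 r0 h k) <= c.
  move=> kn; have [_ _ _ hw] := hB h k h0 h1 (kT k kn).
  by rewrite -(@ler_pXn2r _ 2)// ?nnegrE ?w2_ge0 ?(ltW c0)//; exact: le_trans hw h2.
have srho k : (k <= n)%N -> supp_in rho (euler_law W mu0 r0 h k).
  move=> kn; have [lX Xr _ _] := hB h k h0 h1 (kT k kn).
  by apply: supp_in_le (supp_in_bounded lX Xr); rewrite /rho le_max lerDl ler01 orbT.
have fv k (kn : (k <= n)%N) := supp_in_finite_moment (srho k kn).
have dist x : enorm (euler W mu0 r0 h n x - flow b T 0 (clip r0 x) t) ^+ 2 <= (eta / 2) ^+ 2.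
  have [k kn|k kn|k q y kn /andP[q1 q2] yX|f hf fX] := @scheme_approx_sol _ _ b e 0 h B (fun k => euler W mu0 r0 h k x)
     (fun k => conv_grad W (euler_law W mu0 r0 h k) (euler W mu0 r0 h k x)) n h0 B0.
  - by [].
  - by have [_ _ hb _] := hB h k h0 h1 (kT k (ltnW kn)); exact: hb.
  - rewrite add0r in q1; rewrite add0r in q2.
    have qT : 0 <= q <= T.
      apply/andP; split; first by apply: le_trans q1; rewrite mulr_ge0// ltW.
      exact: le_trans (ltW q2) (kT _ kn).
    have kqT : 0 <= k%:R * h <= T.
      by apply/andP; split; [rewrite mulr_ge0// ltW|apply: kT; exact: ltnW].
    have [_ Xr _ _] := hB h k h0 h1 (kT k (ltnW kn)).
    apply: close.
    + exact: srho (ltnW kn).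
    + by apply: supp_in_le (hr qT); rewrite /rho le_max lexx.
    + by apply: le_trans (Xr x) _; rewrite /rho le_max lerDl ler01 orbT.
    + rewrite (_ : y = euler W mu0 r0 h k x + (y - euler W mu0 r0 h k x)); last by rewrite addrC subrK.
      apply: le_trans (enormD _ _) _; apply: (@le_trans _ _ (r0 + T * B + 1)); last by rewrite /rho le_max lexx orbT.
      by apply: lerD => //; exact: le_trans yX _.
    + apply: le_trans (w2_tri (fv k (ltnW kn)) (svalP (u (k%:R * h))) (svalP (u q))) _.
      rewrite w2_sym; apply: (@le_trans _ _ (c + c)).
        apply: lerD; first exact: w2c (ltnW kn).
        apply: unif => //; rewrite distrC ger0_norm ?subr_ge0//; apply: le_trans h3.
        by rewrite lerBlDl; move: (ltW q2); rewrite -natr1 mulrDl mul1r.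
      by rewrite [leRHS](splitr c1); apply: lerD; rewrite /c ge_min lexx.
    + by rewrite enormC; exact: le_trans yX _.
  rewrite add0r nh in hf.
  have f0 : f 0 = clip r0 x by have := fX 0%N (leq0n _); rewrite mul0r addr0.
  have fn : f t = euler W mu0 r0 h n x by have := fX n (leqnn _); rewrite add0r nh.
  have DD (q : R) : 0 <= q <= t -> enorm (f q - flow b T 0 (clip r0 x) q) <= D.
    move=> qt; apply: le_trans (enormD _ _) _; rewrite enormN; apply: lerD.
      apply: le_trans (approx_sol_bound B0 hf qt) _; rewrite f0 subr0 lerD2r; exact: clip_le.
    apply: le_trans (approx_sol_bound L0 (sol x) qt) _; rewrite flow_start subr0 lerD2r; exact: clip_le.
  have tt : 0 <= t <= t by rewrite lexx t0'.
  have := approx_sol_dist bmono (lexx 0) t0' tT' D0 DD hf (sol x) tt.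
  rewrite fn f0 flow_start subrr enorm0 expr0n/= add0r addr0 subr0 => hd; apply: le_trans hd _.
  rewrite mulrAC (mulrC _ e) /e mulrAC ler_pdivrMr ?ltr_wpDl// ler_wpM2l ?sqr_ge0//.
  by rewrite lerDl.
have [lX _ _ _] := hB h n h0 h1 (kT n (leqnn n)).
have wF : w2 (euler_law W mu0 r0 h n) nu <= eta / 2.
  rewrite -(@ler_pXn2r _ 2)// ?nnegrE ?w2_ge0 ?(ltW eta2)//; apply: w2_sqr_le.
  apply: le_trans (W2e_le lX lF) _.
  rewrite -[leRHS](integral_cst_probability mu0); apply: ge0_le_integral_EFin => //.
  - by apply: measurable_enorm_sqr_sub => //; case: lX.
  - by move=> x; exact: sqr_ge0.
have := w2_tri (svalP (u t)) (fv n (leqnn n)) fnu => /le_trans; apply.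
rewrite (splitr eta); apply: lerD => //.
have := w2c n (leqnn n); rewrite nh => /le_trans; apply.
by rewrite /c ge_min lexx orbT.
Qed.

Lemma flow_law t : 0 <= t <= T -> is_law mu0 (fun x : Rd => flow b T 0 x t : Rd) (sval (u t)).
Proof.
move=> tT.
have mF : measurable_fun setT (fun x : Rd => flow b T 0 x t : Rd).
  apply: measurable_coordP => i.
  have c : continuous (fun x => flow b T 0 x t 0 i).
    apply: (@lipschitz_continuousRd _ _ _ 1) => x y; rewrite mul1r -coordB.
    by apply: le_trans (coord_le _ _) _; exact: (flow_contract (ltW T0) bmono bbound bunif).
  exact: (continuous_measurableRd c).
exact: (is_law_transport mF (is_law_clip (is_law_id mu0) smu0) (is_law_id mu0) (flow_law_clip tT)).
Qed.

End flow_law.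

(** * Growth of functions with bounded weak gradient *)

Section spline.
Context {R : realType}.
Implicit Types (c e x y h z : R).

Let pos z : R := Num.max 0 z.
Let pp z := pos z ^+ 2.

(** A quadratic remainder valid across the kink gives the derivative at every point without separate
    cases at the nodes of the spline. *)
Let pp_quad z h : `|pp (z + h) - pp z - 2 * pos z * h| <= h ^+ 2.
Proof.
have posE a : (0 <= a /\ pos a = a) \/ (a < 0 /\ pos a = 0).
  by rewrite /pos; case: (leP 0 a) => h0; [left|right].
rewrite /pp ler_norml.
by case: (posE z) => -[z0 ->]; case: (posE (z + h)) => -[zh0 ->]; apply/andP; split; nra.
Qed.

(* A quadratic spline, rising from 0 to 1 on [c, c + 2e]; its derivative is the
   piecewise linear [hat]. *)
Definition step c e y : R := let z := (y - c) / e in 2^-1 * (pp z - 2 * pp (z - 1) + pp (z - 2)).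
Definition hat c e y : R := let z := (y - c) / e in e^-1 * (pos z - 2 * pos (z - 1) + pos (z - 2)).

Lemma step_quad c e x h : 0 < e -> `|step c e (x + h) - step c e x - hat c e x * h| <= 2 * (h / e) ^+ 2.
Proof.
move=> e0; rewrite /step /hat; set z := (x - c) / e.
have -> : (x + h - c) / e = z + h / e by rewrite /z addrAC mulrDl.
have q0 := pp_quad z (h / e); have q1 := pp_quad (z - 1) (h / e); have q2 := pp_quad (z - 2) (h / e).
rewrite !(addrAC z (h / e)).
have -> : e^-1 * (pos z - 2 * pos (z - 1) + pos (z - 2)) * h = (pos z - 2 * pos (z - 1) + pos (z - 2)) * (h / e).
  by ring.
move: q0 q1 q2; rewrite !ler_norml => /andP[a1 a2] /andP[b1 b2] /andP[c1 c2].
apply/andP; split; lra.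
Qed.

Let pos_cases a : (0 <= a /\ pos a = a) \/ (a < 0 /\ pos a = 0).
Proof. by rewrite /pos; case: (leP 0 a) => h0; [left|right]. Qed.

Lemma hat_ge0 c e y : 0 < e -> 0 <= hat c e y.
Proof.
move=> e0; apply: mulr_ge0; first by rewrite invr_ge0 ltW.
move: ((y - c) / e) => z.
by case: (pos_cases z) => -[z0 ->]; case: (pos_cases (z - 1)) => -[z1 ->]; case: (pos_cases (z - 2)) => -[z2 ->]; lra.
Qed.

Lemma hat_supp c e y : 0 < e -> ~~ (c <= y <= c + 2 * e) -> hat c e y = 0.
Proof.
move=> e0; rewrite negb_and -!ltNge => h; rewrite /hat.
suff -> : pos ((y - c) / e) - 2 * pos ((y - c) / e - 1) + pos ((y - c) / e - 2) = 0 by rewrite mulr0.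
case/orP: h => h.
  have : (y - c) / e < 0 by rewrite pmulr_llt0 ?invr_gt0// subr_lt0.
  move: (_ / e) => z z0.
  by case: (pos_cases z) => -[? ->]; case: (pos_cases (z - 1)) => -[? ->]; case: (pos_cases (z - 2)) => -[? ->]; lra.
have : 2 < (y - c) / e by rewrite ltr_pdivlMr// ltrBrDl.
move: (_ / e) => z z0.
by case: (pos_cases z) => -[? ->]; case: (pos_cases (z - 1)) => -[? ->]; case: (pos_cases (z - 2)) => -[? ->]; lra.
Qed.

Lemma step_lo c e y : 0 < e -> y <= c -> step c e y = 0.
Proof.
move=> e0 h; rewrite /step.
have : (y - c) / e <= 0 by rewrite pmulr_lle0 ?invr_gt0// subr_le0.
move: (_ / e) => z z0; rewrite /pp.
case: (pos_cases z) => -[? ->]; case: (pos_cases (z - 1)) => -[? ->]; case: (pos_cases (z - 2)) => -[? ->]; try lra.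
- have -> : z = 0 by lra.
  by rewrite !expr0n/=; lra.
Qed.

Lemma step_hi c e y : 0 < e -> c + 2 * e <= y -> step c e y = 1.
Proof.
move=> e0 h; rewrite /step.
have : 2 <= (y - c) / e by rewrite ler_pdivlMr// lerBrDl.
move: (_ / e) => z z0; rewrite /pp.
case: (pos_cases z) => -[? ->]; case: (pos_cases (z - 1)) => -[? ->]; case: (pos_cases (z - 2)) => -[? ->]; try lra.
Qed.

Lemma step_mid c e y : 0 < e -> c + e <= y -> 2^-1 <= step c e y.
Proof.
move=> e0 h; rewrite /step.
have : 1 <= (y - c) / e by rewrite ler_pdivlMr// mul1r lerBrDl.
move: (_ / e) => z z0; rewrite /pp.
case: (pos_cases z) => -[? ->]; case: (pos_cases (z - 1)) => -[? ->]; case: (pos_cases (z - 2)) => -[? ->]; try nra.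
Qed.

Lemma hat_continuous c e : continuous (hat c e).
Proof.
move=> y; rewrite /hat /pos.
have cz : {for y, continuous (fun y : R => (y - c) / e)}.
  by apply: cvgM; [apply: cvgB; [exact: cvg_id|exact: cvg_cst]|exact: cvg_cst].
have cm (f : R -> R) : {for y, continuous f} -> {for y, continuous (fun y => Num.max 0 (f y))}.
  by move=> cf; apply: (@continuous_max _ _ (fun=> 0) f); [exact: cst_continuous|exact: cf].
have cs k : {for y, continuous (fun y : R => (y - c) / e - k)}.
  by apply: cvgB => //; exact: cvg_cst.
apply: cvgM; first exact: cvg_cst.
apply: cvgD; last exact: cm (cs 2).
apply: cvgB; first exact: cm cz.
by apply: cvgM; [exact: cvg_cst|exact: cm (cs 1)].
Qed.

Lemma is_derive_quad (f : R -> R) (x l C : R) : (forall h, `|f (x + h) - f x - l * h| <= C * h ^+ 2) ->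
  is_derive x 1 f l.
Proof.
move=> hf.
have lim : h^-1 *: ((f \o shift x) (h *: 1) - f x) @[h --> 0^'] --> l.
  apply/(@cvgrPdist_le _ R^o) => eps eps0; near=> h.
  have h0 : h != 0 by near: h; exact: nbhs_dnbhs_neq.
  have hs : `|h| <= eps / (`|C| + 1).
    near: h; apply: dnbhs0_le; by rewrite divr_gt0// ltr_wpDl.
  have -> : l - h^-1 *: ((f \o shift x) (h *: 1) - f x) = - (h^-1 * (f (x + h) - f x - l * h)).
    rewrite /shift /= /GRing.scale/= mulr1 (addrC h x); field; exact: h0.
  rewrite normrN normrM normfV ler_pdivrMl ?normr_gt0//.
  apply: le_trans (hf h) _; rewrite -real_normK ?num_real// expr2 mulrA (mulrC C) -mulrA; apply: ler_wpM2l => //.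
  move: hs; rewrite ler_pdivlMr ?ltr_wpDl// mulrDr mulr1; have := normr_ge0 h; have := ler_norm C.
  move: `|h| `|C| => a b bC a0 ab; apply: le_trans ab; rewrite mulrC.
  by apply: le_trans (_ : a * b <= _); [exact: ler_wpM2l|rewrite lerDl].
by split; [exact: cvgP lim|exact: cvg_lim lim].
Unshelve. all: by end_near.
Qed.

Lemma step_derive c e x : 0 < e -> is_derive x 1 (step c e) (hat c e x).
Proof.
move=> e0; apply: (@is_derive_quad _ _ _ (2 / e ^+ 2)) => h.
by apply: le_trans (step_quad c x h e0) _; rewrite expr_div_n mulrA mulrAC.
Qed.

Lemma step_continuous c e : 0 < e -> continuous (step c e).
Proof.
move=> e0 x; apply: differentiable_continuous; apply/derivable1_diffP.
by have [] := step_derive c x e0.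
Qed.

Lemma step_le c e y y' : 0 < e -> y <= y' -> step c e y <= step c e y'.
Proof.
move=> e0 yy; have := @mean_value_le _ (fun z => - step c e z) y y' 0 yy.
rewrite mul0r opprK addrC subr_le0; apply.
  move=> t _ eps eps0.
  have := step_continuous e0 (c := c) (x := t) => /(@cvgrPdist_le _ R^o) /(_ _ eps0) /nbhs_ballP[r /= r0 hr].
  by exists r => // q _ qt; rewrite opprK addrC; apply: hr; rewrite /ball/= distrC.
move=> t _ eps eps0; exists (eps * e ^+ 2 / 2); first by rewrite !mulr_gt0// exprn_gt0.
move=> q /andP[tq]; rewrite -ltrBlDl => qr _.
have := step_quad c t (q - t) e0; rewrite (_ : t + (q - t) = q) ?ler_norml => [/andP[h1 _]|]; last by rewrite addrC subrK.
have qt : 0 <= q - t by rewrite subr_ge0 ltW.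
have h2 := mulr_ge0 (hat_ge0 c t e0) qt.
rewrite opprK addrC add0r.
have h3 : 2 * ((q - t) / e) ^+ 2 <= eps * (q - t).
  rewrite expr_div_n mulrA ler_pdivrMr ?exprn_gt0// (expr2 (q - t)) mulrA -(mulrA eps) (mulrC (q - t) (e ^+ 2)) mulrA.
  by apply: ler_wpM2r => //; rewrite -ler_pdivlMl// mulrC ltW.
lra.
Qed.

Lemma step_01 c e y : 0 < e -> 0 <= step c e y <= 1.
Proof.
move=> e0; apply/andP; split.
  have [h|h] := leP y c; first by rewrite step_lo.
  by rewrite -(step_lo e0 (lexx c)); apply: step_le => //; exact: ltW.
have [h|h] := leP (c + 2 * e) y; first by rewrite step_hi.
by rewrite -(step_hi e0 (lexx (c + 2 * e))); apply: step_le => //; exact: ltW.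
Qed.

Lemma compact_support_integral (f : R -> R) a b : continuous f ->
  (forall y, ~~ (a <= y <= b) -> f y = 0) ->
  lebesgue_measure.-integrable setT (EFin \o f) /\
  \int[lebesgue_measure]_y f y = \int[lebesgue_measure]_(y in `[a, b]) f y.
Proof.
move=> cf sf.
have E : f \_ `[a, b] = f.
  by apply/funext => y; rewrite patchE; case: ifPn => //; rewrite notin_setE/= in_itv/= => /negP/sf.
have EE : (EFin \o f) \_ `[a, b] = EFin \o f.
  by apply/funext => y; rewrite patchE; case: ifPn => //; rewrite notin_setE/= in_itv/= => /negP/sf ->.
have Ey y : (f \_ `[a, b]) y = f y by rewrite E.
split; last by rewrite [RHS]Rintegral_mkcond; apply: eq_Rintegral => y _; exact/esym/Ey.
rewrite -EE -integrable_mkcond//; apply: continuous_compact_integrable; first exact: segment_compact.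
by apply: continuous_subspaceT => y; exact: cf.
Qed.

Lemma hat_integral c e : 0 < e -> lebesgue_measure.-integrable setT (EFin \o hat c e) /\
  \int[lebesgue_measure]_y hat c e y = 1.
Proof.
move=> e0; have [ih ->] := compact_support_integral (@hat_continuous c e) (fun y => @hat_supp c e y e0).
split => //.
have cc : c < c + 2 * e by rewrite ltrDl mulr_gt0.
rewrite /Rintegral (@continuous_FTC2 _ (hat c e) (step c e))//.
- by rewrite (step_lo e0 (lexx c)) (step_hi e0 (lexx _)) sube0.
- by apply: continuous_subspaceT => y; exact: hat_continuous.
- split.
  + by move=> y _; have [] := step_derive c y e0.
  + exact: cvg_at_right_filter (step_continuous e0 (c := c) (x := c)).
  + exact: cvg_at_left_filter (step_continuous e0 (c := c) (x := c + 2 * e)).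
- by move=> y _; rewrite derive1E; have [] := step_derive c y e0.
Qed.

End spline.

Section C1_products.
Context {R : realType} {d : nat}.
Implicit Types (G H : 'rV[R]_d -> R) (x v : 'rV[R]_d).

Lemma C1_mul G H : C1_on setT G -> C1_on setT H -> C1_on setT (fun x => G x * H x).
Proof.
move=> [dG cG] [dH cH]; split; first by move=> x _; apply: differentiableM; [exact: dG|exact: dH].
move=> v x _.
rewrite (_ : 'D_v (fun x => G x * H x) = (fun x => G x * 'D_v H x + H x * 'D_v G x)); last first.
  by apply/funext => y; rewrite deriveM//; apply: diff_derivable; [exact: dG|exact: dH].
have cGx : {for x, continuous G} by apply: differentiable_continuous; exact: dG.
have cHx : {for x, continuous H} by apply: differentiable_continuous; exact: dH.
have h1 : {for x, continuous (fun y => G y * 'D_v H y)} by apply: continuousM; [exact: cGx|exact: cH].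
have h2 : {for x, continuous (fun y => H y * 'D_v G y)} by apply: continuousM; [exact: cHx|exact: cG].
exact: continuousD h1 h2.
Qed.

Lemma C1_cst (c : R) : C1_on setT (fun _ : 'rV[R]_d => c).
Proof.
split; first by move=> x _; exact: differentiable_cst.
move=> v x _; rewrite (_ : 'D_v _ = cst 0); first exact: cst_continuous.
by apply/funext => y; rewrite derive_cst.
Qed.

Lemma derive_coord_comp (f : R -> R) (l : R) x v (j : 'I_d) : is_derive (x 0 j) 1 f l ->
  'D_v (fun x : 'rV[R]_d => f (x 0 j)) x = l * v 0 j.
Proof.
move=> [df fl]; have df' : differentiable f (x 0 j) by apply/derivable1_diffP.
have dc := @differentiable_coord R 1 d x 0 j.
rewrite deriveE; last exact: (differentiable_comp dc df').
rewrite (diff_comp dc df') /=.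
rewrite (diff1E df') /= derive1E fl -deriveE//.
rewrite (_ : 'D_v _ x = v 0 j); first by rewrite /GRing.scale/= mulrC.
rewrite /derive; apply: cvg_lim => //; apply: (@cvg_near_cst _ _ (v 0 j)).
near=> h; have h0 : h != 0 by near: h; exact: nbhs_dnbhs_neq.
by rewrite /= !mxE addrK /GRing.scale/= mulKf.
Unshelve. all: by end_near.
Qed.

Lemma C1_coord (f f' : R -> R) (j : 'I_d) : (forall t : R, is_derive t 1 f (f' t)) -> continuous f' ->
  C1_on setT (fun x : 'rV[R]_d => f (x 0 j)).
Proof.
move=> hf cf'; split.
  move=> x _; have dc := @differentiable_coord R 1 d x 0 j.
  by apply: (differentiable_comp dc); apply/derivable1_diffP; have [] := hf (x 0 j).
move=> v x _; rewrite (_ : 'D_v _ = (fun x => f' (x 0 j) * v 0 j)); last first.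
  by apply/funext => y; exact: derive_coord_comp.
have h1 : {for x, continuous (fun y : 'rV[R]_d => f' (y 0 j))}.
  by apply: continuous_comp; [exact: coord_continuous|exact: cf'].
have h2 : {for x, continuous (fun _ : 'rV[R]_d => v 0 j)} by exact: cst_continuous.
exact: continuousM h1 h2.
Qed.

Lemma C1_prod (S : seq 'I_d) (F F' : 'I_d -> R -> R) : (forall j (t : R), is_derive t 1 (F j) (F' j t)) ->
  (forall j, continuous (F' j)) -> C1_on setT (fun x : 'rV[R]_d => \prod_(j <- S) F j (x 0 j)).
Proof.
move=> hF cF'; elim: S => [|j S IH].
  rewrite (_ : (fun x => _) = (fun=> 1)); first exact: C1_cst.
  by apply/funext => x; rewrite big_nil.
rewrite (_ : (fun x => _) = (fun x => F j (x 0 j) * \prod_(j <- S) F j (x 0 j))); last first.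
  by apply/funext => x; rewrite big_cons.
exact: (C1_mul (C1_coord j (hF j) (cF' j)) IH).
Qed.

Lemma derive_invariant G x v : (forall h, G (h *: v + x) = G x) -> 'D_v G x = 0.
Proof.
move=> hG; rewrite /derive (_ : (fun h => _) = cst 0); first exact: lim_cst.
by apply/funext => h; rewrite /= hG subrr scaler0.
Qed.

Lemma grad_prod (F F' : 'I_d -> R -> R) x (i : 'I_d) : (forall j (t : R), is_derive t 1 (F j) (F' j t)) ->
  (forall j, continuous (F' j)) ->
  grad (fun x : 'rV[R]_d => \prod_j F j (x 0 j)) x 0 i = F' i (x 0 i) * \prod_(j | j != i) F j (x 0 j).
Proof.
move=> hF cF'; rewrite mxE.
pose G y := F i ((y : 'rV[R]_d) 0 i); pose H y := \prod_(j | j != i) F j ((y : 'rV[R]_d) 0 j).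
rewrite (_ : (fun x => _) = (fun x => G x * H x)); last by apply/funext => y; rewrite (bigD1 i).
have [dG _] := C1_coord i (hF i) (cF' i).
have dH : differentiable H x.
  rewrite (_ : H = fun y => \prod_(j <- [seq j <- index_enum 'I_d | j != i]) F j ((y : 'rV[R]_d) 0 j)).
    by have [h _] := C1_prod [seq j <- index_enum 'I_d | j != i] hF cF'; exact: h.
  by apply/funext => y; rewrite big_filter.
rewrite deriveM; [|exact: diff_derivable (dG x _)|exact: diff_derivable].
rewrite (_ : 'D_(delta_mx 0 i) H x = 0) ?scaler0 ?add0r; last first.
  apply: derive_invariant => h; apply: eq_bigr => j ji.
  by rewrite !mxE eqxx (negbTE ji)/= mulr0 add0r.
by rewrite (derive_coord_comp _ (hF i (x 0 i))) mxE !eqxx mulr1 /GRing.scale/= mulrC.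
Qed.

Lemma compact_box (r : R) : compact [set x : 'rV[R]_d | enorm x <= r].
Proof.
apply: bounded_closed_compact.
  exists r; split; first exact: num_real.
  by move=> M rM x /= xr; apply: le_trans (mx_norm_le_enorm x) _; exact: le_trans xr (ltW rM).
rewrite (_ : [set x | _] = (@enorm R d) @^-1` [set y | y <= r])//.
by apply: preimage_closed; [move=> x _; exact: continuous_enorm|exact: closed_le].
Qed.

End C1_products.

Section boxed_integral.
Context {R : realType}.
Local Notation leb := (@lebesgue_measure R).

Definition boxed (r M : R) (f : R -> R) :=
  (forall t, `|f t| <= M) /\ (forall t, ~~ (- r <= t <= r) -> f t = 0).

(* Monotonicity without measurability: the integrands below involve a field that
   is only known to be measurable as a function of all the variables. *)
Lemma ge0_integral_mono d0 (T : measurableType d0) (mu : {measure set T -> \bar R}) (f g : T -> \bar R) :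
  (forall t, 0 <= f t)%E -> (forall t, f t <= g t)%E -> (\int[mu]_t f t <= \int[mu]_t g t)%E.
Proof.
move=> f0 fg; rewrite !ge0_integralTE//; last by move=> t; exact: le_trans (f0 t) (fg t).
by apply: ge_ereal_sup => _ [h hf <-]; apply: ereal_sup_ubound; exists h => // t; exact: le_trans (hf t) (fg t).
Qed.

Lemma boxed_integral_le r M (h : R -> \bar R) : 0 <= r -> 0 <= M -> (forall t, 0 <= h t)%E ->
  (forall t, h t <= M%:E)%E -> (forall t : R, ~~ (- r <= t <= r) -> h t = 0%E) ->
  (\int[leb]_t h t <= (M * (2 * r))%:E)%E.
Proof.
move=> r0 M0 h0 hM hr.
pose A : set R := `[(- r), r]%classic.
have le : (\int[leb]_(t in A) (cst M%:E t) <= (M * (2 * r))%:E)%E.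
  rewrite integral_cst//; last exact: measurable_itv.
  rewrite [X in (_ * X)%E](_ : _ = lebesgue_measure A)// /A lebesgue_measure_itv/= lte_fin.
  by case: ifP => _; rewrite ?mule0 -?EFinB -?EFinM lee_fin ?mulr_ge0//; lra.
apply: le_trans le; rewrite [leRHS]integral_mkcond; apply: ge0_integral_mono => // t.
rewrite patchE; case: ifPn => //; rewrite notin_setE /A/= in_itv/= => /negP ht.
by rewrite hr.
Qed.

(** The integrals of the positive and negative parts lie between 0 and 2 r M by monotonicity of the
    extended integral. They are therefore finite, and monotonicity descends to the real-valued
    integral. *)
Lemma boxed_Rintegral r M f : 0 <= r -> boxed r M f ->
  `|\int[leb]_t f t| <= M * (2 * r) /\
  forall g, boxed r M g -> (forall t, f t <= g t) -> \int[leb]_t f t <= \int[leb]_t g t.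
Proof.
move=> r0 bf; have M0 : 0 <= M by have [h _] := bf; exact: le_trans (normr_ge0 _) (h 0).
have pos h : boxed r M h -> (0 <= \int[leb]_t (EFin \o h)^\+ t <= (M * (2 * r))%:E)%E.
  move=> [hM hr]; apply/andP; split; first by apply: integral_ge0 => t _; exact: funepos_ge0.
  apply: boxed_integral_le => //.
  - move=> t; rewrite funeposE /= ge_max !lee_fin M0 andbT; exact: le_trans (ler_norm _) (hM t).
  - by move=> t /hr ht; rewrite funeposE /= ht maxxx.
have neg h : boxed r M h -> (0 <= \int[leb]_t (EFin \o h)^\- t <= (M * (2 * r))%:E)%E.
  move=> [hM hr]; apply/andP; split; first by apply: integral_ge0 => t _; exact: funeneg_ge0.
  apply: boxed_integral_le => //.
  - move=> t; rewrite funenegE /= ge_max !lee_fin M0 andbT.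
    by apply: le_trans (ler_norm _) _; rewrite normrN.
  - by move=> t /hr ht; rewrite funenegE /= ht oppr0 maxxx.
have fin (a : \bar R) (c : R) : (0 <= a <= c%:E -> a \is a fin_num)%E.
  by move=> /andP[a0 ac]; rewrite ge0_fin_numE//; apply: le_lt_trans ac (ltry _).
have E h : boxed r M h -> \int[leb]_t h t = fine (\int[leb]_t (EFin \o h)^\+ t) - fine (\int[leb]_t (EFin \o h)^\- t).
  by move=> bh; rewrite /Rintegral integralE fineB//; [exact: fin (pos h bh)|exact: fin (neg h bh)].
split.
  have b (a : \bar R) (c : R) : (0 <= a <= c%:E)%E -> 0 <= fine a <= c.
    move=> h; have /andP[a0 ac] := h; rewrite fine_ge0//= -lee_fin fineK//; exact: fin h.
  rewrite E// ler_norml; have /andP[p1 p2] := b _ _ (pos f bf); have /andP[n1 n2] := b _ _ (neg f bf).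
  by apply/andP; split; lra.
move=> g bg fg; rewrite !E//; apply: lerB; apply: fine_le.
- exact: fin (pos f bf).
- exact: fin (pos g bg).
- apply: ge0_integral_mono => t; first exact: funepos_ge0.
  by rewrite !funeposE /= -!EFin_max lee_fin ge_max !le_max lexx fg !orbT.
- exact: fin (neg g bg).
- exact: fin (neg f bf).
- apply: ge0_integral_mono => t; first exact: funeneg_ge0.
  by rewrite !funenegE /= -!EFin_max lee_fin ge_max !le_max lexx lerN2 fg !orbT.
Qed.

Definition boxed_Rd (r M : R) d (f : 'rV[R]_d -> R) :=
  (forall x, `|f x| <= M) /\ (forall (x : 'rV[R]_d) (i : 'I_d), ~~ (- r <= x 0 i <= r) -> f x = 0).

Lemma row_mx_coord d (t : R) (y : 'rV[R]_d) :
  ((row_mx (t%:M : 'rV[R]_1) y : 'rV[R]_d.+1) 0 ord0 = t) *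
  (forall j, (row_mx (t%:M : 'rV[R]_1) y : 'rV[R]_d.+1) 0 (lift ord0 j) = y 0 j).
Proof.
split=> [|j].
  rewrite (_ : ord0 = lshift d (ord0 : 'I_1)); last exact/val_inj.
  by rewrite (@row_mxEl _ 1 1 d) mxE eqxx.
rewrite (_ : lift ord0 j = rshift 1 j); last exact/val_inj.
by rewrite (@row_mxEr _ 1 1 d).
Qed.

Lemma integral_Rd_boxed r M d (f : 'rV[R]_d -> R) : 0 <= r -> boxed_Rd r M f ->
  `|integral_Rd f| <= M * (2 * r) ^+ d /\
  forall g, boxed_Rd r M g -> (forall x, f x <= g x) -> integral_Rd f <= integral_Rd g.
Proof.
move=> r0; elim: d f M => [|d IH] f M bf /=.
  by rewrite expr0 mulr1; split=> [|g _ fg //]; have [h _] := bf; exact: h.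
pose sec (f : 'rV[R]_d.+1 -> R) t := fun y : 'rV[R]_d => f (row_mx (t%:M : 'rV[R]_1) y).
have bsec g t : boxed_Rd r M g -> boxed_Rd r M (sec g t).
  move=> [h1 h2]; split=> [y|y j hy]; first exact: h1.
  by apply: (h2 _ (lift ord0 j)); rewrite (row_mx_coord t y).2.
have zsec g t : boxed_Rd r M g -> ~~ (- r <= t <= r) -> integral_Rd (sec g t) = 0.
  move=> [h1 h2] ht.
  have b0 : boxed_Rd r 0 (sec g t).
    have z y : sec g t y = 0 by apply: (h2 _ ord0); rewrite (row_mx_coord t y).1.
    by split=> [y|y j _]; rewrite z// normr0.
  have [+ _] := IH _ _ b0; rewrite mul0r normr_le0 => /eqP; exact.
have bI g : boxed_Rd r M g -> boxed r (M * (2 * r) ^+ d) (fun t => integral_Rd (sec g t)).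
  move=> bg; split=> t; last exact: zsec.
  by have [] := IH _ _ (bsec g t bg).
split.
  have [h1 _] := boxed_Rintegral r0 (bI f bf).
  by rewrite exprS (mulrC (2 * r)) mulrA.
move=> g bg fg; have [_ h] := boxed_Rintegral r0 (bI f bf); apply: h; first exact: bI.
by move=> t; have [_ h] := IH _ _ (bsec f t bf); apply: h => [|y]; [exact: bsec|exact: fg].
Qed.

Lemma integral_Rd_prod d (F : 'I_d -> R -> R) (c : R) :
  (forall i, leb.-integrable setT (EFin \o F i)) ->
  integral_Rd (fun x : 'rV[R]_d => c * \prod_i F i (x 0 i)) = c * \prod_i \int[leb]_t F i t.
Proof.
elim: d F c => [|d IH] F c iF /=; first by rewrite !big_ord0.
rewrite big_ord_recl mulrA -RintegralZl// -RintegralZr//; last first.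
  rewrite (_ : EFin \o _ = (fun t => c%:E * (EFin \o F ord0) t)%E); last exact/funext.
  exact: integrableZl.
apply: eq_Rintegral => t _; rewrite -IH//; congr integral_Rd.
apply/funext => y; rewrite big_ord_recl mulrA; have [e0 eS] := row_mx_coord t y.
congr (c * F ord0 _ * _); first exact: e0.
by apply: eq_bigr => j _; congr (F _ _); exact: eS.
Qed.

End boxed_integral.

Section growth.
Context {R : realType} {d : nat}.
Local Notation leb := (@lebesgue_measure R).

Lemma hat_le (c e y : R) : 0 < e -> hat c e y <= e^-1.
Proof.
move=> e0; rewrite /hat -[leRHS]mulr1; apply: ler_wpM2l; first by rewrite invr_ge0 ltW.
move: ((y - c) / e) => z.
have pos_cases (a : R) : (0 <= a /\ Num.max 0 a = a) \/ (a < 0 /\ Num.max 0 a = 0).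
  by case: (leP 0 a) => h0; [left|right].
by case: (pos_cases z) => -[? ->]; case: (pos_cases (z - 1)) => -[? ->]; case: (pos_cases (z - 2)) => -[? ->]; lra.
Qed.

(** Its derivative is a unit mass near c minus a unit mass near c + w: a weak derivative tested with
    it compares the values at two points at distance w. *)
Definition bump (c w e y : R) := step c e y - step (c + w) e y.

Lemma bump_supp c w e y : 0 < e -> 0 <= w -> ~~ (c <= y <= c + w + 2 * e) -> bump c w e y = 0.
Proof.
move=> e0 w0; rewrite negb_and -!ltNge /bump => /orP[h|h].
  by rewrite !step_lo ?subrr// ?ltW//; lra.
by rewrite !step_hi ?subrr//; lra.
Qed.

Lemma bump_01 c w e y : 0 < e -> 0 <= w -> 0 <= bump c w e y <= 1.
Proof.
move=> e0 w0; have /andP[a1 a2] := step_01 c y e0; have /andP[b1 b2] := step_01 (c + w) y e0.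
rewrite /bump; apply/andP; split; last by lra.
have [yc|cy] := leP y (c + w); first by rewrite (step_lo e0 yc) subr0.
have -> : step (c + w) e y = step c e (y - w).
  by rewrite /step opprD addrA addrAC.
by rewrite subr_ge0; apply: step_le => //; lra.
Qed.

Lemma bump_continuous c w e : 0 < e -> continuous (bump c w e).
Proof. by move=> e0 y; apply: cvgB; exact: step_continuous. Qed.

Lemma bump_derive c w e (y : R) : 0 < e -> is_derive y 1 (bump c w e) (hat c e y - hat (c + w) e y).
Proof. by move=> e0; apply: is_deriveB; exact: step_derive. Qed.

Lemma itv_bounds (f : R -> R) a b k : a <= b -> continuous f ->
  ((forall y, a <= y <= b -> f y <= k) -> \int[leb]_(y in `[a, b]) f y <= k * (b - a)) /\
  ((forall y, a <= y <= b -> k <= f y) -> k * (b - a) <= \int[leb]_(y in `[a, b]) f y).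
Proof.
move=> ab cf; have mA : measurable (`[a, b]%classic : set (measurableTypeR R)) by exact: measurable_itv.
have intg (h : R -> R) : continuous h -> leb.-integrable `[a, b] (EFin \o h).
  move=> ch; apply: continuous_compact_integrable; first exact: segment_compact.
  by apply: continuous_subspaceT => y; exact: ch.
have ck : continuous (fun _ : R => k) by move=> y; exact: cst_continuous.
have cst1 : \int[leb]_(y in `[a, b]) k = k * (b - a).
  rewrite Rintegral_cst//; congr (_ * _).
  rewrite [X in fine X](_ : _ = lebesgue_measure `[a, b])// lebesgue_measure_itv/= lte_fin.
  by case: ifP => [_|/negbT]; [rewrite -EFinB|rewrite -leNgt /= => ba; lra].
split=> h; rewrite -cst1; apply: le_Rintegral mA _ _ _; try exact: intg;
  by move=> y /=; rewrite in_itv/=; exact: h.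
Qed.

Lemma bump_integral c w e : 0 < e -> 0 <= w ->
  leb.-integrable setT (EFin \o bump c w e) /\ \int[leb]_y bump c w e y <= w + 2 * e.
Proof.
move=> e0 w0.
have [ib Ib] := @compact_support_integral _ (bump c w e) c (c + w + 2 * e)
  (@bump_continuous c w e e0) (fun y => @bump_supp c w e y e0 w0).
split => //; rewrite Ib.
have ab : c <= c + w + 2 * e by lra.
have [h _] := itv_bounds 1 ab (@bump_continuous c w e e0).
rewrite (_ : w + 2 * e = 1 * (c + w + 2 * e - c)); last by ring.
by apply: h => y _; have /andP[] := @bump_01 c w e y e0 w0.
Qed.

Lemma bump_integral_gt0 c e : 0 < e -> 0 < \int[leb]_y bump c (2 * e) e y.
Proof.
move=> e0; have w0 : 0 <= 2 * e by rewrite mulr_ge0// ltW.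
have [ib _] := bump_integral c e0 w0.
have ab : c + e <= c + 2 * e by lra.
have mA : measurable (`[c + e, c + 2 * e]%classic : set (measurableTypeR R)) by exact: measurable_itv.
have [_ h] := itv_bounds 2^-1 ab (@bump_continuous c (2 * e) e e0).
have {}h : 2^-1 * e <= \int[leb]_(y in `[c + e, c + 2 * e]) bump c (2 * e) e y.
  rewrite (_ : 2^-1 * e = 2^-1 * (c + 2 * e - (c + e))); last by ring.
  by apply: h => y /andP[y1 y2]; rewrite /bump (step_lo e0 y2) subr0; exact: step_mid.
apply: (@lt_le_trans _ _ (2^-1 * e)); first by rewrite mulr_gt0.
apply: le_trans h _; apply: fine_le.
- by apply: integrable_fin_num => //; exact: integrableS ib.
- exact: integrable_fin_num.
- apply: ge0_subset_integral => //; first exact: (measurable_int _ ib).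
  by move=> y _; rewrite lee_fin; have /andP[] := @bump_01 c (2 * e) e y e0 w0.
Qed.

(** With [m] the mass of the bumps in the other directions, the test gives (psi x - psi y2) m up to
    2 m on one side, by continuity of [psi], and at most C (t + 2) m on the other. The factor [m] is
    positive and cancels; the additive constants are harmless for linear growth. *)
Lemma bounded_gradient_increment (psi : 'rV[R]_d -> R) (g : 'rV[R]_d -> 'rV[R]_d) (C : R) x (i : 'I_d) t :
  continuous psi -> (forall x, enorm (g x) <= C) -> is_weak_gradient psi g -> 0 <= t ->
  `|psi (x + t *: delta_mx 0 i) - psi x| <= C * (t + 2) + 2.
Proof.
move=> cpsi gC wg t0; set y2 := x + _.
have C0 : 0 <= C := le_trans (enorm_ge0 _) (gC x).
have near y : exists2 r, 0 < r & forall z, enorm (y - z) < r -> `|psi z - psi y| <= 1.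
  have := cpsi y => /(@cvgrPdist_le _ R^o _ (nbhs y) (nbhs_filter y)) /(_ _ ltr01) /nbhs_enormP[r r0 hr].
  by exists r => // z /hr; rewrite distrC.
have [r1 r10 h1] := near x; have [r2 r20 h2] := near y2.
(* The supports of the two masses deviate by at most 4 e in each coordinate, hence lie where [psi]
   is within 1 of its value at [x], respectively at [y2]. *)
pose e : R := Order.min 1 (Order.min r1 r2 / (4 * d%:R + 1)).
have D0 : 0 < 4 * d%:R + 1 :> R by rewrite ltr_wpDl// mulr_ge0.
have rr0 : 0 < Order.min r1 r2 by rewrite lt_min r10.
have e0 : 0 < e by rewrite lt_min ltr01 divr_gt0.
have e1 : e <= 1 by rewrite ge_min lexx.
have er : d%:R * (4 * e) < Order.min r1 r2.
  have : e * (4 * d%:R + 1) <= Order.min r1 r2 by rewrite -ler_pdivlMr// ge_min lexx orbT.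
  by move: e0; move: (Order.min r1 r2) d%:R => q n; lra.
have w0 : 0 <= 2 * e by rewrite mulr_ge0// ltW.
(* In direction i the bump spans the increment. In the others a width of 2 e makes its mass positive
   while its support stays small. *)
pose w j := if j == i then t else 2 * e.
have wj j : 0 <= w j by rewrite /w; case: ifP.
pose F j := bump (x 0 j) (w j) e.
pose F' j y := hat (x 0 j) e y - hat (x 0 j + w j) e y.
have dF j (y : R) : is_derive y 1 (F j) (F' j y) by exact: bump_derive.
have cF' j : continuous (F' j) by move=> y; apply: cvgB; exact: hat_continuous.
pose phi (z : 'rV[R]_d) := \prod_j F j (z 0 j).
pose b (z : 'rV[R]_d) := \prod_(j | j != i) F j (z 0 j).
have F01 j y : 0 <= F j y <= 1 by exact: bump_01.
have b01 z : 0 <= b z <= 1.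
  rewrite prodr_ge0 => [|j _]; last by have /andP[] := F01 j (z 0 j).
  by apply: prodr_ile1 => j _; exact: F01.
have phi01 z : 0 <= phi z <= 1.
  rewrite prodr_ge0 => [|j _]; last by have /andP[] := F01 j (z 0 j).
  by apply: prodr_ile1 => j _; exact: F01.
pose rho := enorm x + t + 4 * e.
have rho0 : 0 <= rho by rewrite !addr_ge0 ?enorm_ge0// mulr_ge0// ltW.
have xj j : - enorm x <= x 0 j <= enorm x by rewrite -ler_norml; exact: coord_le.
have out j y : ~~ (- rho <= y <= rho) -> [/\ F j y = 0, hat (x 0 j) e y = 0 & hat (x 0 j + w j) e y = 0].
  move=> hy; have out' (a q : R) : - enorm x <= a -> a + q <= rho -> ~~ (a <= y <= a + q).
    move=> ha hq; apply: contra hy => /andP[q1 q2]; rewrite (le_trans q2 hq) andbT (le_trans _ q1)// (le_trans _ ha)//.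
    by rewrite /rho; lra.
  have /andP[x1 x2] := xj j; have wle : w j <= t + 2 * e by rewrite /w; case: ifP => _; clear -e0 t0; lra.
  have wj0 := wj j.
  split; [apply: bump_supp => //; rewrite -addrA|apply: hat_supp => //|apply: hat_supp => //]; apply: out'; rewrite /rho; clear -x1 x2 wle wj0 t0 e0; lra.
have phiC : C1_compact phi.
  split; first exact: C1_prod.
  exists [set z | enorm z <= d%:R * rho]; first exact: compact_box.
  move=> z /= hz; have [j hj] : exists j, ~ (`|z 0 j| <= rho).
    by apply/existsNP => h; apply: hz; exact: enorm_le_bound.
  rewrite /phi (bigD1 j)//=; have [|-> _ _] := out j (z 0 j); last by rewrite mul0r.
  by rewrite -ler_norml; exact/negP.
have gradphi z : grad phi z 0 i = (hat (x 0 i) e (z 0 i) - hat (x 0 i + t) e (z 0 i)) * b z.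
  by rewrite grad_prod// /F' /w eqxx.
have zero_out (z : 'rV[R]_d) j : ~~ (- rho <= z 0 j <= rho) -> phi z = 0 /\
   (hat (x 0 i) e (z 0 i) * b z = 0 /\ hat (x 0 i + t) e (z 0 i) * b z = 0).
  move=> /[dup] hj /(out j)[Fj hj1 hj2]; split; first by rewrite /phi (bigD1 j)//= Fj mul0r.
  have [ji|ji] := eqVneq j i.
    by rewrite -ji hj1 mul0r; move: hj2; rewrite /w ji eqxx => ->; rewrite mul0r.
  by rewrite /b (bigD1 j)//= Fj mul0r !mulr0.
pose H1 (z : 'rV[R]_d) := hat (x 0 i) e (z 0 i) * b z; pose H2 (z : 'rV[R]_d) := hat (x 0 i + t) e (z 0 i) * b z.
have H01 z : 0 <= H1 z <= e^-1 /\ 0 <= H2 z <= e^-1.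
  have /andP[b0 b1] := b01 z; have ei : 0 <= e^-1 by rewrite invr_ge0 ltW.
  have q c : 0 <= hat c e (z 0 i) * b z <= e^-1.
    rewrite mulr_ge0 ?hat_ge0//= -[leRHS]mulr1; apply: ler_pM => //; [exact: hat_ge0|exact: hat_le].
  by split; exact: q.
have near_supp (c : R) (y z : 'rV[R]_d) : y 0 i = c -> (forall j, j != i -> y 0 j = x 0 j) ->
    hat c e (z 0 i) * b z != 0 -> enorm (y - z) < Order.min r1 r2.
  move=> yi yj; rewrite mulf_eq0 negb_or => /andP[hc hb]; apply: le_lt_trans er.
  apply: enorm_le_bound => j; rewrite coordB distrC ler_norml.
  have [->|ji] := eqVneq j i.
    have : c <= z 0 i <= c + 2 * e by apply: contraNT hc => h; apply/eqP; exact: hat_supp.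
    by rewrite -yi; move: (z 0 i) (y 0 i) e0 => p q; lra.
  have Fj : F j (z 0 j) != 0.
    by apply: contraNneq hb => Fj; rewrite /b (bigD1 j)//= Fj mul0r.
  have : x 0 j <= z 0 j <= x 0 j + w j + 2 * e by apply: contraNT Fj => h; apply/eqP; exact: bump_supp.
  by rewrite /w (negbTE ji) (yj j ji); move: (z 0 j) (x 0 j) e0 => p q; lra.
have y2i : y2 0 i = x 0 i + t by rewrite /y2 !mxE !eqxx mulr1.
have y2j j : j != i -> y2 0 j = x 0 j by move=> ji; rewrite /y2 !mxE eqxx (negbTE ji)/= mulr0 addr0.
have psi1 z : (psi x - 1) * H1 z <= psi z * H1 z <= (psi x + 1) * H1 z.
  have [/andP[H10 _] _] := H01 z; have [->|Hn] := eqVneq (H1 z) 0; first by rewrite !mulr0 lexx.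
  have /h1 : enorm (x - z) < r1.
    by have := @near_supp _ x z erefl (fun j _ => erefl) Hn; rewrite lt_min => /andP[].
  by rewrite ler_norml => /andP[p1 p2]; apply/andP; split; apply: ler_wpM2r => //; clear -p1 p2; lra.
have psi2 z : (psi y2 - 1) * H2 z <= psi z * H2 z <= (psi y2 + 1) * H2 z.
  have [_ /andP[H20 _]] := H01 z; have [->|Hn] := eqVneq (H2 z) 0; first by rewrite !mulr0 lexx.
  have /h2 : enorm (y2 - z) < r2.
    by have := @near_supp _ y2 z y2i y2j Hn; rewrite lt_min => /andP[].
  by rewrite ler_norml => /andP[p1 p2]; apply/andP; split; apply: ler_wpM2r => //; clear -p1 p2; lra.
pose M := (`|psi x| + 1) * e^-1 + (`|psi y2| + 1) * e^-1.
have boxH (u : 'rV[R]_d -> R) : (forall z, exists p q, [/\ u z = p - q,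
     - ((`|psi x| + 1) * H1 z) <= p <= (`|psi x| + 1) * H1 z & - ((`|psi y2| + 1) * H2 z) <= q <= (`|psi y2| + 1) * H2 z]) ->
    boxed_Rd rho M u.
  move=> hu; split=> [z|z j hz].
    have [p [q [-> p12 q12]]] := hu z; have [/andP[H10 H11] /andP[H20 H21]] := H01 z.
    apply: le_trans (ler_normB _ _) _; apply: lerD; [move: p12|move: q12]; rewrite -ler_norml => /le_trans; apply; by apply: ler_wpM2l => //; rewrite addr_ge0.
  have [p [q [-> p12 q12]]] := hu z; have [_ [z1 z2]] := zero_out z j hz.
  by move: p12 q12; rewrite /H1 /H2 z1 z2 !mulr0 oppr0 -!eq_le => /eqP <- /eqP <-; rewrite subrr.
have nx := ler_norm (psi x); have nx' := ler_norm (- psi x); rewrite normrN in nx'.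
have ny := ler_norm (psi y2); have ny' := ler_norm (- psi y2); rewrite normrN in ny'.
have boxpsi : boxed_Rd rho M (fun z => psi z * grad phi z 0 i).
  apply: boxH => z; exists (psi z * H1 z), (psi z * H2 z); have [/andP[H10 _] /andP[H20 _]] := H01 z.
  have /andP[p1 p2] := psi1 z; have /andP[q1 q2] := psi2 z.
  split; first by rewrite gradphi /H1 /H2; ring.
    rewrite (le_trans _ p1) ?(le_trans p2) -?mulNr//; apply: ler_wpM2r => //; clear -nx nx'; lra.
  rewrite (le_trans _ q1) ?(le_trans q2) -?mulNr//; apply: ler_wpM2r => //; clear -ny ny'; lra.
have boxlin a1 a2 : `|a1| <= `|psi x| + 1 -> `|a2| <= `|psi y2| + 1 -> boxed_Rd rho M (fun z => a1 * H1 z - a2 * H2 z).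
  move=> ha1 ha2; apply: boxH => z; exists (a1 * H1 z), (a2 * H2 z); have [/andP[H10 _] /andP[H20 _]] := H01 z.
  by split=> //; rewrite -ler_norml normrM; [rewrite (ger0_norm H10)|rewrite (ger0_norm H20)]; apply: ler_wpM2r.
have bumpI j : leb.-integrable setT (EFin \o F j) by have [] := bump_integral (x 0 j) e0 (wj j).
pose m := \prod_(j | j != i) \int[leb]_y F j y.
have m0 : 0 < m.
  by apply: prodr_gt0 => j ji; rewrite /F /w (negbTE ji); exact: bump_integral_gt0.
have hatI c := hat_integral c e0.
have intlin a1 a2 : integral_Rd (fun z => a1 * H1 z - a2 * H2 z) = (a1 - a2) * m.
  pose G j := if j == i then (fun y => a1 * hat (x 0 i) e y - a2 * hat (x 0 i + t) e y) else F j.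
  have ihat a c : leb.-integrable setT (EFin \o (fun y => a * hat c e y)).
    rewrite (_ : EFin \o _ = (fun y => a%:E * (EFin \o hat c e) y)%E); last exact/funext.
    by apply: integrableZl => //; have [] := hatI c.
  have iG j : leb.-integrable setT (EFin \o G j).
    rewrite /G; case: ifP => // _.
    rewrite (_ : EFin \o _ = (EFin \o (fun y => a1 * hat (x 0 i) e y)%R) \- (EFin \o (fun y => a2 * hat (x 0 i + t) e y)%R))%E//.
    by apply: integrableB.
  rewrite (_ : (fun z => _) = (fun z : 'rV[R]_d => 1 * \prod_j G j (z 0 j))); last first.
    apply/funext => z; rewrite mul1r (bigD1 i)//= {1}/G eqxx /H1 /H2.
    rewrite (eq_bigr (fun j => F j (z 0 j))); first by rewrite -/(b z); ring.
    by move=> j ji; rewrite /G (negbTE ji).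
  rewrite integral_Rd_prod// mul1r (bigD1 i)//= {1}/G eqxx; congr (_ * _).
    have hatZ a c : \int[leb]_y (a * hat c e y) = a.
      by have [ih Ih] := hatI c; rewrite RintegralZl// Ih mulr1.
    by rewrite (RintegralB _ (ihat a1 _) (ihat a2 _))// !hatZ.
  by apply: eq_bigr => j ji; rewrite /G (negbTE ji).
have intphi a : integral_Rd (fun z => a * phi z) = a * (\int[leb]_y F i y * m).
  by rewrite integral_Rd_prod// (bigD1 i).
have boxphi (u : 'rV[R]_d -> R) : (forall z, `|u z| <= C * phi z) -> boxed_Rd rho C u.
  move=> hu; split=> [z|z j hz].
    by apply: le_trans (hu z) _; have /andP[_ p1] := phi01 z; rewrite ler_piMr.
  by have [p0 _] := zero_out z j hz; have := hu z; rewrite p0 mulr0 normr_le0 => /eqP.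
have normCphi z : `|C * phi z| <= C * phi z by have /andP[p0 _] := phi01 z; rewrite ger0_norm// mulr_ge0.
have gphi z : `|g z 0 i * phi z| <= C * phi z.
  have /andP[p0 _] := phi01 z; rewrite normrM (ger0_norm p0); apply: ler_wpM2r => //.
  exact: le_trans (coord_le _ _) (gC z).
have J2 : \int[leb]_y F i y <= t + 2.
  have [_ h] := bump_integral (x 0 i) e0 (wj i); apply: le_trans h _; rewrite /w eqxx; clear -e1; lra.
have [_ mon1] := integral_Rd_boxed rho0 (boxphi _ gphi).
have up := mon1 _ (boxphi _ normCphi) (fun z => le_trans (ler_norm _) (gphi z)).
have boxN : boxed_Rd rho C (fun z => - C * phi z) by apply: boxphi => z; rewrite mulNr normrN.
have [_ mon2] := integral_Rd_boxed rho0 boxN.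
have lo : integral_Rd (fun z => - C * phi z) <= integral_Rd (fun z => g z 0 i * phi z).
  apply: mon2; first exact: boxphi.
  by move=> z; have := gphi z; rewrite ler_norml mulNr => /andP[].
rewrite intphi in up; rewrite intphi in lo.
have id := wg phi i phiC.
have na1 : `|psi x - 1| <= `|psi x| + 1 by apply: le_trans (ler_normB _ _) _; rewrite normr1.
have na2 : `|psi x + 1| <= `|psi x| + 1 by apply: le_trans (ler_normD _ _) _; rewrite normr1.
have nb1 : `|psi y2 - 1| <= `|psi y2| + 1 by apply: le_trans (ler_normB _ _) _; rewrite normr1.
have nb2 : `|psi y2 + 1| <= `|psi y2| + 1 by apply: le_trans (ler_normD _ _) _; rewrite normr1.
have [_ mon3] := integral_Rd_boxed rho0 (boxlin _ _ na1 nb2).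
have [_ mon4] := integral_Rd_boxed rho0 boxpsi.
have gE z : psi z * grad phi z 0 i = psi z * H1 z - psi z * H2 z by rewrite gradphi /H1 /H2; ring.
have lo2 : (psi x - 1 - (psi y2 + 1)) * m <= integral_Rd (fun z => psi z * grad phi z 0 i).
  rewrite -intlin; apply: mon3 => // z.
  by rewrite gE; have /andP[p1 _] := psi1 z; have /andP[_ q2] := psi2 z; exact: lerB.
have up2 : integral_Rd (fun z => psi z * grad phi z 0 i) <= (psi x + 1 - (psi y2 - 1)) * m.
  rewrite -intlin; apply: mon4; first exact: boxlin.
  by move=> z; rewrite gE; have /andP[_ p2] := psi1 z; have /andP[q1 _] := psi2 z; exact: lerB.
have Jm : C * (\int[leb]_y F i y * m) <= C * (t + 2) * m.
  by rewrite mulrA; apply: ler_wpM2r; [exact: ltW|exact: ler_wpM2l].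
rewrite ler_norml; apply/andP; split; rewrite -(ler_pM2r m0); move: id lo up lo2 up2 Jm; rewrite mulNr; clear;
  move: (integral_Rd _) (integral_Rd _) (\int[leb]_y _) => I1 I2 I3 ->; lra.
Qed.

(** From 0 to x one coordinate at a time; each of the d increments has length at most |x|. *)
Lemma bounded_gradient_growth (psi : 'rV[R]_d -> R) : bounded_gradient psi ->
  exists2 C, 0 <= C & forall x, `|psi x| <= C * (1 + enorm x).
Proof.
move=> [cpsi [g [_ [C hC] wg]]].
have C0 : 0 <= C := le_trans (enorm_ge0 _) (hC 0).
have inc (x : 'rV[R]_d) (i : 'I_d) (t : R) : `|psi (x + t *: delta_mx 0 i) - psi x| <= C * (`|t| + 2) + 2.
  have [t0|t0] := leP 0 t; first by rewrite (ger0_norm t0); exact: bounded_gradient_increment wg t0.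
  have nt : 0 <= - t by rewrite oppr_ge0 ltW.
  have := bounded_gradient_increment (x + t *: delta_mx 0 i) i cpsi hC wg nt.
  by rewrite scaleNr addrK distrC (ltr0_norm t0).
have sum (x : 'rV[R]_d) (S : seq 'I_d) : `|psi (\sum_(j <- S) x 0 j *: delta_mx 0 j) - psi 0| <=
    (size S)%:R * (C * (enorm x + 2) + 2).
  elim: S => [|j S IH]; first by rewrite big_nil subrr normr0 mul0r.
  rewrite big_cons (addrC (x 0 j *: _)); set y := \sum_(_ <- _) _ in IH *.
  rewrite (_ : psi _ - psi 0 = (psi (y + x 0 j *: delta_mx 0 j) - psi y) + (psi y - psi 0)); last by ring.
  apply: le_trans (ler_normD _ _) _; rewrite /= -natr1 mulrDl mul1r addrC; apply: lerD => //.
  apply: le_trans (inc _ _ _) _; rewrite lerD2r; apply: ler_wpM2l => //; rewrite lerD2r; exact: coord_le.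
exists (`|psi 0| + d%:R * (2 * C + 2)); first by rewrite addr_ge0// mulr_ge0// addr_ge0// mulr_ge0.
move=> x; have := sum x (index_enum 'I_d).
rewrite -(row_sum_delta x) (_ : size _ = d); last by rewrite -[RHS]card_ord cardE enumT.
move=> h; rewrite (_ : psi x = (psi x - psi 0) + psi 0); last by rewrite subrK.
apply: le_trans (ler_normD _ _) _; apply: le_trans (lerD h (lexx _)) _.
have := enorm_ge0 x; have := normr_ge0 (psi 0); have : 0 <= d%:R :> R by [].
move: (enorm x) `|psi 0| (d%:R : R) => p q n n0 q0 p0.
have := mulr_ge0 n0 p0; have := mulr_ge0 q0 p0; have := mulr_ge0 (mulr_ge0 n0 C0) p0; lra.
Qed.

End growth.

(** * Transport along characteristics and viscosity *)

(** The curve has only a right tangent [v], so the first-order expansion of [phi] is evaluated along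
    it at a small q > 0 and divided by q. *)
Lemma diff_touching {R : realType} {V : normedModType R} (phi : V -> R) (z0 v : V) (zeta : R -> V) :
  differentiable phi z0 ->
  (forall e, 0 < e -> exists2 r, 0 < r & forall q, 0 < q < r -> `|zeta q - z0 - q *: v| <= e * q) ->
  (exists2 r, 0 < r & forall q, 0 < q < r -> phi z0 <= phi (zeta q)) ->
  0 <= 'd phi z0 v.
Proof.
move=> dphi hz [r1 r10 touch]; apply/ler_addgt0Pr => e e0.
have e2 : 0 < e / 2 by rewrite divr_gt0.
have [eta eta0 heta] : exists2 eta, 0 < eta & forall w, `|w| < eta -> `|'d phi z0 w| <= e / 2.
  have [dc _] := (diff_locallyP z0 phi).1 dphi.
  have := dc 0; rewrite /continuous_at linear0 => /(@cvgrPdist_le _ R^o) /(_ _ e2) /nbhs_ballP[eta /= eta0 h].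
  exists eta => // w we; have := h w; rewrite -ball_normE/= sub0r normrN => /(_ we).
  by rewrite sub0r normrN.
have v1 : 0 < `|v| + 1 by rewrite ltr_wpDl.
have := diff_locally dphi => /eqaddoP /(_ _ (divr_gt0 e2 v1)) /nbhs_ballP[r2 /= r20 hr2].
pose k := Order.min (eta / 2) 1.
have k0 : 0 < k by rewrite lt_min divr_gt0//=.
have [r3 r30 hr3] := hz k k0.
pose rr := Order.min r1 (Order.min r3 (r2 / (`|v| + 1))).
have rr0 : 0 < rr by rewrite !lt_min r10 r30 divr_gt0.
pose q := rr / 2; have q0 : 0 < q by rewrite divr_gt0.
have qrr : q < rr by rewrite ltr_pdivrMr// ltr_pMr// ltr1n.
have [q1 q3 q2] : [/\ q < r1, q < r3 & q < r2 / (`|v| + 1)] by move: qrr; rewrite !lt_min => /and3P.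
pose w := q^-1 *: (zeta q - z0 - q *: v).
have wk : `|w| <= k.
  by rewrite normrZ normfV (gtr0_norm q0) ler_pdivrMl// mulrC; apply: hr3; rewrite q0.
have zE : zeta q = q *: (v + w) + z0.
  by rewrite /w scalerDr scalerA divff ?gt_eqF// scale1r [_ + (_ - _)]addrC subrK subrK.
have wv : `|v + w| <= `|v| + 1.
  apply: le_trans (ler_normD _ _) _; rewrite lerD2l; apply: le_trans wk _; by rewrite ge_min lexx orbT.
have hb : `|q *: (v + w)| <= q * (`|v| + 1) by rewrite normrZ (gtr0_norm q0) ler_pM2l.
have := hr2 (q *: (v + w)); rewrite -ball_normE/= sub0r normrN => /(_ _).
have hb2 : `|q *: (v + w)| < r2 by apply: le_lt_trans hb _; rewrite -ltr_pdivlMr.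
move=> /(_ hb2); rewrite !fctE /= -zE linearZ linearD /=.
have dw : `|'d phi z0 w| <= e / 2.
  apply: heta; apply: le_lt_trans wk _; rewrite gt_min; apply/orP; left.
  by rewrite ltr_pdivrMr// ltr_pMr// ltr1n.
have small : e / 2 / (`|v| + 1) * `|q *: (v + w)| <= q * (e / 2).
  rewrite mulrAC ler_pdivrMr// (_ : q * (e / 2) * _ = e / 2 * (q * (`|v| + 1))); last by ring.
  exact: (ler_wpM2l (ltW e2) hb).
have tq := touch q; rewrite q0 q1 in tq; have {}tq := tq isT.
move=> h; have {h} := le_trans h small; rewrite ler_norml => /andP[_ h].
move: dw; rewrite ler_norml => /andP[_ dw].
have dD : 'd phi z0 (v + w) = 'd phi z0 v + 'd phi z0 w by exact: linearD.
rewrite -(ler_pM2l q0) mulr0; move: h; rewrite dD /GRing.scale/=.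
have := ler_wpM2l (ltW q0) dw; move: tq.
move: ('d phi z0 v) ('d phi z0 w) (phi (zeta q)) (phi z0) => x1 x2 x3 x4; lra.
Qed.

Lemma within_slab_continuous {R : realType} {d : nat} {V : normedModType R} (tau : R) (f : R * 'rV[R]_d -> V) :
  (forall z e, slab tau z -> 0 < e -> exists2 r, 0 < r & forall z', slab tau z' ->
     `|z.1 - z'.1| < r -> enorm (z.2 - z'.2) < r -> `|f z - f z'| <= e) ->
  {within slab tau, continuous f}.
Proof.
move=> hf; apply/subspace_continuousP => z hz; apply/cvgrPdist_le => e e0.
have [r r0 hr] := hf z e hz e0.
have : nbhs z.2 [set y | enorm (z.2 - y) < r] by apply/nbhs_enormP; exists r.
move=> h2; have h1 : nbhs z.1 (ball z.1 r) by exact: nbhsx_ballx.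
exists (ball z.1 r, [set y | enorm (z.2 - y) < r]); first by split.
by move=> [s y] /= [h3 h4] hs; exact: hr.
Qed.

Section flow_dist.
Context {R : realType} {d : nat} (b : R -> 'rV[R]_d -> 'rV[R]_d) (T : R).
Hypothesis T0 : 0 <= T.
Hypothesis bmono : forall t x y, 0 <= t <= T -> 0 <= dotp (b t x - b t y) (x - y).
Hypothesis bbound : forall rho, exists2 M, 0 <= M & forall t x, 0 <= t <= T -> enorm x <= rho ->
  enorm (b t x) <= M.
Hypothesis bunif : forall rho e, 0 < e -> exists2 c, 0 < c & forall t t' x y, 0 <= t <= T -> 0 <= t' <= T ->
  enorm x <= rho -> enorm y <= rho -> `|t - t'| <= c -> enorm (x - y) <= c -> enorm (b t x - b t' y) <= e.

(** The trajectory that starts earlier is followed up to the later start, which costs [L] times the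
    delay; from there on the flow contracts. *)
Lemma flow_start_dist rho : 0 <= rho -> exists2 L, 0 <= L & forall a a' x x' t, 0 <= a -> 0 <= a' ->
  a <= t <= T -> a' <= t <= T -> enorm x <= rho -> enorm x' <= rho ->
  enorm (flow b T a x t - flow b T a' x' t) <= L * `|a - a'| + enorm (x - x').
Proof.
move=> rho0; have [L L0 hL] := flow_lipschitz T0 bmono bbound bunif rho0.
exists L => //; have ord a a' x x' t : 0 <= a -> a <= a' -> a' <= t <= T -> enorm x <= rho ->
    enorm (flow b T a x t - flow b T a' x' t) <= L * `|a - a'| + enorm (x - x').
  move=> a0 aa atT xr; have /andP[a't tT] := atT; have a'0 := le_trans a0 aa.
  rewrite -(flow_semigroup T0 bmono bbound bunif x a0 aa a't tT).
  apply: le_trans (flow_contract T0 bmono bbound bunif _ _ a'0 atT) _.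
  rewrite (_ : _ - x' = (flow b T a x a' - x) + (x - x')); last by rewrite addrA subrK.
  apply: le_trans (enormD _ _) _; rewrite lerD2r distrC ger0_norm ?subr_ge0//.
  by apply: hL => //; rewrite aa (le_trans a't).
move=> a a' x x' t a0 a'0 at1 at2 xr xr'.
have [aa|aa] := leP a a'; first exact: ord.
by rewrite enormC (enormC x) distrC; apply: ord => //; exact: ltW.
Qed.

(** By contraction a trajectory stays within |x| of the one issued from the origin, which is bounded
    on [0, T]. *)
Lemma flow_growth : exists2 L, 0 <= L & forall a x t, 0 <= a -> a <= t <= T -> enorm (flow b T a x t) <= enorm x + L.
Proof.
have [L L0 hL] := flow_lipschitz T0 bmono bbound bunif (lexx 0).
exists (L * T); first by rewrite mulr_ge0.
move=> a x t a0 atT; have /andP[at1 tT] := atT.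
rewrite (_ : flow b T a x t = (flow b T a x t - flow b T a 0 t) + flow b T a 0 t); last by rewrite subrK.
apply: le_trans (enormD _ _) _; apply: lerD.
  by rewrite -{2}(subr0 x); exact: flow_contract.
have := hL a 0 t a0 atT; rewrite enorm0 subr0 => /(_ (lexx 0)) /le_trans; apply.
by apply: ler_wpM2l => //; lra.
Qed.

End flow_dist.

Section characteristics.
Context {R : realType} {d : nat} (b : R -> 'rV[R]_d -> 'rV[R]_d) (T : R).
Hypothesis T0 : 0 <= T.
Hypothesis bmono : forall t x y, 0 <= t <= T -> 0 <= dotp (b t x - b t y) (x - y).
Hypothesis bbound : forall rho, exists2 M, 0 <= M & forall t x, 0 <= t <= T -> enorm x <= rho ->
  enorm (b t x) <= M.
Hypothesis bunif : forall rho e, 0 < e -> exists2 c, 0 < c & forall t t' x y, 0 <= t <= T -> 0 <= t' <= T ->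
  enorm x <= rho -> enorm y <= rho -> `|t - t'| <= c -> enorm (x - y) <= c -> enorm (b t x - b t' y) <= e.
Variables (tau : R) (tauT : 0 <= tau <= T).

Definition transport (psi0 : 'rV[R]_d -> R) (z : R * 'rV[R]_d) : R :=
  psi0 (flow b T (tau - z.1) z.2 tau).

Let slabP (z : R * 'rV[R]_d) : slab tau z -> [/\ 0 <= z.1, z.1 <= tau, 0 <= tau - z.1, tau - z.1 <= tau & tau - z.1 <= T].
Proof.
rewrite /slab/= in_itv/= => /andP[z0 zt]; have /andP[t0 tT] := tauT.
by split => //; lra.
Qed.

Lemma transport_continuous psi0 : continuous psi0 -> {within slab tau, continuous (transport psi0)}.
Proof.
move=> cpsi; apply: (@within_slab_continuous _ _ R^o) => z e /slabP[z0 zt tz tz' tzT] e0.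
have := cpsi (flow b T (tau - z.1) z.2 tau) => /(@cvgrPdist_le _ R^o) /(_ _ e0) /nbhs_enormP[r r0 hr].
have rho0 : 0 <= enorm z.2 + 1 by rewrite addr_ge0// enorm_ge0.
have [L L0 hL] := flow_start_dist T0 bmono bbound bunif rho0.
exists (Order.min 1 (r / (L + 2))); first by rewrite lt_min ltr01 divr_gt0// ltr_wpDl.
move=> z' /slabP[z'0 z't' tz2 tz2' tz2T]; rewrite !lt_min => /andP[_ h1] /andP[h2 h3].
apply: hr; have /andP[t0 tT] := tauT.
have q1 : tau - z.1 <= tau <= T by rewrite tz' tT.
have q2 : tau - z'.1 <= tau <= T by rewrite tz2' tT.
have x1 : enorm z.2 <= enorm z.2 + 1 by rewrite lerDl.
have x2 : enorm z'.2 <= enorm z.2 + 1.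
  rewrite (_ : z'.2 = z.2 - (z.2 - z'.2)); last by rewrite opprB addrC subrK.
  by apply: le_trans (enormD _ _) _; rewrite enormN lerD2l ltW.
apply: le_lt_trans (hL _ _ _ _ _ tz tz2 q1 q2 x1 x2) _.
have L2 : 0 < L + 2 by rewrite ltr_wpDl.
move: h1 h3; rewrite !ltr_pdivlMr//.
rewrite (_ : tau - z.1 - (tau - z'.1) = - (z.1 - z'.1)) ?normrN; last by ring.
have := normr_ge0 (z.1 - z'.1); have := enorm_ge0 (z.2 - z'.2).
move: `|_| (enorm _) => p q q0 p0; nra.
Qed.

Lemma transport_characteristic psi0 z q : slab tau z -> 0 <= q <= z.1 ->
  transport psi0 (z.1 - q, flow b T (tau - z.1) z.2 (tau - z.1 + q)) = transport psi0 z.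
Proof.
move=> /slabP[z0 zt tz tz' tzT] /andP[q0 qz]; rewrite /transport /=; congr psi0.
have -> : tau - (z.1 - q) = tau - z.1 + q by ring.
have /andP[t0 tT] := tauT.
by apply: (flow_semigroup T0 bmono bbound bunif) => //; lra.
Qed.

Lemma transport_touching psi0 (z : R * 'rV[R]_d) (U : set (R * 'rV[R]_d)) (phi : R * 'rV[R]_d -> R) :
  0 < z.1 <= tau -> open U -> U z -> differentiable phi z ->
  (forall y, U y -> slab tau y -> transport psi0 y <= phi y) -> phi z = transport psi0 z ->
  dtime phi z <= dotp (- b (tau - z.1) z.2) (dspace phi z).
Proof.
move=> /andP[z0 zt] oU Uz dphi touch eqz.
have hz : slab tau z by rewrite /slab/= in_itv/= (ltW z0).
have [_ _ tz tz' tzT] := slabP hz; have /andP[t0 tT] := tauT.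
pose a := tau - z.1; pose v := b a z.2.
(* The flow runs forward in its own time while s decreases, so this arc starts at [z] in the
   direction (-1, - v) and stays in the slab for q <= z.1: hence the restriction to tested points
   with positive time. *)
pose zeta q : R * 'rV[R]_d := (z.1 - q, flow b T a z.2 (a + q)).
have aT : 0 <= a < T by apply/andP; split => //; rewrite /a; lra.
have fd := flow_right_deriv T0 bmono bbound bunif z.2 aT.
have zc e : 0 < e -> exists2 r, 0 < r & forall q, 0 < q < r -> `|zeta q - z - q *: (-1, - v)| <= e * q.
  move=> e0; have [r r0 hr] := fd e e0; exists (Order.min r z.1); first by rewrite lt_min r0.
  move=> q /andP[q0]; rewrite lt_min => /andP[qr qz].
  have eq0 : 0 <= e * q by rewrite mulr_ge0 ?ltW.
  rewrite /Num.norm/= ge_max; apply/andP; split.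
    by rewrite /= /GRing.scale/= (_ : _ - _ = 0) ?normr0//; ring.
  rewrite /=; apply: le_trans (mx_norm_le_enorm _) _.
  have := hr (a + q); rewrite ltrDl q0 ltrD2l qr flow_start (_ : a + q - a = q); last by ring.
  by apply=> //; rewrite /a; lra.
have Unear : exists2 r, 0 < r & forall q, 0 < q < r -> U (zeta q).
  have : nbhs z U by exact: open_nbhs_nbhs.
  move=> /nbhs_ballP[r /= r0 hr].
  have [r1 r10 h1] := zc 1 ltr01.
  pose m := `|(-1, - v) : R * 'rV[R]_d| + 1.
  have m0 : 0 < m by rewrite ltr_wpDl.
  exists (Order.min r1 (r / m)); first by rewrite lt_min r10 divr_gt0.
  move=> q /andP[q0]; rewrite lt_min => /andP[qr1 qm]; apply: hr; rewrite -ball_normE/= distrC.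
  rewrite (_ : zeta q - z = (zeta q - z - q *: (-1, - v)) + q *: (-1, - v)); last by rewrite subrK.
  apply: le_lt_trans (ler_normD _ _) _.
  have h2 : `|zeta q - z - q *: (-1, - v)| <= 1 * q by apply: h1; rewrite q0.
  apply: le_lt_trans (lerD h2 (lexx _)) _; rewrite normrZ (gtr0_norm q0) mul1r.
  by move: qm; rewrite ltr_pdivlMr// /m mulrDr mulr1; move: `|(-1, - v) : R * 'rV[R]_d| => p; rewrite addrC.
have ge0 : 0 <= 'd phi z (-1, - v).
  apply: (diff_touching dphi zc).
  have [r r0 hr] := Unear; exists (Order.min r z.1); first by rewrite lt_min r0.
  move=> q /andP[q0]; rewrite lt_min => /andP[qr qz].
  have Uq : U (zeta q) by apply: hr; rewrite q0.
  rewrite eqz -(transport_characteristic psi0 hz (_ : 0 <= q <= z.1)); last by rewrite !ltW.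
  apply: touch => //; rewrite /slab/= in_itv/=; lra.
have dE : 'd phi z (-1, - v) = - dtime phi z - dotp v (dspace phi z).
  have sumE : \sum_(i < d) v 0 i *: ((0, delta_mx 0 i) : R * 'rV[R]_d) = (0, v).
    rewrite [in RHS](row_sum_delta v) (big_morph (fun x : 'rV[R]_d => (0, x) : R * 'rV[R]_d) (id1 := 0) (op1 := +%R))//.
      by apply: eq_bigr => i _; rewrite -[LHS]/(v 0 i * 0, v 0 i *: delta_mx 0 i) mulr0.
    by move=> x y; rewrite -[RHS]/(0 + 0, x + y) addr0.
  have -> : (-1, - v) = - ((1, 0) : R * 'rV[R]_d) - \sum_(i < d) v 0 i *: ((0, delta_mx 0 i) : R * 'rV[R]_d).
    by rewrite sumE -[RHS]/(- 1 - 0, - 0 - v) subr0 oppr0 sub0r.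
  rewrite linearB linearN linear_sum /dtime deriveE; last exact: dphi.
  congr (_ - _); apply: eq_bigr => i _; rewrite linearZ /= /dspace mxE deriveE; [by []|exact: dphi].
by move: ge0; rewrite dE dotpNl; lra.
Qed.

Lemma transport_viscosity psi0 : continuous psi0 ->
  {within slab tau, continuous (fun z => - b (tau - z.1) z.2)} ->
  viscosity_solution tau (fun z => - b (tau - z.1) z.2) (transport psi0).
Proof.
move=> cpsi cb; split => //; first exact: transport_continuous.
  move=> z hz U phi oU Uz [[dphi _] _] touch eqz.
  exact: (transport_touching hz oU Uz (dphi z Uz) touch eqz).
move=> z hz U phi oU Uz [[dphi _] _] touch eqz.
(* The super-solution case is the sub-solution one for [- psi0] and [- phi], as transport commutes
   with the change of sign. *)
have dz := dphi z Uz; have dN : differentiable (- phi) z by exact: differentiableN.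
have touchN y : U y -> slab tau y -> transport (fun x => - psi0 x) y <= (- phi) y.
  by move=> Uy hy; rewrite /transport/= lerN2; exact: touch.
have eqN : (- phi) z = transport (fun x => - psi0 x) z.
  by rewrite -[LHS]/(- phi z) eqz.
have := transport_touching hz oU Uz dN touchN eqN.
have dt : dtime (- phi) z = - dtime phi z by rewrite /dtime deriveN//; exact: diff_derivable.
have -> : dspace (- phi) z = - dspace phi z.
  apply/rowP => i; rewrite [LHS]mxE [RHS]mxE [X in _ = - X]mxE; apply: deriveN; exact: diff_derivable dz.
by rewrite dt dotpNr lerN2.
Qed.

End characteristics.

(** * Moments, duality and conclusion *)

Lemma compactly_supported_supp_in {R : realType} {d : nat} (mu : probability (borelRd R d) R) :
  compactly_supported mu -> exists2 r, 0 <= r & supp_in r mu.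
Proof.
move=> [K cK K0]; have [M [_ hM]] := compact_bounded cK.
pose r := d%:R * (`|M| + 1); have r0 : 0 <= r by rewrite mulr_ge0// addr_ge0.
exists r => //; apply/eqP; rewrite -measure_le0 -[leRHS]K0; apply: le_measure; rewrite ?inE.
- by apply: (@measurable_enorm_gt _ _ _ _ (fun x : borelRd R d => x)); exact: measurable_id.
- apply: measurableC; apply: closed_measurableRd; apply: compact_closed cK; exact: norm_hausdorff.
- move=> x /= xr Kx; apply: xr; apply: enorm_le_bound => i.
  apply: le_trans (coord_le_mx_norm _ _) _; apply: hM => //.
  by apply: le_lt_trans (ler_norm _) _; rewrite ltrDl.
Qed.

Lemma supp_in_finite_moment1 {R : realType} {d : nat} r (mu : probability (borelRd R d) R) : 0 <= r ->
  supp_in r mu -> finite_moment 1 mu.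
Proof.
move=> r0 hr; rewrite /finite_moment.
have mn : measurable_fun setT (fun x : borelRd R d => enorm (x : 'rV[R]_d)) by apply: measurable_enorm; exact: measurable_id.
under eq_integral do rewrite powRr1 ?enorm_ge0//.
rewrite (is_law_integral (is_law_clip (is_law_id mu) hr))//; last 2 first.
- exact/measurable_EFinP.
- by move=> x; rewrite lee_fin enorm_ge0.
apply: (@le_lt_trans _ _ (\int[mu]_x (cst r%:E x))%E).
  apply: ge0_le_integral_EFin => //.
  - exact: (measurableT_comp mn (measurable_clip r)).
  - by move=> x; exact: enorm_ge0.
  - by move=> x; exact: clip_le.
by rewrite (integral_cst_probability mu r%:E) ltry.
Qed.

Section duality.
Context {R : realType} {d : nat} (s : R) (W : 'rV[R]_d -> R).
Hypothesis hs : 0 < s.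
Hypothesis hWeven : forall x, W (- x) = W x.
Hypothesis hWconvex : convex_function setT W.
Hypothesis hWreg : C1_holder_loc s W.
Local Notation Rd := (borelRd R d).
Variables (T r : R) (u : R -> Pp R d 2).
Hypothesis T0 : 0 < T.
Hypothesis rr : 0 <= r.
Hypothesis hu : continuous_curve (@wasserstein R d 2) T u.
Hypothesis hr : forall t, 0 <= t <= T -> supp_in r (sval (u t)).

Lemma field_defined t : 0 <= t <= T -> conv_grad_defined W (sval (u t)).
Proof.
move=> tT x i.
have mc := @measurable_clip R d r.
apply/(is_law_integrable (is_law_clip (is_law_id (sval (u t))) (hr tT))).
  by apply/measurable_EFinP; exact: (measurable_gradW_sub hWreg x i (@measurable_id _ Rd setT)).
exact: (gradW_integrable hs hWreg (sval (u t)) x i mc (fun y => clip_le y rr)).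
Qed.

Let bmono := field_mono hs hWconvex hWreg rr hr.
Let bbound := field_bound hs hWreg rr hr.
Let bunif := field_unif hs hWreg hu hr.

Lemma field_slab_continuous tau : 0 <= tau <= T ->
  {within slab tau, continuous (fun z => - field W u (tau - z.1) z.2)}.
Proof.
move=> tauT; apply: within_slab_continuous => z e hz e0.
have [c c0 hc] := bunif (enorm z.2 + 1) e0.
exists (Order.min 1 c); first by rewrite lt_min ltr01.
move=> z' hz'; rewrite !lt_min => /andP[_ h1] /andP[h2 h3].
have tT (y : R * 'rV[R]_d) : slab tau y -> 0 <= tau - y.1 <= T.
  by rewrite /slab/= in_itv/= => /andP[y0 yt]; have /andP[q0 qT] := tauT; apply/andP; split; lra.
rewrite -opprD normrN; apply: le_trans (mx_norm_le_enorm _) _; apply: hc.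
- exact: tT.
- exact: tT.
- by rewrite lerDl.
- rewrite (_ : z'.2 = z.2 - (z.2 - z'.2)); last by rewrite opprB addrC subrK.
  by apply: le_trans (enormD _ _) _; rewrite enormN lerD2l ltW.
- rewrite (_ : tau - z.1 - (tau - z'.1) = - (z.1 - z'.1)); last by ring.
  by rewrite normrN ltW.
- exact: ltW.
Qed.

Lemma transport_linear_growth tau psi0 : 0 <= tau <= T -> bounded_gradient psi0 ->
  linear_growth tau (transport (field W u) T tau psi0).
Proof.
move=> tauT hpsi; have [cpsi _] := hpsi; have [C C0 hC] := bounded_gradient_growth hpsi.
have [L L0 hL] := flow_growth (ltW T0) bmono bbound bunif.
split; first exact: (transport_continuous (ltW T0) bmono bbound bunif tauT).
exists (C * (1 + L)) => q x /andP[q0 qtau]; have /andP[t0 tT] := tauT.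
have x1 : 0 < 1 + enorm x by rewrite ltr_pwDl// enorm_ge0.
rewrite normrM normfV (gtr0_norm x1) ler_pdivrMr//.
apply: le_trans (hC _) _; rewrite -mulrA; apply: ler_wpM2l => //.
have tq : 0 <= tau - q by lra.
have tq' : tau - q <= tau <= T by apply/andP; split; lra.
have := hL (tau - q) x tau tq tq'; have := mulr_ge0 L0 (enorm_ge0 x); rewrite /=; lra.
Qed.

End duality.

Theorem theorem6p1 (R : realType) (d : nat) (T s : R) (W : 'rV[R]_d -> R)
    (mu0 : Pp R d 2) (mu : R -> Pp R d 2)
    (hT : 0 < T)
    (hs : 0 < s <= 1)
    (hmu0 : compactly_supported (sval mu0))
    (hWeven : forall x, W (- x) = W x)
    (hWconvex : convex_function setT W)
    (hWreg : C1_holder_loc s W)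
    (hmu : gradient_flow T W mu0 mu) :
  dual_viscosity_solution T W (fun t => sval (mu t)).
Proof.
have [s0 _] := andP hs; have [mu00 cmu slope] := hmu.
have [r0 r00 smu0] := compactly_supported_supp_in hmu0.
have m0 : sval (mu 0) = sval mu0 by rewrite mu00.
have [r rr hr] := curve_supp s0 hWeven hWconvex hWreg hT r00 cmu slope m0 smu0.
have bmono := field_mono s0 hWconvex hWreg rr hr.
have bbound := field_bound s0 hWreg rr hr.
have bunif := field_unif s0 hWreg cmu hr.
split; first by move=> t tT; exact: (field_defined s0 hWreg rr hr tT).
exists (transport (field W mu) T) => tau tauT; split.
(* Transport is composition with the initial datum, so linearity holds by computation. *)
- by [].
- move=> psi0 hpsi; have [cpsi _] := hpsi; split.
  + exact: (transport_linear_growth s0 hWconvex hWreg hT rr cmu hr tauT hpsi).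
  + apply: (transport_viscosity (ltW hT) bmono bbound bunif tauT cpsi).
    exact: (field_slab_continuous s0 hWreg cmu hr tauT).
  + by move=> x; rewrite /transport /= subr0 flow_start.
- exact: supp_in_finite_moment1 rr (hr tau tauT).
- move=> psi0 [cpsi _].
  have lF := flow_law s0 hWeven hWconvex hWreg hT r00 cmu slope m0 smu0 rr hr tauT.
  rewrite (is_law_integral_EFin lF (continuous_measurableRd cpsi)) m0.
  (* At s = tau the characteristic starts at time 0, so the integrand is [psi0] composed with the
     flow from 0 to tau. *)
  by apply: eq_integral => x _; rewrite /transport /= subrr.
Qed.
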